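(* Let $W=\overline B(0,1)$ be the closed Euclidean unit ball of $\mathbb{R}^d$. Let $k\ge1$ and let $\varphi\in\mathcal C^2([0,1],\mathbb{R}^+)$ satisfy $\inf_{t\in[0,1]}\varphi(t)>0$ and $\varphi'(1)=0$. Define the positive Poisson functional $F_k$ by $$\sqrt{F_k}=\sum_{n\ge k}\mathbf 1(N(W)=n)\,\varphi(\|X_{(k),n}\|^2)+\varphi(1)\mathbf 1(N(W)<k).$$ Then $\zeta_k=\nabla\log F_k$ is an element of $\mathrm{Dom}(\overline D)$. Moreover, the Stein estimator $\widehat\theta_k=\widehat\theta_{\mathrm{MLE}}+\frac1{|W|}\zeta_k$ (with $\widehat\theta_{\mathrm{MLE}}=N(W)/|W|$), its mean squared error and its gain with respect to $\widehat\theta_{\mathrm{MLE}}$ are given by $$\widehat\theta_k=\widehat\theta_{\mathrm{MLE}}-\frac4{d|W|}\,\frac{Y_{(k)}\,\varphi'(Y_{(k)})}{\varphi(Y_{(k)})},$$ $$\mathrm{MSE}(\widehat\theta_k)=\mathrm{MSE}(\widehat\theta_{\mathrm{MLE}})-\frac{16}{d^2|W|^2}\,\mathbb{E}\left[\mathcal G(Y_{(k)})\right],$$ $$\mathrm{Gain}(\widehat\theta_k)=\frac{\mathrm{MSE}(\widehat\theta_{\mathrm{MLE}})-\mathrm{MSE}(\widehat\theta_k)}{\mathrm{MSE}(\widehat\theta_{\mathrm{MLE}})}=\frac{16}{\theta d^2|W|}\,\mathbb{E}\left[\mathcal G(Y_{(k)})\right],$$ where $$Y_{(k)}=1+(\|X_{(k)}\|^2-1)\mathbf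 1(\|X_{(k)}\|\le1),$$ that is, $Y_{(k)}=\|X_{(k)}\|^2$ if $\|X_{(k)}\|\le1$ and $Y_{(k)}=1$ otherwise, and $\mathcal G(t)=-t\,(\varphi'(t)+t\varphi''(t))/\varphi(t)$.
   Context: Point process. $\mathbf X$ is a homogeneous Poisson point process on $\mathbb{R}^d$ with intensity $\theta>0$, $W=\overline B(0,1)$, $|W|$ is its Lebesgue measure, $N(W)$ is the number of points of $\mathbf X\cap W$, and given $N(W)=n$ these points are denoted $X_1,\dots,X_n$. For $x_1,\dots,x_n\in W$ and $1\le k\le n$, $x_{(k),n}$ denotes the $k$-th closest point of $\{x_1,\dots,x_n\}$ to $0$ (so $X_{(k),n}$ is the $k$-th closest to $0$ among $X_1,\dots,X_n$), and $X_{(k)}$ denotes the $k$-th closest point of $\mathbf X$ to $0$ (possibly outside $W$). $L^2(\Omega)=L^2(\Omega,\mathcal F_W,\mathbb P)$ with $\mathcal F_W$ the $\sigma$-field generated by the points of $\mathbf X$ in $W$. $\mathrm{MSE}(T)=\mathbb{E}[(T-\theta)^2]$. Functionals. $\mathcal S$ is the set of $F=f_0\mathbf 1(N(W)=0)+\sum_{n\ge1}\mathbf 1(N(W)=n)f_n(X_1,\dots,X_n)$ with $f_0\in\mathbb{R}$ and each $f_n\in L^1(W^n,\mathbb{R})$ symmetric (form functions). $\mathcal S'$ is the set of $F\in\mathcal S$ for which there is $C>0$ such that for all $n\ge1$, $f_n\in\mathcal C^1(W^n,\mathbb{R})$ and $\|f_n\|_{L^\infty}+\sum_{i=1}^n\|\nabla_{x_i}f_n\|_{L^\infty}\le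 C^n$, where $\nabla_{x_i}$ is the gradient in the $i$-th variable $x_i\in\mathbb{R}^d$. $\mathrm{Dom}(D)$ is the set of $F\in\mathcal S'$ with $f_{n+1}(z_1,\dots,z_n,z_{n+1})=f_n(z_1,\dots,z_n)$ for all $n\ge1$, $z_1,\dots,z_n\in W$, $z_{n+1}\in\partial W$, and $f_1(z)=f_0$ for $z\in\partial W$. Operators. Fix an orthonormal family $(V_m)_{1\le m\le d}$ of bounded functions of $L^2(W,\mathbb{R})$ and let $V=d^{-1/2}(V_1,\dots,V_d)^\top$. For $F\in\mathrm{Dom}(D)$, $D_xF=-\sum_{n\ge1}\mathbf 1(N(W)=n)\sum_{i=1}^n(\nabla_{x_i}f_n)(X_1,\dots,X_n)\,(X_i^\top V(x))\in\mathbb{R}^d$ and $\nabla F=\int_WD_xF\cdot V(x)\,\mathrm dx=-\frac1d\sum_{n\ge1}\mathbf 1(N(W)=n)\sum_{i=1}^n\nabla_{x_i}f_n(X_1,\dots,X_n)\cdot X_i$. The operator $D:\mathrm{Dom}(D)\subset L^2(\Omega)\to L^2(\Omega,L^2(W,\mathbb{R}^d))$ is closable; $\mathrm{Dom}(\overline D)$ is the set of $F\in L^2(\Omega)$ for which there are $F_\ell\in\mathrm{Dom}(D)$ with $F_\ell\to F$ in $L^2(\Omega)$ and $DF_\ell$ convergent in $L^2(\Omega,L^2(W,\mathbb{R}^d))$; then $\nabla F:=\lim\nabla F_\ell$ in $L^2(\Omega)$. The functional $\log F_k$ lies in $\mathrm{Dom}(\overline D)$, so $\nabla\log F_k$ is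 well defined.
   Formalization: As printed, the MSE and Gain formulas fail when φ''(1)≠0 (e.g. d=k=1, φ(t)=1+(1−t)², θ→0); they are proved with E[G(Y_(k))1(‖X_(k)‖≤1)] in place of E[G(Y_(k))], and exactly as printed when φ''(1)=0. *)

(* Defs.v *)
From HB Require Import structures.
From mathcomp Require Export all_boot all_order all_algebra all_fingroup.
From mathcomp Require Export finmap.
From mathcomp Require Export all_classical all_reals all_analysis.

Set Implicit Arguments.
Unset Strict Implicit.
Unset Printing Implicit Defensive.

Import Order.TTheory GRing.Theory Num.Theory.
Export numFieldNormedType.Exports.

Local Open Scope classical_set_scope.
Local Open Scope ring_scope.

(* The product sigma-algebra on matrices, generated by the entries; for real
   entries this is the Borel sigma-algebra of R^(m * n). *)
Section measurable_matrix.
Context {disp : measure_display} {T : measurableType disp}.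
Variables m n : nat.

Definition mx_cylinders : set (set 'M[T]_(m, n)) :=
  [set A | exists ij : 'I_m * 'I_n, exists2 B : set T,
    measurable B & A = [set M : 'M[T]_(m, n) | B (M ij.1 ij.2)]].

Let mxC (A : set 'M[T]_(m, n)) :
  <<s mx_cylinders >> A -> <<s mx_cylinders >> (~` A).
Proof. by move=> mA; rewrite -setTD; exact: sigma_algebraCD. Qed.

HB.instance Definition _ := @isMeasurable.Build disp
  'M[T]_(m, n) <<s mx_cylinders >>
  (@sigma_algebra0 _ setT mx_cylinders) mxC
  (@sigma_algebra_bigcup _ setT mx_cylinders).

Lemma measurable_fun_mx d0 (S : measurableType d0) (f : S -> 'M[T]_(m, n)) :
  (forall i j, measurable_fun [set: S] (fun s => f s i j)) ->
  measurable_fun [set: S] f.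
Proof.
move=> mf; apply: (@measurability _ _ _ _ _ _ mx_cylinders) => //.
move=> _ [_ [[i j] [B mB ->]] <-]; exact: mf.
Qed.

Lemma measurable_mx_entry i j :
  measurable_fun [set: 'M[T]_(m, n)] (fun M => M i j).
Proof.
move=> _ B mB; rewrite setTI; apply: sub_sigma_algebra.
by exists (i, j), B.
Qed.

End measurable_matrix.

Section pushforward_sigma_finite.
Local Open Scope ereal_scope.
Context d1 d2 (T1 : measurableType d1) (T2 : measurableType d2) (R : realType).
Variables (mu : {measure set T1 -> \bar R}).
Variables (f : T1 -> T2) (g : T2 -> T1).
Hypotheses (mf : measurable_fun [set: T1] f) (mg : measurable_fun [set: T2] g).
Hypotheses (fK : cancel f g) (smu : sigma_finite [set: T1] mu).

(* The left inverse [g] only serves to transfer sigma-finiteness. *)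
Definition pushforward_can of cancel f g & measurable_fun [set: T1] f
    & measurable_fun [set: T2] g & sigma_finite [set: T1] mu :=
  pushforward mu f.

Local Notation nu := (pushforward_can fK mf mg smu).

Let nu0 : nu set0 = 0.
Proof. by rewrite /pushforward_can /pushforward preimage_set0 measure0. Qed.

Let nu_ge0 A : 0 <= nu A. Proof. exact: measure_ge0. Qed.

Let nu_sigma_additive : semi_sigma_additive nu.
Proof.
move=> F mF tF mUF; rewrite /pushforward_can /pushforward preimage_bigcup.
apply: measure_semi_sigma_additive.
- by move=> n; rewrite -[X in measurable X]setTI; exact: mf.
- apply/trivIsetP => /= i j _ _ ij; rewrite -preimage_setI.
  by move/trivIsetP : tF => /(_ _ _ _ _ ij) ->//; rewrite preimage_set0.
- by rewrite -preimage_bigcup -[X in measurable X]setTI; exact: mf.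
Qed.

HB.instance Definition _ := isMeasure.Build _ _ _ nu
  nu0 nu_ge0 nu_sigma_additive.

Let nu_sigma_finite : sigma_finite setT nu.
Proof.
have [F FT Foo] := smu.
exists (fun n => g @^-1` F n); first by rewrite -preimage_bigcup -FT preimage_setT.
move=> n; have [mF Fn] := Foo n; split.
  by rewrite -[X in measurable X]setTI; exact: mg.
rewrite /pushforward_can /pushforward -comp_preimage.
by rewrite (_ : g \o f = id)//; apply/funext => x /=; rewrite fK.
Qed.

HB.instance Definition _ := Measure_isSigmaFinite.Build _ _ _ nu
  nu_sigma_finite.

End pushforward_sigma_finite.

Lemma sigma_finite_product d1 d2 (T1 : measurableType d1)
    (T2 : measurableType d2) (R : realType)
    (m1 : {sigma_finite_measure set T1 -> \bar R})
    (m2 : {sigma_finite_measure set T2 -> \bar R}) :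
  sigma_finite setT (product_measure1 m1 m2).
Proof.
have /sigma_finiteP[F [TF ndF Foo]] := sigma_finiteT m1.
have /sigma_finiteP[G [TG ndG Goo]] := sigma_finiteT m2.
exists (fun n => F n `*` G n).
  rewrite -setXTT TF TG predeqE => -[x y]; split.
    move=> [/= [n _ Fnx] [k _ Gky]]; exists (maxn n k) => //; split.
    - by move: x Fnx; exact/subsetPset/ndF/leq_maxl.
    - by move: y Gky; exact/subsetPset/ndG/leq_maxr.
  by move=> [n _ []/= ? ?]; split; exists n.
move=> k; have [? ?] := Foo k; have [? ?] := Goo k.
split; first exact: measurableX.
by rewrite product_measure1E// lte_mul_pinfty// ge0_fin_numE.
Qed.

Section lebesgue_matrix.
Context {R : realType}.
Local Notation mR := (measurableTypeR R).

Let consp n (x : mR * n.-tuple mR) : n.+1.-tuple mR := cons_tuple x.1 x.2.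
Let unconsp n (t : n.+1.-tuple mR) : mR * n.-tuple mR :=
  (thead t, behead_tuple t).

Let conspK n : cancel (@consp n) (@unconsp n).
Proof.
by move=> [x t]; rewrite /unconsp /consp theadE; congr pair; exact/val_inj.
Qed.

Let measurable_consp n : measurable_fun setT (@consp n).
Proof. exact: measurable_cons. Qed.

Let measurable_unconsp n : measurable_fun setT (@unconsp n).
Proof.
apply/measurable_fun_pair; first exact: measurable_tnth.
exact: measurable_behead.
Qed.

Definition lebesgue_cons n
    (mu : {sigma_finite_measure set (n.-tuple mR) -> \bar R})
    : {sigma_finite_measure set (n.+1.-tuple mR) -> \bar R} :=
  pushforward_can (@conspK n) (@measurable_consp n) (@measurable_unconsp n)
    (sigma_finite_product lebesgue_measure mu).

Fixpoint lebesgue_tuple n : {sigma_finite_measure set (n.-tuple mR) -> \bar R} :=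
  if n is n'.+1 then lebesgue_cons (lebesgue_tuple n') else \d_([tuple] : 0.-tuple mR).

Variables m n : nat.

Let tuple_to_mx (t : (m * n).-tuple mR) : 'M[R]_(m, n) :=
  \matrix_(i, j) tnth t (mxvec_index i j).
Let mx_to_tuple (M : 'M[R]_(m, n)) : (m * n).-tuple mR :=
  [tuple mxvec M ord0 k | k < m * n].

Let tuple_to_mxK : cancel tuple_to_mx mx_to_tuple.
Proof.
move=> t; apply: eq_from_tnth => k; rewrite tnth_mktuple.
by case/mxvec_indexP: k => i j; rewrite mxvecE mxE.
Qed.

Let measurable_tuple_to_mx : measurable_fun setT tuple_to_mx.
Proof.
apply: measurable_fun_mx => i j.
rewrite (_ : (fun s => _) = (@tnth _ mR)^~ (mxvec_index i j)).
  exact: measurable_tnth.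
by apply/funext => t; rewrite mxE.
Qed.

Let measurable_mx_to_tuple : measurable_fun setT mx_to_tuple.
Proof.
apply/measurable_fun_tnthP => k.
case/mxvec_indexP: k => i j.
rewrite (_ : _ \o _ = fun M : 'M[R]_(m, n) => M i j).
  exact: measurable_mx_entry.
by apply/funext => M /=; rewrite tnth_mktuple mxvecE.
Qed.

Definition lebesgue_mx : {sigma_finite_measure set 'M[R]_(m, n) -> \bar R} :=
  pushforward_can tuple_to_mxK measurable_tuple_to_mx measurable_mx_to_tuple
    (sigma_finiteT (lebesgue_tuple (m * n))).

End lebesgue_matrix.

Lemma lebesgue_tuple_box (R : realType) n (B : 'I_n -> set (measurableTypeR R)) :
  (forall i, measurable (B i)) ->
  lebesgue_tuple n [set t | forall i, B i (tnth t i)] = (\prod_(i < n) lebesgue_measure (B i))%E.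
Proof.
elim: n B => [|n IH] B mB.
  rewrite big_ord0 /= diracE mem_set//= => -[].
  by [].
rewrite big_ord_recl -(IH (fun i => B (lift ord0 i)))//=.
rewrite -product_measure1E//; last first.
  rewrite (_ : [set _ | _] = \bigcap_(i in [set: 'I_n]) ((fun t : n.-tuple (measurableTypeR R) => tnth t i) @^-1` B (lift ord0 i))).
    apply: fin_bigcap_measurable => // i _; rewrite -[X in measurable X]setTI.
    by apply: (@measurable_tnth _ (measurableTypeR R)).
  by apply/seteqP; split => t /= h i; [move=> _|]; apply: h.
rewrite /lebesgue_cons /= /pushforward_can /pushforward; congr product_measure1.
apply/seteqP; split => -[x t] /=.
  move=> h; split; first by have := h ord0; rewrite tnth0.
  by move=> i; have := h (lift ord0 i); rewrite tnthS.
move=> [h0 h] i; case: (unliftP ord0 i) => [j|] ->; first by rewrite tnthS.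
by rewrite tnth0.
Qed.

Lemma lebesgue_mx_box (R : realType) m n (B : 'I_m -> 'I_n -> set R) :
  (forall i j, measurable (B i j)) ->
  lebesgue_mx m n [set M | forall i j, B i j (M i j)] =
    (\prod_(i < m) \prod_(j < n) lebesgue_measure (B i j : set (measurableTypeR R)))%E.
Proof.
move=> mB; pose C (k : 'I_(m * n)) := let ij := enum_val (cast_ord (esym (mxvec_cast m n)) k) in B ij.1 ij.2.
have CE i j : C (mxvec_index i j) = B i j.
  by rewrite /C /mxvec_index cast_ordK enum_rankK.
rewrite pair_bigA/=; transitivity (\prod_(k < m * n) lebesgue_measure (C k : set (measurableTypeR R)))%E; last first.
  rewrite (reindex _ (curry_mxvec_bij _ _))/=; apply: eq_bigr => -[i j] _ /=.
  by rewrite CE.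
rewrite -lebesgue_tuple_box; last by move=> k; exact: mB.
rewrite /lebesgue_mx /= /pushforward_can /pushforward; congr (_ _).
apply/seteqP; split => t /= h.
  move=> k; case/mxvec_indexP: k => i j; rewrite CE.
  by have := h i j; rewrite mxE.
by move=> i j; rewrite mxE -CE.
Qed.

Section euclidean.
Context {R : realType} {d : nat}.
Implicit Types x y : 'rV[R]_d.

Definition dotp x y : R := \sum_j x 0 j * y 0 j.

(* The library norm on matrices is the sup norm. *)
Definition enorm x : R := Num.sqrt (dotp x x).

Definition unit_ball : set 'rV[R]_d := [set x | enorm x <= 1].
Definition unit_sphere : set 'rV[R]_d := [set x | enorm x = 1].

Definition volume (A : set 'rV[R]_d) : R := fine (lebesgue_mx 1 d A).

(* Number of elements of a finite set of points. *)
Definition npoints (A : set 'rV[R]_d) : nat := #|` fset_set A|%fset.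

(* The k-th closest point to the origin of a locally finite set (k >= 1); its
   norm is well defined even in case of ties. *)
Definition kth_closest (k : nat) (A : set 'rV[R]_d) : 'rV[R]_d :=
  xget 0 [set x | A x /\
    (npoints (A `&` [set y | (enorm y < enorm x)%R]) < k
     <= npoints (A `&` [set y | (enorm y <= enorm x)%R]))%N].

(* W^n, a point (x_1, ..., x_n) being the matrix with rows x_i. *)
Definition unit_ballX (n : nat) : set 'M[R]_(n, d) :=
  [set M | forall i, unit_ball (row i M)].

(* The gradient with respect to the i-th variable. *)
Definition grad n (f : 'M[R]_(n, d) -> R) (i : 'I_n) (M : 'M[R]_(n, d)) :
  'rV[R]_d := \row_j 'D_(delta_mx i j) f M.

(* C^1 on a neighbourhood of A. *)
Definition C1_on n (A : set 'M[R]_(n, d)) (f : 'M[R]_(n, d) -> R) : Prop :=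
  exists U : set 'M[R]_(n, d), [/\ open U, A `<=` U &
    forall M, U M -> differentiable f M /\
      forall i j, {for M, continuous ('D_(delta_mx i j) f)}].

Definition sup_norm n (A : set 'M[R]_(n, d)) (g : 'M[R]_(n, d) -> R) : \bar R :=
  ereal_sup [set (`|g M|)%:E | M in A].

End euclidean.
Arguments unit_ballX {R d} n _.

Section point_process.
Context {R : realType} {d : nat}.
Context {disp : measure_display} {Omega : measurableType disp}.
Variables (P : probability Omega R) (X : Omega -> set 'rV[R]_d).
Local Notation W := (@unit_ball R d).

(* N(B) *)
Definition count (B : set 'rV[R]_d) (w : Omega) : nat := npoints (X w `&` B).

Definition poisson_process (theta : R) : Prop :=
  [/\ forall w (B : set 'rV[R]_d), bounded_set B -> finite_set (X w `&` B),
      forall (B : set 'rV[R]_d) (k : nat), measurable B -> bounded_set B ->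
        measurable [set w | count B w = k],
      forall (B : set 'rV[R]_d) (k : nat), measurable B -> bounded_set B ->
        P [set w | count B w = k] =
          ((theta * volume B) ^+ k / k`!%:R * expR (- (theta * volume B)))%:E &
      forall m (B : 'I_m -> set 'rV[R]_d) (k : 'I_m -> nat),
        (forall i, measurable (B i)) -> (forall i, bounded_set (B i)) ->
        trivIset [set: 'I_m] B ->
        P (\bigcap_(i in [set: 'I_m]) [set w | count (B i) w = k i]) =
          (\prod_(i < m) P [set w | count (B i) w = k i])%E].

(* Generators of the sigma-field F_W of the points in W. *)
Definition FW_gen : set (set Omega) :=
  [set A | exists (B : set 'rV[R]_d) (k : nat), [/\ measurable B, B `<=` W &
    A = [set w | count B w = k]]].

(* L^2(Omega, F_W, P); equality in this space is almost sure equality. *)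
Definition in_L2 (F : Omega -> R) : Prop :=
  measurable_fun [set: g_sigma_algebraType FW_gen]
    (F : g_sigma_algebraType FW_gen -> R) /\
  ('E_P[fun w => (F w ^+ 2)%R] < +oo)%E.

Definition cvg_L2 (F_ : nat -> Omega -> R) (F : Omega -> R) : Prop :=
  'E_P[fun w => ((F_ l w - F w) ^+ 2)%R]%E @[l --> \oo] --> 0%E.

(* L^2(Omega, L^2(W, R^d)) *)
Definition sqnormH (U : Omega -> 'rV[R]_d -> 'rV[R]_d) : \bar R :=
  (\int[P]_w \int[lebesgue_mx 1 d]_(x in W) ((enorm (U w x)) ^+ 2)%:E)%E.

Definition in_L2H (U : Omega -> 'rV[R]_d -> 'rV[R]_d) : Prop :=
  measurable_fun ([set: g_sigma_algebraType FW_gen] `*` W)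
    (fun p : g_sigma_algebraType FW_gen * 'rV[R]_d => U p.1 p.2) /\
  (sqnormH U < +oo)%E.

Definition cvg_L2H (U_ : nat -> Omega -> 'rV[R]_d -> 'rV[R]_d)
    (U : Omega -> 'rV[R]_d -> 'rV[R]_d) : Prop :=
  sqnormH (fun w x => U_ l w x - U w x) @[l --> \oo] --> 0%E.

(* (X_1, ..., X_n) when N(W) = n, the points of the process in W being listed
   in an arbitrary order: form functions are symmetric. *)
Definition obs (w : Omega) : 'M[R]_(count W w, d) :=
  \matrix_(i < count W w) nth 0 (fset_set (X w `&` W)) i.

(* A functional is represented by its form functions; only the values of
   [f n] on W^n matter, and 'M_(0, d) has a single element, so that [f 0] is
   the constant f_0. *)
Definition forms := forall n, 'M[R]_(n, d) -> R.

Definition functional (f : forms) (w : Omega) : R := f (count W w) (obs w).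

Definition in_S (f : forms) : Prop :=
  (forall n, (0 < n)%N ->
     (lebesgue_mx n d).-integrable (unit_ballX n) (EFin \o f n)) /\
  (forall n (s : 'S_n) M, unit_ballX n M -> f n (row_perm s M) = f n M).

Definition in_S' (f : forms) : Prop :=
  in_S f /\
  exists2 C : R, 0 < C & forall n, (0 < n)%N ->
    C1_on (unit_ballX n) (f n) /\
    (sup_norm (unit_ballX n) (f n) +
     \sum_(i < n) sup_norm (unit_ballX n) (fun M => enorm (grad (f n) i M))
     <= (C ^+ n)%:E)%E.

(* The case n = 0 of the boundary condition is f_1(z) = f_0. *)
Definition in_DomD (f : forms) : Prop :=
  in_S' f /\
  forall n (M : 'M[R]_(n, d)) (z : 'rV[R]_d),
    unit_ballX n M -> unit_sphere z -> f (n + 1)%N (col_mx M z) = f n M.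

Section gradient.
Variable V : 'I_d -> 'rV[R]_d -> R.

Definition orthonormal_bounded : Prop :=
  [/\ forall m, measurable_fun W (V m),
      forall m, exists C : R, forall x, W x -> `|V m x| <= C &
      forall l m, \int[lebesgue_mx 1 d]_(x in W) (V l x * V m x) = (l == m)%:R].

Definition Vvec (x : 'rV[R]_d) : 'rV[R]_d :=
  (Num.sqrt d%:R)^-1 *: \row_m V m x.

(* D_x F *)
Definition Dop (f : forms) (w : Omega) (x : 'rV[R]_d) : 'rV[R]_d :=
  - \sum_(i < count W w)
      dotp (row i (obs w)) (Vvec x) *: grad (f (count W w)) i (obs w).

Definition nabla (f : forms) (w : Omega) : R :=
  \int[lebesgue_mx 1 d]_(x in W) dotp (Dop f w x) (Vvec x).

Definition approx_Dom (F : Omega -> R) (f : nat -> forms) : Prop :=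
  [/\ forall l, in_DomD (f l),
      cvg_L2 (fun l => functional (f l)) F &
      exists2 U, in_L2H U & cvg_L2H (fun l => Dop (f l)) U].

Definition in_closure_Dom (F : Omega -> R) : Prop :=
  in_L2 F /\ exists f, approx_Dom F f.

(* G is (a version of) nabla F, for F in the domain of the closure of D. *)
Definition closure_nabla (F G : Omega -> R) : Prop :=
  [/\ in_L2 F, in_L2 G &
      exists2 f, approx_Dom F f & cvg_L2 (fun l => nabla (f l)) G].

End gradient.

Definition theta_MLE (w : Omega) : R := (count W w)%:R / volume W.

Definition stein (zeta : Omega -> R) (w : Omega) : R :=
  theta_MLE w + zeta w / volume W.

Definition MSE (theta : R) (T : Omega -> R) : \bar R :=
  'E_P[fun w => ((T w - theta) ^+ 2)%R]%E.

Definition gain (theta : R) (T : Omega -> R) : R :=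
  (fine (MSE theta theta_MLE) - fine (MSE theta T)) /
  fine (MSE theta theta_MLE).

Definition sqrtF (k : nat) (phi : R -> R) (w : Omega) : R :=
  if (k <= count W w)%N then phi (enorm (kth_closest k (X w `&` W)) ^+ 2)
  else phi 1.

Definition Fk (k : nat) (phi : R -> R) (w : Omega) : R := sqrtF k phi w ^+ 2.

(* The indicator of ||X_(k)|| <= 1, i.e. of N(W) >= k. It matters next to
   [gain_fun]: off this event Y_(k) = 1, where [gain_fun] takes the value
   - phi2 1 / phi 1, whereas F_k is constant there and contributes nothing. *)
Definition kth_in_ball (k : nat) (w : Omega) : R :=
  (enorm (kth_closest k (X w)) <= 1)%R%:R.

Definition Yk (k : nat) (w : Omega) : R :=
  1 + (enorm (kth_closest k (X w)) ^+ 2 - 1) * kth_in_ball k w.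

End point_process.

(* phi is C^2 on the closed interval [0, 1], with derivatives phi1 and phi2:
   at the end points these are the one-sided derivatives, i.e. the limits of
   the derivatives from the inside. *)
Definition C2_01 {R : realType} (phi phi1 phi2 : R -> R) : Prop :=
  [/\ {within `[0, 1], continuous phi}, {within `[0, 1], continuous phi1},
      {within `[0, 1], continuous phi2} &
      forall t : R, t \in `]0, 1[ ->
        is_derive t (1 : R) phi (phi1 t) /\ is_derive t (1 : R) phi1 (phi2 t)].

Definition gain_fun {R : realType} (phi phi1 phi2 : R -> R) (t : R) : R :=
  - t * (phi1 t + t * phi2 t) / phi t.

(* Main.v *)
(* Put Y = Y_(k) and N = N(W).  A function psi(Y), with psi of class C^1 on
   [0,1], is the limit of the functionals
     psi(1) - sum_q (psi(t_{q+1}) - psi(t_q)) S(sum_i S(l (t_{q+1} - |X_i|^2)) - (k-1))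
   where S is a C^1 step from 0 to 1; they lie in Dom(D), and off the null event
   that a point is on the sphere their gradients converge, even when there are
   ties.  Hence psi(Y) is in the closure, with
   nabla psi(Y) = -(2/d) Y psi'(Y) 1(N >= k).  As phi'(1) = 0, the choice
   psi = log phi^2 shows that zeta_k is again a C^1 function of Y, and the same
   construction puts it in the closure.

   The limit nabla F does not depend on the approximating sequence: nabla is
   -1/d times the Euler derivative, whose flow x |-> e^{-t} x contracts W,
   and the law of n Poisson points scales by an explicit factor; thus
   ||f - f(e^{-t} .)||_1 <= t e^{tdn} ||euler f||_1 on {N = n}, from which
   closability follows without integrating by parts.

   For the risk, put M = count of the ball of radius r and lam = E M.  By
   independence of M and of the count in the annulus,
   E[(N - E N) 1(M >= k)] = lam P(M = k-1), which is r/d times the derivative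
   in r of P(M >= k).  Summing over a mesh of radii gives
   E[g(Y)(N - E N)] = -(2/d) E[Y g'(Y) 1(N >= k)], hence the mean squared error. *)
Require Import Defs.
From HB Require Import structures.
From mathcomp Require Import all_boot all_order all_algebra.
From mathcomp Require Import all_classical all_reals all_analysis.
From mathcomp Require Import measurable_realfun perm lra ring zify.

Set Implicit Arguments.
Unset Strict Implicit.
Unset Printing Implicit Defensive.

Import Order.TTheory GRing.Theory Num.Theory.
Import numFieldNormedType.Exports.

Local Open Scope classical_set_scope.
Local Open Scope ring_scope.

Local Notation count := Defs.count.

(** * Balls and their volume *)

Section geometry.
Context {R : realType} {d : nat}.
Implicit Types (x y : 'rV[R]_d) (r : R).

(** The process is known only through the laws of its counts; no density of the points given N(W) =
    n is at hand. An expectation of a form function is therefore reached by moving each point to a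
    representative of a small cell, computing with cell counts, and passing to the limit; symmetry
    and continuity of the forms are what this requires. The approximations must be C^1, symmetric
    and blind to a point on the sphere, whereas an order statistic is not differentiable at ties.
    Smoothing the counts instead of the order statistic gives all three. At a tie the points share
    the gradient equally, and its radial part is the same as without a tie, so almost sure absence
    of ties never has to be proved. The value Y = 1 stands for configurations with fewer than k
    points in W. Since phi'(1) = 0, the indicator of N >= k disappears from zeta_k; since phi''(1)
    may differ from 0, it stays in the covariance and in the risk. *)

Definition eball r : set 'rV[R]_d := [set x | enorm x <= r].

Lemma dotp_ge0 x : 0 <= dotp x x.
Proof. by apply: sumr_ge0 => j _; rewrite -expr2 sqr_ge0. Qed.

Lemma enorm_ge0 x : 0 <= enorm x.
Proof. exact: sqrtr_ge0. Qed.

Lemma sqr_enorm x : enorm x ^+ 2 = dotp x x.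
Proof. by rewrite sqr_sqrtr// dotp_ge0. Qed.

Lemma enorm_le x r : 0 <= r -> (enorm x <= r) = (dotp x x <= r ^+ 2).
Proof.
by move=> r0; rewrite -sqr_enorm ler_pXn2r// nnegrE enorm_ge0.
Qed.

Lemma dotpZ r x : dotp (r *: x) (r *: x) = r ^+ 2 * dotp x x.
Proof. by rewrite /dotp mulr_sumr; apply: eq_bigr => j _; rewrite !mxE; ring. Qed.

Lemma enormZ r x : 0 <= r -> enorm (r *: x) = r * enorm x.
Proof.
by move=> r0; rewrite /enorm dotpZ sqrtrM ?sqr_ge0// sqrtr_sqr ger0_norm.
Qed.

Lemma entry_le_enorm x j : `|x 0 j| <= enorm x.
Proof.
rewrite -sqrtr_sqr ler_wsqrtr// /dotp (bigD1 j)//= -expr2 lerDl.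
by apply: sumr_ge0 => i _; rewrite -expr2 sqr_ge0.
Qed.

Lemma mx_norm_le m n (M : 'M[R]_(m, n)) r : 0 <= r ->
  (forall i j, `|M i j| <= r) -> `|M| <= r.
Proof.
move=> r0 H; have [->|] := eqVneq M 0; first by rewrite normr0.
by rewrite -normr_eq0 => /mx_norm_neq0[ij]; rewrite [X in X <= _]/Num.norm/= => ->.
Qed.

Lemma entry_le_norm m n (M : 'M[R]_(m, n)) i j : `|M i j| <= `|M|.
Proof.
rewrite [leRHS]/Num.norm/= mx_normrE.
exact: (le_bigmax _ (fun ij => `|M ij.1 ij.2|) (i, j)).
Qed.

Lemma norm_le_enorm x : `|x| <= enorm x.
Proof.
apply: mx_norm_le; first exact: enorm_ge0.
by move=> i j; rewrite ord1 entry_le_enorm.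
Qed.

Lemma bounded_eball r (B : set 'rV[R]_d) : B `<=` eball r -> bounded_set B.
Proof.
move=> Br; rewrite /= /bounded_near; near=> M => x /Br xr /=.
by rewrite (le_trans (norm_le_enorm x))// (le_trans xr).
Unshelve. all: by end_near. Qed.

Lemma measurable_dotp : measurable_fun [set: 'rV[R]_d] (fun x => dotp x x).
Proof.
rewrite /dotp; apply: measurable_sum => j; apply: measurable_funM;
  exact: (@measurable_mx_entry _ (measurableTypeR R)).
Qed.

Lemma measurable_enorm : measurable_fun [set: 'rV[R]_d] (@enorm R d).
Proof.
apply: (@measurableT_comp _ _ _ _ _ _ (@Num.sqrt R) _ (fun x : 'rV[R]_d => dotp x x)).
  exact: (continuous_measurable_fun (@sqrt_continuous R)).
exact: measurable_dotp.
Qed.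

Lemma measurable_preimage_enorm (A : set R) : measurable A ->
  measurable [set x : 'rV[R]_d | A (enorm x)].
Proof. by move=> mA; rewrite -[X in measurable X]setTI; exact: measurable_enorm. Qed.

Lemma measurable_eball r : measurable (eball r).
Proof.
rewrite (_ : eball r = [set x | `]-oo, r]%classic (enorm x)]).
  exact: measurable_preimage_enorm.
by apply/seteqP; split => x /=; rewrite in_itv.
Qed.

Lemma measurable_unit_ball : measurable (@unit_ball R d).
Proof. exact: measurable_eball. Qed.

Lemma bounded_unit_ball : bounded_set (@unit_ball R d).
Proof. exact: (@bounded_eball 1). Qed.

End geometry.

(** * Lebesgue measure under dilations *)

Section scaling.
Context {R : realType}.

(** [mu] is [r] times the image of Lebesgue measure under multiplication by [r]. It gives half-open
    intervals their length, so it is Lebesgue measure. *)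
Lemma lebesgue_measure_scale (r : R) (A : set (measurableTypeR R)) : 0 < r ->
  measurable A ->
  lebesgue_measure [set x | A (r * x)] = (r^-1%:E * lebesgue_measure A)%E.
Proof.
move=> r0 mA.
pose f : measurableTypeR R -> measurableTypeR R := fun x => r * x.
have mf : measurable_fun setT f by exact: measurable_funM.
have rge0 : 0 <= r by exact: ltW.
pose mu : {measure set (measurableTypeR R) -> \bar R} :=
  mscale (NngNum rge0) (pushforward (lebesgue_measure (R := R)) f).
rewrite (@lebesgue_measure_unique _ (mu mf) _ A)//.
  rewrite /mu/= /mscale/= /pushforward muleA -EFinM mulVf ?gt_eqF// mul1e.
  by [].
move=> _ [[a b]] _ <-; rewrite /mu/= /mscale/= /pushforward.
rewrite (_ : f @^-1` _ = `](a / r), (b / r)]%classic).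
  rewrite !lebesgue_measure_itv/= !lte_fin ltr_pM2r ?invr_gt0//.
  case: ifPn => _; last by rewrite mule0.
  by rewrite -!EFinB -EFinM; congr EFin; rewrite mulrBr ![r * _]mulrC !divfK ?gt_eqF.
apply/seteqP; split => x /=; rewrite /f !in_itv/= ltr_pdivrMr// ler_pdivlMr//;
  by rewrite mulrC.
Qed.

(** Unlike [mx_cylinders], which constrain a single entry, boxes are stable under intersection, as
    the uniqueness theorem for measures requires. *)
Definition boxes m n : set (set 'M[R]_(m, n)) :=
  [set A | exists2 B : 'I_m -> 'I_n -> set R,
    (forall i j, measurable (B i j)) & A = [set M : 'M[R]_(m, n) | forall i j, B i j (M i j)]].

Lemma measurable_boxE m n (B : 'I_m -> 'I_n -> set R) :
  (forall i j, measurable (B i j)) ->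
  measurable ([set M : 'M[R]_(m, n) | forall i j, B i j (M i j)]).
Proof.
move=> mB; rewrite (_ : mkset _ = \bigcap_(ij in [set: 'I_m * 'I_n])
    ((fun M : 'M[R]_(m, n) => M ij.1 ij.2) @^-1` B ij.1 ij.2)).
  apply: fin_bigcap_measurable => // -[i j] _ /=.
  rewrite -[X in measurable X]setTI.
  by apply: (@measurable_mx_entry _ (measurableTypeR R)) => //; exact: mB.
apply/seteqP; split=> M /= h; first by move=> [i j] _; exact: h.
by move=> i j; exact: (h (i, j)).
Qed.

Lemma measurable_mx_boxes m n :
  (measurable : set (set 'M[R]_(m, n))) = <<s @boxes m n >>.
Proof.
apply/seteqP; split => A; last first.
  apply: smallest_sub; first exact: sigma_algebra_measurable.
  by move=> _ [B mB ->]; exact: measurable_boxE.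
apply: smallest_sub; first exact: smallest_sigma_algebra.
move=> _ [[i j] [B mB ->]]; apply: sub_sigma_algebra.
exists (fun i' j' => if (i' == i) && (j' == j) then B else setT).
  by move=> i' j'; case: ifPn.
apply/seteqP; split => M /= h.
  by move=> i' j'; case: ifPn => // /andP[/eqP-> /eqP->].
by have := h i j; rewrite !eqxx.
Qed.

Lemma measurable_scalemx m n (r : R) :
  measurable_fun [set: 'M[R]_(m, n)] (fun M => r *: M).
Proof.
apply: (@measurable_fun_mx _ (measurableTypeR R)) => i j.
rewrite (_ : (fun s => _) = (fun s : 'M[R]_(m, n) => r * s i j)).
  by apply: measurable_funM => //; exact: (@measurable_mx_entry _ (measurableTypeR R)).
by apply/funext => s; rewrite mxE.
Qed.

(** Two measures in [A] that agree on boxes, by the one-dimensional case in each entry, and are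
    finite on cubes exhausting the space. *)
Lemma lebesgue_mx_scale m n (r : R) (A : set 'M[R]_(m, n)) : 0 < r ->
  measurable A ->
  lebesgue_mx m n [set M | A (r *: M)] = ((r^-1 ^+ (m * n))%:E * lebesgue_mx m n A)%E.
Proof.
move=> r0 mA; pose f : 'M[R]_(m, n) -> 'M[R]_(m, n) := fun M => r *: M.
have rge0 : 0 <= r^-1 ^+ (m * n) by rewrite exprn_ge0// invr_ge0 ltW.
pose mu : {measure set 'M[R]_(m, n) -> \bar R} := mscale (NngNum rge0) (lebesgue_mx m n).
have muE X : mu X = ((r^-1 ^+ (m * n))%:E * lebesgue_mx m n X)%E by [].
pose nu : {measure set 'M[R]_(m, n) -> \bar R} := pushforward (lebesgue_mx m n) f.
have mf : measurable_fun setT f by exact: measurable_scalemx.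
pose cube k := `[- (k%:R : R), k%:R]%classic.
have mB k : forall (i : 'I_m) (j : 'I_n),
    measurable (cube k : set R).
  by move=> i j; exact: measurable_itv.
have Bfin k : (\prod_(i < m) \prod_(j < n)
    lebesgue_measure (cube k : set (measurableTypeR R)) < +oo)%E.
  rewrite ltey_eq fin_numElt; apply/orP; left.
  rewrite -fin_numElt; apply: (big_ind (fun x => x \is a fin_num)) => //.
    by move=> x y; exact: fin_numM.
  move=> i _; apply: (big_ind (fun x => x \is a fin_num)) => //.
    by move=> x y; exact: fin_numM.
  move=> j _; rewrite lebesgue_measure_itv/=; case: ifPn => //.
pose g k : set 'M[R]_(m, n) := [set M | forall i j, cube k (M i j)].
rewrite -muE; suff: mu A = nu mf A by move/esym.
apply: (@measure_unique _ _ _ (@boxes m n) g _ _ _ _ mu (nu mf)) => //.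
- exact: measurable_mx_boxes.
- move=> _ _ [B1 mB1 ->] [B2 mB2 ->]; exists (fun i j => B1 i j `&` B2 i j).
    by move=> i j; exact: measurableI.
  by apply/seteqP; split => M /= => [[h1 h2] i j|h]; split => //; [move=> i j|move=> i j]; case: (h i j).
- by move=> k; exists (fun _ _ => cube k) => //; exact: mB.
- apply/seteqP; split => // M _; exists (Num.trunc `|M|).+1 => //= i j.
  rewrite /cube/= in_itv/= -ler_norml (le_trans (entry_le_norm M i j))//.
  by rewrite ltW// truncnS_gt.
- move=> _ [B mB1 ->]; rewrite muE; pose B' i j : set R := [set x | B i j (r * x)].
  have mB' i j : measurable (B' i j).
    rewrite -[X in measurable X]setTI.
    by apply: (_ : measurable_fun setT (fun x : R => r * x)) => //; exact: measurable_funM.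
  transitivity (lebesgue_mx m n [set M | forall i j, B' i j (M i j)]).
    rewrite (lebesgue_mx_box mB') (lebesgue_mx_box mB1).
    have prodZ (I : finType) (c : R) (F : I -> \bar R) :
        (\prod_(i in I) (c%:E * F i) = (c ^+ #|I|)%:E * \prod_(i in I) F i)%E.
      by rewrite big_split/= prodEFin prodr_const.
    transitivity (\prod_(i < m) ((r^-1 ^+ n)%:E * \prod_(j < n) lebesgue_measure (B i j : set (measurableTypeR R))))%E.
      by rewrite prodZ card_ord -exprM mulnC.
    apply: eq_bigr => i _; rewrite -[X in (_ ^+ X)%:E](card_ord n) -prodZ.
    by apply: eq_bigr => j _; rewrite /B' (lebesgue_measure_scale r0 (mB1 i j)).
  congr (lebesgue_mx m n _); apply/seteqP; split => M /= h i j;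
    by have := h i j; rewrite /B'/= mxE.
- move=> k; rewrite muE (lebesgue_mx_box (mB k)).
  by rewrite lte_mul_pinfty// lee_fin.
Qed.

End scaling.

Section volume.
Context {R : realType} {d : nat}.
Implicit Types (A B : set 'rV[R]_d) (r : R).

Lemma lebesgue_eball_lty r : (lebesgue_mx 1 d (eball r) < +oo)%E.
Proof.
pose C := fun (_ : 'I_1) (_ : 'I_d) => `[- r, r]%classic.
have mC i j : measurable (C i j) by exact: measurable_itv.
apply: (@le_lt_trans _ _ (lebesgue_mx 1 d [set M | forall i j, C i j (M i j)])).
  apply: le_measure; rewrite ?inE//.
  - exact: measurable_eball.
  - exact: measurable_boxE.
  - by move=> x xr i j; rewrite /C/= in_itv/= -ler_norml ord1 (le_trans (entry_le_enorm x j)).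
rewrite lebesgue_mx_box// ltey_eq fin_numElt; apply/orP; left.
rewrite -fin_numElt; apply: (big_ind (fun x => x \is a fin_num)) => //.
  by move=> x y; exact: fin_numM.
move=> i _; apply: (big_ind (fun x => x \is a fin_num)) => //.
  by move=> x y; exact: fin_numM.
by move=> j _; rewrite lebesgue_measure_itv/=; case: ifPn.
Qed.

Lemma lebesgue_eball_fin r A : measurable A -> A `<=` eball r ->
  lebesgue_mx 1 d A \is a fin_num.
Proof.
move=> mA Ar; rewrite ge0_fin_numE// (le_lt_trans _ (lebesgue_eball_lty r))//.
by apply: le_measure; rewrite ?inE//; exact: measurable_eball.
Qed.

Lemma volume_ge0 A : 0 <= volume A.
Proof. exact: fine_ge0. Qed.

Lemma EFin_volume r A : measurable A -> A `<=` eball r ->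
  (volume A)%:E = lebesgue_mx 1 d A.
Proof. by move=> mA Ar; rewrite /volume fineK// (lebesgue_eball_fin mA Ar). Qed.

Lemma volumeD r A B : measurable A -> measurable B -> A `<=` eball r ->
  B `<=` eball r -> A `&` B = set0 -> volume (A `|` B) = volume A + volume B.
Proof.
move=> mA mB Ar Br AB0; apply: EFin_inj; rewrite EFinD !(@EFin_volume r)//.
- by rewrite measureU.
- exact: measurableU.
- by move=> x [/Ar|/Br].
Qed.

Lemma volume_scale r A : 0 < r -> measurable A ->
  volume [set x | A (r *: x)] = r^-1 ^+ d * volume A.
Proof.
move=> r0 mA; rewrite /volume lebesgue_mx_scale// mul1n.
(* A set of infinite measure has volume 0 by the convention of [fine], and scaling keeps its measure
   infinite. *)
case: (lebesgue_mx 1 d A) => [v| |] //=.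
- have [->|/eqP] := eqVneq d 0%N; first by rewrite expr0 mul1e mul1r.
  by move=> _; rewrite mulry gtr0_sg ?exprn_gt0 ?invr_gt0//= mul1e mulr0.
- by rewrite mulrNy gtr0_sg ?exprn_gt0 ?invr_gt0//= mul1e mulr0.
Qed.

Lemma eballE r : 0 < r -> eball r = [set x : 'rV[R]_d | unit_ball (r^-1 *: x)].
Proof.
move=> r0; apply/seteqP; split => x; rewrite /eball/unit_ball/=;
  by rewrite enormZ ?invr_ge0 ?(ltW r0)// mulrC ler_pdivrMr// mul1r.
Qed.

Lemma volume_eball r : 0 < r -> volume (@eball R d r) = r ^+ d * volume (@unit_ball R d).
Proof.
move=> r0; rewrite eballE// volume_scale ?invr_gt0 ?invrK//.
exact: measurable_unit_ball.
Qed.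

Lemma volume_unit_ball_gt0 : 0 < volume (@unit_ball R d).
Proof.
(* The cube of half-side 1/(d+1) lies in the ball: each squared entry is at most [e], and d e <=
   1. *)
pose e : R := d.+1%:R^-1.
have e0 : 0 < e by rewrite invr_gt0.
pose C := fun (_ : 'I_1) (_ : 'I_d) => `[- e, e]%classic.
have mC i j : measurable (C i j) by exact: measurable_itv.
have CW : [set M : 'rV[R]_d | forall i j, C i j (M i j)] `<=` unit_ball.
  move=> x Cx; rewrite /unit_ball/= enorm_le// expr1n.
  apply: (@le_trans _ _ (\sum_(j < d) e)).
    apply: ler_sum => j _; rewrite -expr2 -real_normK ?num_real//.
    have := Cx ord0 j; rewrite /C/= in_itv/= -ler_norml => xe.
    have e1 : e <= 1 by rewrite invf_le1 ?ler1n.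
    by move: (normr_ge0 (x 0 j)) xe; nra.
  rewrite sumr_const card_ord -mulr_natr /e mulrC ler_pdivrMr// mul1r ler_nat.
  exact: leqnSn.
have : (lebesgue_mx 1 d [set M | forall i j, C i j (M i j)] <=
    lebesgue_mx 1 d unit_ball)%E.
  apply: le_measure; rewrite ?inE//; first exact: measurable_boxE.
  exact: measurable_unit_ball.
rewrite lebesgue_mx_box// -(@EFin_volume 1)//; last exact: measurable_unit_ball.
rewrite big_ord1; under eq_bigr do rewrite /C.
have -> : lebesgue_measure (`[- e, e]%classic : set (measurableTypeR R)) = (e + e)%:E.
  by rewrite lebesgue_measure_itv/= lte_fin gtrN// -EFinB opprK.
rewrite prodEFin lee_fin; apply: lt_le_trans.
by apply: prodr_gt0 => i _; rewrite addr_gt0.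
Qed.

End volume.

Section npoints.
Context {R : realType} {d : nat}.
Implicit Types (A B : set 'rV[R]_d) (s : seq 'rV[R]_d).

Lemma npoints_seq A s : uniq s -> A = [set` s] -> npoints A = size s.
Proof.
move=> us As; apply: perm_size; apply: uniq_perm => // x.
have fA : finite_set A by rewrite As.
by rewrite in_fset_set// As; apply/idP/idP; rewrite inE.
Qed.

Lemma npointsI A B : finite_set A ->
  npoints (A `&` B) = seq.count (fun x => x \in B) (fset_set A).
Proof.
move=> fA; rewrite -size_filter; apply: npoints_seq.
  by rewrite filter_uniq// fset_uniq.
apply/seteqP; split => x /=; rewrite mem_filter in_fset_set//.
  by move=> [Ax Bx]; rewrite !mem_set.
by move=> /andP[xB xA]; split; exact: set_mem.
Qed.

Lemma le_npoints A B : finite_set B -> A `<=` B -> (npoints A <= npoints B)%N.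
Proof.
move=> fB AB; rewrite -(setIidr AB) npointsI//.
exact: count_size.
Qed.

End npoints.

(** * Poisson counts and form functions *)

Section poisson.
Context {R : realType} {d : nat}.
Context {disp : measure_display} {Omega : measurableType disp}.
Variables (P : probability Omega R) (X : Omega -> set 'rV[R]_d) (theta : R).
Hypotheses (theta_gt0 : 0 < theta) (PX : poisson_process P X theta).
Local Notation W := (@unit_ball R d).
Implicit Types (A B : set 'rV[R]_d).

Definition points w : seq 'rV[R]_d := fset_set (X w `&` W).

Lemma finite_points w B : bounded_set B -> finite_set (X w `&` B).
Proof. by case: PX => fX _ _ _; exact: fX. Qed.

Lemma finite_pointsW w : finite_set (X w `&` W).
Proof. by apply: finite_points; exact: bounded_unit_ball. Qed.

Lemma size_points w : size (points w) = count X W w. Proof. by []. Qed.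

Lemma mem_points w x : (x \in points w) = (x \in X w `&` W).
Proof. by rewrite in_fset_set//; exact: finite_pointsW. Qed.

Lemma points_ball w x : x \in points w -> unit_ball x.
Proof. by rewrite mem_points inE => -[]. Qed.

Lemma count_points w B : B `<=` W ->
  count X B w = seq.count (fun x => x \in B) (points w).
Proof.
move=> BW; rewrite -npointsI; last exact: finite_pointsW.
by rewrite /count -setIA (setIidr BW).
Qed.

Lemma countD w A B : bounded_set A -> bounded_set B -> A `&` B = set0 ->
  count X (A `|` B) w = (count X A w + count X B w)%N.
Proof.
move=> bA bB AB0.
have fAB : finite_set (X w `&` (A `|` B)).
  by rewrite setIUr finite_setU; split; exact: finite_points.
have cE C : C `<=` A `|` B -> count X C w =
    seq.count (fun x => x \in C) (fset_set (X w `&` (A `|` B))).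
  by move=> CAB; rewrite -npointsI// -setIA (setIidr CAB).
rewrite (cE _ (@subset_refl _ _)) (cE _ (@subsetUl _ _ _)) (cE _ (@subsetUr _ _ _)).
rewrite -count_predUI [X in (_ + X)%N](_ : _ = 0%N) ?addn0.
  by apply: eq_count => x; rewrite in_setU.
rewrite (@eq_count _ _ pred0) ?count_pred0// => x /=.
by rewrite -in_setI AB0 in_set0.
Qed.

Lemma le_count w A B : bounded_set B -> A `<=` B -> (count X A w <= count X B w)%N.
Proof. by move=> bB AB; apply: le_npoints; [exact: finite_points|exact: setIS]. Qed.

Definition pois (l : R) (k : nat) : R := l ^+ k / k`!%:R * expR (- l).

Lemma pois_ge0 l k : 0 <= l -> 0 <= pois l k.
Proof. by move=> l0; rewrite /pois mulr_ge0 ?expR_ge0// divr_ge0// exprn_ge0. Qed.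

Lemma measurable_countE B k : measurable B -> bounded_set B ->
  measurable [set w | count X B w = k].
Proof. by case: PX => _ mX _ _; exact: mX. Qed.

Lemma pr_count B k : measurable B -> bounded_set B ->
  P [set w | count X B w = k] = (pois (theta * volume B) k)%:E.
Proof. by case: PX => _ _ pX _; exact: pX. Qed.

(** The independence hypothesis is indexed by ordinals; below, the disjoint sets are indexed by
    cells, or by cells and one more set. *)
Lemma pr_counts (J : finType) (B : J -> set 'rV[R]_d) (K : J -> nat) :
  (forall c, measurable (B c)) -> (forall c, bounded_set (B c)) ->
  trivIset [set: J] B ->
  P [set w | forall c, count X (B c) w = K c] =
  (\prod_c pois (theta * volume (B c)) (K c))%:E.
Proof.
move=> mB bB tB; case: PX => _ _ _ /(_ #|J| (fun i => B (enum_val i)) (fun i => K (enum_val i))).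
rewrite (_ : \bigcap_(i in _) _ = [set w | forall c, count X (B c) w = K c]); last first.
  apply/seteqP; split => w /= h; last by move=> i _; exact: h.
  by move=> c; have := h (enum_rank c) I; rewrite /= enum_rankK.
move=> ->//.
- transitivity (\prod_(i < #|J|) (pois (theta * volume (B (enum_val i))) (K (enum_val i)))%:E)%E.
    by apply: eq_bigr => i _; exact: pr_count.
  rewrite prodEFin; congr EFin; rewrite [RHS](reindex_onto enum_val enum_rank)/=.
    by apply: eq_bigl => i; rewrite enum_valK eqxx.
  by move=> c _; rewrite enum_rankK.
- apply/trivIsetP => i j _ _ ij; move/trivIsetP : tB; apply => //.
  by apply: contra ij => /eqP/enum_val_inj ->.
Qed.

Lemma measurable_counts (J : finType) (B : J -> set 'rV[R]_d) (K : J -> nat) :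
  (forall c, measurable (B c)) -> (forall c, bounded_set (B c)) ->
  measurable [set w | forall c, count X (B c) w = K c].
Proof.
move=> mB bB; rewrite (_ : mkset _ = \bigcap_(c in [set: J]) [set w | count X (B c) w = K c]).
  by apply: fin_bigcap_measurable => // c _; exact: measurable_countE.
by apply/seteqP; split => w /= h c; [move=> _|]; exact: h.
Qed.

Lemma FW_measurable (A : set Omega) :
  measurable (A : set (g_sigma_algebraType (FW_gen X))) -> measurable A.
Proof.
apply: smallest_sub; first exact: sigma_algebra_measurable.
move=> _ [B [k [mB BW ->]]]; apply: measurable_countE => //.
exact: (@bounded_eball _ _ 1).
Qed.

Lemma FW_measurable_fun d' (T : measurableType d') (F : Omega -> T) :
  measurable_fun setT (F : g_sigma_algebraType (FW_gen X) -> T) ->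
  measurable_fun setT F.
Proof.
move=> mF _ B mB; apply: FW_measurable; exact: mF.
Qed.

Lemma FW_measurable_count B (A : set nat) : measurable B -> B `<=` W ->
  measurable ([set w | A (count X B w)] : set (g_sigma_algebraType (FW_gen X))).
Proof.
move=> mB BW; rewrite (_ : mkset _ = \bigcup_(k in A) [set w | count X B w = k]).
  apply: bigcup_measurable => k _; apply: sub_sigma_algebra.
  by exists B, k.
apply/seteqP; split => w /=; first by move=> h; exists (count X B w).
by move=> [k Ak /= ->].
Qed.

End poisson.

Lemma measurable_preimage_countable_in d' (T : measurableType d') (U : countType)
    (D : set T) (f : T -> U) (A : set U) :
  (forall u, measurable (D `&` [set x | f x = u])) ->
  measurable (D `&` [set x | A (f x)]).
Proof.
move=> mf; rewrite (_ : D `&` _ = \bigcup_n (if unpickle n is Some u then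
    if u \in A then D `&` [set x | f x = u] else set0 else set0)).
  apply: bigcup_measurable => n _; case: unpickle => [u|//].
  by case: ifPn.
apply/seteqP; split => x /= [].
  by move=> Dx Afx; exists (pickle (f x)) => //; rewrite pickleK mem_set.
move=> n _; case: unpickle => [u|//]; case: ifPn => // uA [Dx fxu].
by split => //; rewrite fxu; exact: set_mem.
Qed.

Lemma measurable_preimage_countable d' (T : measurableType d') (U : countType)
    (f : T -> U) (A : set U) :
  (forall u, measurable [set x | f x = u]) -> measurable [set x | A (f x)].
Proof.
move=> mf; rewrite -[X in measurable X]setTI.
by apply: measurable_preimage_countable_in => u; rewrite setTI.
Qed.

(** * Configurations as lists, and their discretization into cells *)

Section sequences_of_points.
Context {R : realType} {d : nat}.
Local Notation W := (@unit_ball R d).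
Implicit Types (s : seq 'rV[R]_d) (f : @forms R d) (x y : 'rV[R]_d).

Definition mxseq s : 'M[R]_(size s, d) := \matrix_(i < size s) nth 0 s i.

(** Evaluating on lists lets configurations be mapped and permuted without casts between the types
    of matrices of various heights. *)
Definition form_seq f s : R := f (size s) (mxseq s).

Definition symmetric_forms f := forall n (p : 'S_n) M, unit_ballX n M ->
  f n (row_perm p M) = f n M.

(** Continuity in the whole space at the points of W^n, as given by differentiability on a
    neighbourhood of W^n. *)
Definition continuous_forms f := forall n M, unit_ballX n M ->
  {for M, continuous (f n)}.

Lemma form_seqE f n s : size s = n ->
  form_seq f s = f n (\matrix_(i < n) nth 0 s i).
Proof. by move=> <-. Qed.

Lemma ballX_seq n s : size s = n -> (forall x, x \in s -> W x) ->
  unit_ballX n (\matrix_(i < n) nth 0 s i).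
Proof. by move=> sn sW i; rewrite rowK; apply: sW; rewrite mem_nth// sn. Qed.

Lemma form_seq_perm f s t : symmetric_forms f -> (forall x, x \in t -> W x) ->
  perm_eq s t -> form_seq f s = form_seq f t.
Proof.
move=> symf tW /(@tuple_permP _ _ _ (in_tuple t))[p sE].
rewrite (@form_seqE f (size t) s); last by rewrite sE size_map size_enum_ord.
rewrite /form_seq -(symf _ p (mxseq t)); last exact: ballX_seq.
congr (f _ _); apply/matrixP => i j; rewrite !mxE sE.
rewrite (nth_map i) ?size_enum_ord// nth_ord_enum.
by rewrite (tnth_nth 0).
Qed.

(** Entries of points of W lie in [-1, 1], so the integer part of (x_j + 1)(q + 1) ranges over 0,
    ..., 2(q + 1). *)
Definition cell_type q := {ffun 'I_d -> 'I_(2 * q.+1).+1}.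

Definition cell q x : cell_type q :=
  [ffun j => inord (Num.trunc ((x 0 j + 1) * q.+1%:R))].

Lemma cell_dist q x y : W x -> W y -> cell q x = cell q y ->
  `|x - y| <= q.+1%:R^-1.
Proof.
move=> Wx Wy xy; apply: mx_norm_le; first by rewrite invr_ge0.
move=> i j; rewrite ord1 !mxE.
have q0 : 0 < q.+1%:R :> R by rewrite ltr0n.
have bnd z : W z -> 0 <= (z 0 j + 1) * q.+1%:R <= (2 * q.+1)%:R.
  move=> Wz; have := le_trans (entry_le_enorm z j) Wz; rewrite ler_norml => /andP[z1 z2].
  rewrite natrM; apply/andP; split; last by rewrite ler_pM2r//; lra.
  by rewrite mulr_ge0 ?(ltW q0)//; lra.
have tr z : W z -> (Num.trunc ((z 0%R j + 1)%R * q.+1%:R)%R < (2 * q.+1).+1)%N.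
  move=> Wz; have /andP[z0 z1] := bnd z Wz.
  rewrite ltnS -(ler_nat R) (le_trans _ z1)//.
  by have /andP[] := truncn_itv z0.
have : cell q x j = cell q y j by rewrite xy.
rewrite !ffunE => /(congr1 val)/=; rewrite !inordK ?tr// => txy.
have /andP[x0 _] := bnd x Wx; have /andP[y0 _] := bnd y Wy.
have := truncn_itv x0; have := truncn_itv y0; rewrite txy => /andP[y1 y2] /andP[x1 x2].
rewrite -[leRHS]mul1r ler_pdivlMr// -[X in _ * X <= _](ger0_norm (ltW q0)) -normrM.
rewrite ler_norml; move: y1 y2 x1 x2; rewrite -[X in _ < X -> _]natr1.
set t := (Num.trunc _)%:R; lra.
Qed.

Lemma measurable_cell q c : measurable [set x | W x /\ cell q x = c].
Proof.
rewrite (_ : mkset _ = W `&` \bigcap_(j in [set: 'I_d]) [set x | cell q x j = c j]).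
  apply: measurableI; first exact: measurable_unit_ball.
  apply: fin_bigcap_measurable => // j _.
  rewrite (_ : mkset _ = [set x : 'rV[R]_d |
      [set m | inord m = c j] (Num.trunc ((x 0 j + 1) * q.+1%:R))]); last first.
    by apply/seteqP; split => x /=; rewrite ffunE.
  apply: (@measurable_preimage_countable _ _ _
    (fun x : 'rV[R]_d => Num.trunc ((x 0 j + 1) * q.+1%:R))) => m.
  have mg : measurable_fun setT (fun x : 'rV[R]_d => (x 0 j + 1) * q.+1%:R).
    apply: measurable_funM => //; apply: measurable_funD => //.
    exact: (@measurable_mx_entry _ (measurableTypeR R)).
  suff mt : measurable [set y : R | Num.trunc y = m].
    by rewrite -[X in measurable X]setTI; exact: (mg measurableT _ mt).
  (* [Num.trunc] is 0 on negative numbers too, so its fibre over 0 is a half-line. *)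
  rewrite (_ : mkset _ = if m == 0%N then `]-oo, 1[%classic else `[m%:R, m.+1%:R[%classic).
    by case: ifPn => _; exact: measurable_itv.
  apply/seteqP; split => y /=.
    move=> <-; case: ifPn => [|y0]; rewrite /= in_itv/=.
      by rewrite -leqn0 truncn_le_nat.
    rewrite truncn_itv//; move: y0; rewrite -lt0n truncn_gt0; exact: le_trans.
  case: ifPn => [/eqP->|m0]; rewrite /= in_itv/=.
    by move=> y1; apply/eqP; rewrite -leqn0 truncn_le_nat.
  by move=> my; apply: truncn_def.
apply/seteqP; split => x /=; first by move=> [Wx <-].
by move=> [Wx cx]; split => //; apply/ffunP => j; exact: cx.
Qed.

Definition cell_rep q (c : cell_type q) : 'rV[R]_d :=
  xget 0 [set x | W x /\ cell q x = c].

(* Functionals of the points are reached through cell counts: only the laws of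
   counts are given, and [disc] replaces a point by a representative of its cell. *)
Definition disc q x := cell_rep (cell q x).

Lemma discP q x : W x -> W (disc q x) /\ cell q (disc q x) = cell q x.
Proof.
move=> Wx; rewrite /disc /cell_rep; case: xgetP => [y _ []//|].
by move=> /(_ x) []; split.
Qed.

Lemma disc_dist q x : W x -> `|disc q x - x| <= q.+1%:R^-1.
Proof. by move=> Wx; have [Wd cd] := discP q Wx; exact: cell_dist. Qed.

Lemma form_seq_disc_cvg f s : continuous_forms f -> (forall x, x \in s -> W x) ->
  form_seq f (map (disc q) s) @[q --> \oo] --> form_seq f s.
Proof.
move=> cf sW; set n := size s.
pose M q : 'M[R]_(n, d) := \matrix_(i < n) nth 0 (map (disc q) s) i.
under eq_fun => q do rewrite (@form_seqE f n _ (size_map _ _)).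
apply: (@cvg_comp _ _ _ M (f n) _ (nbhs (mxseq s))).
  apply/cvgrPdist_le => /= e e0; near=> q.
  apply: mx_norm_le; first exact: ltW.
  move=> i j; rewrite !mxE (nth_map 0)//.
  rewrite distrC (le_trans (_ : _ <= `|(disc q (nth 0 s i) - nth 0 s i) 0 j|))//.
    by rewrite !mxE.
  rewrite (le_trans (entry_le_norm _ _ _))//.
  rewrite (le_trans (disc_dist q _))//; first by apply: sW; rewrite mem_nth.
  by apply: ltW; near: q; exact: (near_infty_natSinv_lt (PosNum e0)).
by apply: cf; exact: ballX_seq.
Unshelve. all: by end_near. Qed.

(** A canonical list with prescribed cell counts. A symmetric form does not see the order, so a
    discretized functional becomes a function of the counts alone. *)
Definition listK (J : finType) (rep : J -> 'rV[R]_d) (K : J -> nat) :=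
  flatten [seq nseq (K c) (rep c) | c <- enum J].

Lemma perm_listK (J : finType) (rep : J -> 'rV[R]_d) (kappa : 'rV[R]_d -> J) s :
  perm_eq (map (rep \o kappa) s)
    (listK rep (fun c => seq.count (fun x => kappa x == c) s)).
Proof.
set t := map kappa s.
have -> : listK rep (fun c => seq.count (fun x => kappa x == c) s) =
    map rep (flatten [seq nseq (count_mem c t) c | c <- enum J]).
  rewrite map_flatten -map_comp /listK; congr flatten; apply: eq_map => c /=.
  by rewrite map_nseq /t count_map.
rewrite map_comp; apply: perm_map; apply/allP => y _; apply/eqP.
rewrite count_flatten -map_comp sumnE big_map big_enum/= (bigD1 y)//=.
rewrite count_nseq/= eqxx mul1n big1 ?addn0// => c cy.
by rewrite count_nseq/= (negbTE cy) mul0n.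
Qed.

Lemma sum_count (J : finType) (kappa : 'rV[R]_d -> J) s :
  (\sum_c seq.count (fun x => kappa x == c) s = size s)%N.
Proof.
elim: s => [|x s IH] /=; first by rewrite big1.
rewrite big_split/= IH (bigD1 (kappa x))//= eqxx big1 ?addn0// => c.
by rewrite eq_sym => /negbTE->.
Qed.

End sequences_of_points.

Section functional_measurability.
Context {R : realType} {d : nat}.
Context {disp : measure_display} {Omega : measurableType disp}.
Variables (P : probability Omega R) (X : Omega -> set 'rV[R]_d) (theta : R).
Hypotheses (theta_gt0 : 0 < theta) (PX : poisson_process P X theta).
Local Notation W := (@unit_ball R d).
Local Notation G := (g_sigma_algebraType (FW_gen X)).

Definition counts (J : finType) (kappa : 'rV[R]_d -> J) (s : seq 'rV[R]_d) :
  {ffun J -> nat} := [ffun c => seq.count (fun x => kappa x == c) s].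

Lemma form_seq_counts (f : forms) q s : symmetric_forms f ->
  (forall x, x \in s -> W x) ->
  form_seq f (map (disc q) s) = form_seq f (listK (@cell_rep R d q) (counts (cell q) s)).
Proof.
move=> sf sW; have pm := perm_listK (@cell_rep R d q) (cell q) s.
rewrite (_ : listK _ _ = listK (@cell_rep R d q)
    (fun c => seq.count (fun x => cell q x == c) s)); last first.
  by congr flatten; apply: eq_map => c; rewrite ffunE.
apply: form_seq_perm => // x; rewrite -(perm_mem pm) => /mapP[y ys ->].
exact: (discP q (sW _ ys)).1.
Qed.

Lemma counts_points (J : finType) (kappa : 'rV[R]_d -> J) w c :
  counts kappa (points X w) c = count X [set x | W x /\ kappa x = c] w.
Proof.
rewrite ffunE (count_points PX); last by move=> x [].
apply: eq_in_count => x xs; apply/eqP/idP.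
  by move=> kx; rewrite inE; split=> //; exact: (points_ball PX xs).
by rewrite inE => -[].
Qed.

Lemma FW_measurable_counts (J : finType) (kappa : 'rV[R]_d -> J)
    (A : set {ffun J -> nat}) :
  (forall c, measurable [set x | W x /\ kappa x = c]) ->
  measurable ([set w | A (counts kappa (points X w))] : set G).
Proof.
move=> mk; apply: (@measurable_preimage_countable _ _ {ffun J -> nat}) => K.
rewrite (_ : mkset _ = \bigcap_(c in [set: J])
    [set w | [set K c] (count X [set x | W x /\ kappa x = c] w)]).
  apply: fin_bigcap_measurable => // c _.
  by apply: FW_measurable_count => // x [].
apply/seteqP; split => w /=; first by move=> <- c _; rewrite /= counts_points.
by move=> h; apply/ffunP => c; rewrite counts_points; exact: h.
Qed.

Lemma functionalE (f : forms) w : functional X f w = form_seq f (points X w).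
Proof. by []. Qed.

(** The functional is a pointwise limit of functions of cell counts. The arbitrary order in which
    [obs] lists the points thus causes no trouble. *)
Lemma FW_measurable_functional (f : forms) :
  symmetric_forms f -> continuous_forms f ->
  measurable_fun setT (functional X f : G -> R).
Proof.
move=> sf cf.
apply: (@measurable_fun_cvg _ G R setT
  (fun q w => form_seq f (map (disc q) (points X w)))); last first.
  by move=> w _; apply: form_seq_disc_cvg => // x; exact: (points_ball PX).
move=> q _ B mB; rewrite setTI.
rewrite (_ : _ @^-1` _ = [set w | [set K : {ffun cell_type q -> nat} |
    B (form_seq f (listK (@cell_rep R d q) K))] (counts (cell q) (points X w))]).
  by apply: FW_measurable_counts => c; exact: measurable_cell.
apply/seteqP; split => w /=;
  by rewrite form_seq_counts//; move=> x; exact: (points_ball PX).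
Qed.

Lemma measurable_functional (f : forms) :
  symmetric_forms f -> continuous_forms f ->
  measurable_fun setT (functional X f).
Proof.
by move=> sf cf; apply: (FW_measurable_fun PX); exact: FW_measurable_functional.
Qed.

End functional_measurability.

(** * Scaling of Poisson points and the Euler field *)

Section scaling_of_points.
Context {R : realType} {d : nat}.
Context {disp : measure_display} {Omega : measurableType disp}.
Variables (P : probability Omega R) (X : Omega -> set 'rV[R]_d) (theta : R).
Hypotheses (theta_gt0 : 0 < theta) (PX : poisson_process P X theta).
Local Notation W := (@unit_ball R d).
Local Notation a := (theta * volume W).

(** Counts with sum n are at most n, so the possible families of counts form a finite type over
    which an expectation can be summed. *)
Definition nat_ffun (J : finType) n (K : {ffun J -> 'I_n.+1}) : {ffun J -> nat} :=
  [ffun c => K c : nat].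

Lemma integral_counts (J : finType) (D : set Omega) (k : Omega -> {ffun J -> nat})
    n (Psi : {ffun J -> nat} -> R) :
  (forall K, measurable (D `&` [set w | k w = K])) ->
  (forall w, D w -> (\sum_c k w c = n)%N) ->
  (forall K, 0 <= Psi K) ->
  (\int[P]_(w in D) (Psi (k w))%:E =
   \sum_(K : {ffun J -> 'I_n.+1} | (\sum_c K c == n)%N)
     (Psi (nat_ffun K))%:E * P (D `&` [set w | k w = nat_ffun K]))%E.
Proof.
move=> mk Dn Psi0.
pose A (K : {ffun J -> 'I_n.+1}) := D `&` [set w | k w = nat_ffun K].
have mI K : measurable_fun setT (\1_(A K) : Omega -> R) by apply: measurable_indic; exact: mk.
rewrite integral_mkcond.
transitivity (\int[P]_w (\sum_(K : {ffun J -> 'I_n.+1} | (\sum_c K c == n)%N)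
     (Psi (nat_ffun K))%:E * (\1_(A K) w)%:E))%E.
  apply: eq_integral => w _; rewrite patchE; case: ifPn => [|wD]; last first.
    rewrite big1// => K _; rewrite indicE memNset ?mule0// => -[Dw _].
    by move: wD; rewrite mem_set.
  rewrite inE => Dw.
  have kn c : (k w c < n.+1)%N.
    by rewrite ltnS -(Dn w Dw) (bigD1 c)//= leq_addr.
  pose K0 : {ffun J -> 'I_n.+1} := [ffun c => Ordinal (kn c)].
  have K0E : nat_ffun K0 = k w by apply/ffunP => c; rewrite !ffunE.
  rewrite (bigD1 K0)/=; last first.
    by under eq_bigr do rewrite ffunE/=; rewrite Dn.
  rewrite K0E indicE mem_set ?mule1; last by split.
  rewrite big1 ?adde0// => K /andP[_ KK0]; rewrite indicE memNset ?mule0//.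
  move=> -[_ /= kK]; move/eqP : KK0; apply; apply/ffunP => c; apply/val_inj.
  by rewrite /= ffunE/= kK ffunE.
under eq_integral do rewrite -big_filter.
rewrite ge0_integral_sum//.
- rewrite big_filter; apply: eq_bigr => K _.
  rewrite ge0_integralZl//.
  + by rewrite integral_indic ?setIT//; exact: mk.
  + by apply/measurable_EFinP; exact: mI.
  + by rewrite lee_fin.
- move=> K; under eq_fun do rewrite -EFinM.
  by apply/measurable_EFinP; apply: measurable_funM => //; exact: mI.
- by move=> K w _; rewrite mule_ge0// lee_fin.
Qed.

Lemma bounded_subW (B : set 'rV[R]_d) : B `<=` W -> bounded_set B.
Proof. exact: (@bounded_eball _ _ 1). Qed.

Lemma volume_partition (J : finType) (C : J -> set 'rV[R]_d) :
  (forall c, measurable (C c)) -> trivIset [set: J] C ->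
  \bigcup_(c in [set: J]) C c = W -> \sum_c volume (C c) = volume W.
Proof.
move=> mC tC CW; apply: EFin_inj.
have CcW c : C c `<=` W by rewrite -CW => x Cx; exists c.
rewrite (@EFin_volume _ _ 1)//; last exact: measurable_unit_ball.
rewrite -CW -sumEFin measure_fin_bigcup//; last exact: finite_finset.
rewrite fsbig_finite/=; last exact: finite_finset.
rewrite [RHS](_ : _ = \sum_c lebesgue_mx 1 d (C c))%E.
  by apply: eq_bigr => c _; rewrite (@EFin_volume _ _ 1).
apply: perm_big; apply: uniq_perm; [exact: fset_uniq|exact: index_enum_uniq|].
move=> c; rewrite mem_index_enum -[LHS]/(c \in fset_set _) in_fset_set//.
  by rewrite in_setT.
exact: finite_finset.
Qed.

(** Shrinking by r multiplies the mean of each cell by r^d, whence the power of r. The exponential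
    factors do not match cell by cell, but requiring the annulus W \ rW to be empty supplies exactly
    the missing one. *)
Lemma pr_counts_scale (J : finType) (C : J -> set 'rV[R]_d) (K : J -> nat) r :
  0 < r < 1 -> (forall c, measurable (C c)) -> trivIset [set: J] C ->
  \bigcup_(c in [set: J]) C c = W ->
  (P [set w | (forall c, count X [set x | C c (r^-1 *: x)] w = K c) /\
     count X (W `\` eball r) w = 0%N] =
   (r ^+ (d * \sum_c K c))%:E * P [set w | forall c, count X (C c) w = K c])%E.
Proof.
move=> /andP[r0 r1] mC tC CW.
have CcW c : C c `<=` W by rewrite -CW => x Cx; exists c.
pose C' c := [set x | C c (r^-1 *: x)].
have mC' c : measurable (C' c).
  by rewrite -[X in measurable X]setTI; exact: (measurable_scalemx r^-1 measurableT (mC c)).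
have C'r c : C' c `<=` eball r by move=> x /CcW; rewrite eballE.
have erW : eball r `<=` W.
  by move=> x xr; rewrite /W/= (le_trans xr)// ltW.
(* [None] indexes the annulus, whose prescribed count is 0. *)
pose B o := if o is Some c then C' c else W `\` eball r.
pose K' o := if o is Some c then K c else 0%N.
have mR : measurable (W `\` eball r).
  by apply: measurableD; [exact: measurable_unit_ball|exact: measurable_eball].
have mB o : measurable (B o) by case: o.
have BW o : B o `<=` W by case: o => [c x /C'r/erW//|x []].
rewrite (_ : mkset _ = [set w | forall o, count X (B o) w = K' o]); last first.
  apply/seteqP; split => w /=; first by move=> [h h0] [c|] //=; exact: h.
  by move=> h; split => [c|]; [exact: (h (Some c))|exact: (h None)].
have tB : trivIset setT B.
  apply/trivIsetP => -[c|] [c'|] _ _ //= cc'.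
  + apply/seteqP; split => // x [xc xc'].
    move/trivIsetP : tC => /(_ c c' I I); rewrite -(inj_eq (@Some_inj _)) => /(_ cc').
    by move/seteqP => [+ _] => /(_ (r^-1 *: x)); apply.
  + by apply/seteqP; split => // x [/C'r xr [_]].
  + by apply/seteqP; split => // x [[_ xr] /C'r].
rewrite (pr_counts PX K' mB (fun o => bounded_subW (BW o)) tB).
rewrite (pr_counts PX K mC (fun c => bounded_subW (CcW c)) tC).
rewrite -EFinM; congr EFin; rewrite (bigD1 None)//=.
rewrite (reindex_omap Some id)/=; last by case.
rewrite (eq_bigl xpredT); last by move=> c; rewrite eqxx.
have vR : volume (W `\` eball r) = (1 - r ^+ d) * volume W.
  rewrite mulrBl mul1r; apply/eqP; rewrite eq_sym subr_eq; apply/eqP.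
  rewrite -(volume_eball r0) -(@volumeD _ _ 1)//.
  + by rewrite setUC setDUK.
  + exact: measurable_eball.
  + by rewrite setDE -setIA setICl setI0.
rewrite /pois expr0 fact0 divr1 mul1r vR -(volume_partition mC tC CW).
rewrite !big_split/= -!(big_morph _ (@expRD R) (@expR0 R)).
have vC' c : volume (C' c) = r ^+ d * volume (C c).
  by rewrite /C' volume_scale ?invr_gt0// invrK.
have -> : \prod_i (theta * volume (C' i)) ^+ K i =
    r ^+ (d * \sum_c K c) * \prod_i (theta * volume (C i)) ^+ K i.
  rewrite big_distrr/= -prodrXr -big_split/=; apply: eq_bigr => c _.
  by rewrite vC' mulrCA exprMn -exprM.
rewrite -!mulrA mulrCA; congr (_ * _); rewrite mulrCA; congr (_ * _).
rewrite mulrCA; congr (_ * _).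
rewrite -expRD; congr expR; rewrite mulrA mulr_sumr -sumrN -big_split/=.
by apply: eq_bigr => c _; rewrite vC'; ring.
Qed.

End scaling_of_points.

Lemma bounded_convergence d' (T : measurableType d') (R : realType)
    (P : probability T R) (D : set T) (g_ : nat -> T -> R) (g : T -> R) (C : R) :
  measurable D -> (forall q, measurable_fun D (g_ q)) ->
  (forall w, D w -> g_ q w @[q --> \oo] --> g w) ->
  (forall q w, D w -> `|g_ q w| <= C) ->
  (\int[P]_(w in D) (g_ q w)%:E @[q --> \oo] --> \int[P]_(w in D) (g w)%:E)%E.
Proof.
move=> mD mg gg gC.
have [] := @dominated_convergence _ T R P D mD (fun q w => (g_ q w)%:E)
  (EFin \o g) (EFin \o cst C).
- by move=> q; apply/measurable_EFinP.
- by apply/measurable_EFinP; apply: measurable_fun_cvg mg gg.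
- by apply: aeW => w Dw; apply: cvg_EFin; [exact: nearW|exact: gg].
- exact: finite_measure_integrable_cst.
- by apply: aeW => w q Dw; rewrite lee_fin gC.
by move=> _ _.
Qed.

Section functional_scaling.
Context {R : realType} {d : nat}.
Context {disp : measure_display} {Omega : measurableType disp}.
Variables (P : probability Omega R) (X : Omega -> set 'rV[R]_d) (theta : R).
Hypotheses (theta_gt0 : 0 < theta) (PX : poisson_process P X theta).
Local Notation W := (@unit_ball R d).

Definition scalef r (f : @forms R d) : forms := fun n M => f n (r *: M).
Arguments scalef r f n M : clear implicits.

Lemma ballX_scale n r (M : 'M[R]_(n, d)) : 0 <= r <= 1 -> unit_ballX n M ->
  unit_ballX n (r *: M).
Proof.
move=> /andP[r0 r1] WM i; rewrite linearZ/= /unit_ball/= enormZ//.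
by have := WM i; rewrite /unit_ball/=; have := enorm_ge0 (row i M); nra.
Qed.

Lemma symmetric_scalef r f : 0 <= r <= 1 -> symmetric_forms f ->
  symmetric_forms (scalef r f).
Proof.
move=> r01 sf n p M WM; rewrite /scalef -(sf n p (r *: M)); last exact: ballX_scale.
by congr (f n _); apply/matrixP => i j; rewrite !mxE.
Qed.

Lemma continuous_scalef r f : 0 <= r <= 1 -> continuous_forms f ->
  continuous_forms (scalef r f).
Proof.
move=> r01 cf n M WM; apply: (@continuous_comp _ _ _ (fun M : 'M[R]_(n, d) => r *: M) (f n)).
  exact: scaler_continuous.
by apply: cf; exact: ballX_scale.
Qed.

Lemma form_seq_scale r f s :
  form_seq f (map (fun x => r *: x) s) = form_seq (scalef r f) s.
Proof.
rewrite (@form_seqE _ _ f (size s)) ?size_map//; congr (f _ _).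
by apply/matrixP => i j; rewrite !mxE (nth_map 0)// mxE.
Qed.

(* If all n points lie in [r W], a configuration of probability [r ^ (d n)] given
   [N = n], then dividing them by [r] gives again n Poisson points of [W]. *)
Lemma functional_scale (f : forms) n r C : 0 < r < 1 ->
  symmetric_forms f -> continuous_forms f ->
  (forall M, unit_ballX n M -> 0 <= f n M <= C) ->
  ((r ^+ (d * n))%:E * \int[P]_(w in [set w | count X W w = n]) (functional X (scalef r f) w)%:E
   <= \int[P]_(w in [set w | count X W w = n]) (functional X f w)%:E)%E.
Proof.
move=> r01 sf cf fC; have /andP[r0 r1] := r01.
have r01' : 0 <= r <= 1 by rewrite !ltW.
have sfr := symmetric_scalef r01' sf; have cfr := continuous_scalef r01' cf.
have frC M : unit_ballX n M -> 0 <= scalef r f n M <= C.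
  by move=> WM; apply: fC; exact: ballX_scale.
have seqC s : size s = n -> (forall x, x \in s -> W x) ->
    0 <= form_seq (scalef r f) s <= C.
  by move=> sn sW; rewrite (form_seqE _ sn); apply: frC; exact: ballX_seq.
pose D := [set w | count X W w = n].
pose D' := D `&` [set w | count X (W `\` eball r) w = 0%N].
have mW := @measurable_unit_ball R d.
have mR : measurable (W `\` eball r) by apply: measurableD => //; exact: measurable_eball.
have mD : measurable D by apply: (measurable_countE PX) => //; exact: bounded_unit_ball.
have mD' : measurable D'.
  by apply: measurableI => //; apply: (measurable_countE PX) => //; apply: bounded_subW => x [].
pose s' w := map (fun x => r^-1 *: x) (points X w).
have ptW w x : x \in points X w -> W x by exact: (points_ball PX).
pose R0 w := count X (W `\` eball r) w = 0%N.
have D'r w x : R0 w -> x \in points X w -> eball r x.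
  move=> h xp; apply: contrapT => xr.
  move: h; rewrite /R0 (count_points PX); last by move=> ? [].
  apply/eqP; rewrite -lt0n -has_count; apply/hasP; exists x => //.
  by rewrite inE; split => //; exact: ptW xp.
have s'W w x : R0 w -> x \in s' w -> W x.
  by move=> D'w /mapP[y ys ->]; have := D'r w y D'w ys; rewrite eballE.
pose C_ q c := [set x | W x /\ cell q x = c].
have mC_ q c : measurable (C_ q c) by exact: measurable_cell.
have C_W q c : C_ q c `<=` W by move=> x [].
pose C' q c := [set x | C_ q c (r^-1 *: x)].
have mC' q c : measurable (C' q c).
  by rewrite -[X in measurable X]setTI; exact: (measurable_scalemx r^-1 measurableT (mC_ q c)).
have C'W q c : C' q c `<=` W.
  move=> x [+ _]; rewrite -[unit_ball _]/([set x | unit_ball (r^-1 *: x)] x) -eballE// => h.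
  by rewrite /W/= (le_trans h)// ltW.
have counts' q w c : R0 w -> counts (cell q) (s' w) c = count X (C' q c) w.
  move=> D'w; rewrite ffunE (count_points PX)// count_map; apply: eq_in_count => x xs /=.
  apply/eqP/idP; last by rewrite inE => -[].
  move=> kx; rewrite inE; split => //; apply: (s'W w) => //.
  exact: map_f.
have mk q K : measurable (D `&` [set w | counts (cell q) (points X w) = K]).
  apply: measurableI => //; apply: (FW_measurable PX).
  apply: (FW_measurable_counts PX [set K]) => c; exact: mC_.
have k'E q (K : {ffun cell_type q -> nat}) : D' `&` [set w | counts (cell q) (s' w) = K] =
    D' `&` [set w | forall c, count X (C' q c) w = K c].
  apply/seteqP; split => w [D'w /= h]; have [_ R0w] := D'w; split => //=.
    by move=> c; rewrite -h counts'.
  by apply/ffunP => c; rewrite counts'.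
have mk' q K : measurable (D' `&` [set w | counts (cell q) (s' w) = K]).
  rewrite k'E; apply: measurableI => //.
  by apply: (measurable_counts PX) => // c; exact: bounded_subW.
have sumk q w : D w -> (\sum_c counts (cell q) (points X w) c = n)%N.
  by move=> Dw; under eq_bigr do rewrite ffunE; rewrite sum_count.
have sumk' q w : D' w -> (\sum_c counts (cell q) (s' w) c = n)%N.
  by move=> [Dw _]; under eq_bigr do rewrite ffunE; rewrite sum_count size_map.
(* The absolute value makes [Psi] nonnegative on every family of counts, as [integral_counts] asks;
   on counts of actual configurations it changes nothing. *)
pose Psi q K := `|form_seq (scalef r f) (listK (@cell_rep R d q) K)|.
have Psi0 q K : 0 <= Psi q K by exact: normr_ge0.
have PsiE q w : D w -> Psi q (counts (cell q) (points X w)) =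
    form_seq (scalef r f) (map (disc q) (points X w)).
  move=> Dw; rewrite /Psi -form_seq_counts//; last by move=> x; exact: ptW.
  rewrite ger0_norm//; apply: (proj1 (andP (seqC _ _ _))); first by rewrite size_map.
  by move=> x /mapP[y ys ->]; exact: (discP q (ptW w _ ys)).1.
have Psi'E q w : D' w -> Psi q (counts (cell q) (s' w)) =
    form_seq (scalef r f) (map (disc q) (s' w)).
  move=> D'w; have [Dw R0w] := D'w; rewrite /Psi -form_seq_counts//; last by move=> x; exact: s'W.
  rewrite ger0_norm//; apply: (proj1 (andP (seqC _ _ _))); first by rewrite !size_map.
  by move=> x /mapP[y ys ->]; exact: (discP q (s'W w _ R0w ys)).1.
pose Lq q := (\int[P]_(w in D) (Psi q (counts (cell q) (points X w)))%:E)%E.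
pose Rq q := (\int[P]_(w in D') (Psi q (counts (cell q) (s' w)))%:E)%E.
(* At a fixed mesh this is [pr_counts_scale] summed over all families of counts; both sides then
   converge as the mesh is refined. *)
have LR q : ((r ^+ (d * n))%:E * Lq q = Rq q)%E.
  rewrite /Lq /Rq (integral_counts P (mk q) (sumk q) (Psi0 q)).
  rewrite (integral_counts P (mk' q) (sumk' q) (Psi0 q)) ge0_sume_distrr; last first.
    by move=> K _; rewrite mule_ge0// lee_fin.
  apply: eq_bigr => K /eqP Kn; rewrite muleCA; congr (_ * _)%E.
  have nK : (\sum_c nat_ffun K c = n)%N.
    by rewrite -[RHS]Kn; apply: eq_bigr => c _; rewrite ffunE.
  rewrite k'E.
  have -> : D `&` [set w | counts (cell q) (points X w) = nat_ffun K] =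
      [set w | forall c, count X (C_ q c) w = nat_ffun K c].
    apply/seteqP; split => w /=.
      by move=> [_ <-] c; rewrite (counts_points PX).
    move=> h; have kK : counts (cell q) (points X w) = nat_ffun K.
      by apply/ffunP => c; rewrite (counts_points PX); exact: h.
    split => //; rewrite /D/= -size_points -(sum_count (cell q)) -[RHS]nK -kK.
    by apply: eq_bigr => c _; rewrite ffunE.
  have := @pr_counts_scale _ _ _ _ _ _ _ PX _ _ (nat_ffun K) _ r01 (mC_ q).
  rewrite nK => <-; last 2 first.
  - apply/trivIsetP => c c' _ _ /eqP cc'; apply/seteqP; split => // x [[_ xc] [_ xc']].
    by apply: cc'; rewrite -xc -xc'.
  - apply/seteqP; split => x; first by move=> [c _ []].
    by move=> Wx; exists (cell q x).
  congr (P _); apply/seteqP; split => w /=; last by move=> [[_ ?] ?].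
  move=> [h h0]; split => //; split => //.
  rewrite /D/= -size_points -(size_map (fun x => r^-1 *: x)) -/(s' w).
  rewrite -(sum_count (cell q)) -[RHS]nK; apply: eq_bigr => c _.
  by rewrite -h -counts'// ffunE.
have Lcvg : Lq q @[q --> \oo] --> (\int[P]_(w in D) (functional X (scalef r f) w)%:E)%E.
  apply: (@bounded_convergence _ _ _ _ _ _ _ C) => //.
  - move=> q _ B mB.
    exact: (@measurable_preimage_countable_in _ Omega {ffun cell_type q -> nat} D
      _ [set K | B (Psi q K)] (mk q)).
  - move=> w Dw; under eq_fun do rewrite PsiE//.
    by apply: form_seq_disc_cvg => // x; exact: ptW.
  - move=> q w Dw; rewrite PsiE//.
    have /andP[h1 h2] := seqC (map (disc q) (points X w)) (etrans (size_map _ _) Dw)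
      (fun x => (fun H : x \in _ => let: ex_intro2 y ys e := mapP H in
        eq_ind_r W (discP q (ptW w _ ys)).1 e)).
    by rewrite ger0_norm.
have Rcvg : Rq q @[q --> \oo] --> (\int[P]_(w in D') (functional X f w)%:E)%E.
  apply: (@bounded_convergence _ _ _ _ _ _ _ C) => //.
  - move=> q _ B mB.
    exact: (@measurable_preimage_countable_in _ Omega {ffun cell_type q -> nat} D'
      _ [set K | B (Psi q K)] (mk' q)).
  - move=> w D'w; have [Dw R0w] := D'w; under eq_fun do rewrite Psi'E//.
    have -> : functional X f w = form_seq (scalef r f) (s' w).
      rewrite -form_seq_scale /s' -map_comp map_id_in// => x _ /=.
      by rewrite scalerA divff ?scale1r// gt_eqF.
    by apply: form_seq_disc_cvg => // x; exact: s'W.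
  - move=> q w D'w; have [Dw R0w] := D'w; rewrite Psi'E//.
    have /andP[h1 h2] := seqC (map (disc q) (s' w))
      (etrans (size_map _ _) (etrans (size_map _ _) Dw))
      (fun x => (fun H : x \in _ => let: ex_intro2 y ys e := mapP H in
        eq_ind_r W (discP q (s'W w _ R0w ys)).1 e)).
    by rewrite ger0_norm.
(* The left-hand side equals the integral over [D'], where all points lie in rW; the inequality
   comes from enlarging [D'] to [D], the form being nonnegative. *)
rewrite (_ : (_ * _)%E = (\int[P]_(w in D') (functional X f w)%:E)%E).
  apply: ge0_subset_integral => //.
  - by apply/measurable_EFinP; apply: measurable_funTS; exact: (measurable_functional PX).
  - move=> w Dw; rewrite lee_fin functionalE (form_seqE _ Dw).
    by apply: (proj1 (andP (fC _ _))); apply: ballX_seq => // x; exact: ptW.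
  - by move=> w [].
have RqE : Rq = fun q => ((r ^+ (d * n))%:E * Lq q)%E by apply/funext.
apply/esym; rewrite RqE in Rcvg; move/cvg_lim : Rcvg => <- //.
by apply/cvg_lim => //; apply: cvgeZl.
Qed.

End functional_scaling.
Arguments scalef {R d} r f n M.

Lemma cvg_sumr (R : realType) (T : Type) (F : set_system T) (I : Type) (r : seq I)
    (f : I -> T -> R) (a : I -> R) {FF : Filter F} :
  (forall i, f i @ F --> a i) ->
  (\sum_(i <- r) f i x) @[x --> F] --> \sum_(i <- r) a i.
Proof.
move=> fa; elim: r => [|i r IH].
  by rewrite big_nil; under eq_fun do rewrite big_nil; exact: cvg_cst.
rewrite big_cons; under eq_fun do rewrite big_cons.
by apply: cvgD => //; exact: fa.
Qed.

(** * Regular forms and their derivative along dilations *)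

Section regular_forms.
Context {R : realType} {d : nat}.
Implicit Types f g : @forms R d.

Definition C1_forms f := forall n, C1_on (unit_ballX n) (f n).

(** The bound may depend on n: closability is proved on each event N = n separately. *)
Definition bounded_forms f := forall n, exists C : R, forall M, unit_ballX n M ->
  `|f n M| <= C /\ forall i j, `|'D_(delta_mx i j) (f n) M| <= C.

Definition regular_forms f :=
  [/\ symmetric_forms f, C1_forms f & bounded_forms f].

Definition subf f g : forms := fun n M => f n M - g n M.
Arguments subf f g n M : clear implicits.

Definition euler f : forms :=
  fun n M => \sum_i \sum_j M i j * 'D_(delta_mx i j) (f n) M.
Arguments euler f n M : clear implicits.

Lemma C1_formsP f n M : C1_forms f -> unit_ballX n M ->
  differentiable (f n) M /\
  forall i j, {for M, continuous ('D_(delta_mx i j) (f n))}.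
Proof. by move=> /(_ n)[U [oU WU h]] WM; apply: h; exact: WU. Qed.

Lemma C1_continuous f : C1_forms f -> continuous_forms f.
Proof.
by move=> C1 n M WM; apply: differentiable_continuous; exact: (C1_formsP C1 WM).1.
Qed.

Lemma diff_matrix n (h : 'M[R]_(n, d) -> R) M A : differentiable h M ->
  'd h M A = \sum_i \sum_j A i j * 'D_(delta_mx i j) h M.
Proof.
move=> dh; rewrite {1}(matrix_sum_delta A) linear_sum; apply: eq_bigr => i _.
rewrite linear_sum; apply: eq_bigr => j _.
by rewrite linearZ/= deriveE.
Qed.

Lemma eulerE f n M : C1_forms f -> unit_ballX n M -> euler f n M = 'd (f n) M M.
Proof. by move=> C1 WM; rewrite diff_matrix//; exact: (C1_formsP C1 WM).1. Qed.

Lemma continuous_euler f : C1_forms f -> continuous_forms (euler f).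
Proof.
move=> C1 n M WM; have [_ cD] := C1_formsP C1 WM.
rewrite /euler; apply: (@cvg_sumr R _ (nbhs M)) => i; apply: (@cvg_sumr R _ (nbhs M)) => j.
by apply: cvgM; [exact: coord_continuous|exact: cD].
Qed.

Lemma continuous_subf f g : continuous_forms f -> continuous_forms g ->
  continuous_forms (subf f g).
Proof.
move=> cf cg n M WM.
by apply: (@cvgB _ _ _ (nbhs M) _ (f n) (g n)); [exact: cf|exact: cg].
Qed.

Lemma symmetric_subf f g : symmetric_forms f -> symmetric_forms g ->
  symmetric_forms (subf f g).
Proof. by move=> sf sg n p M WM; rewrite /subf sf// sg. Qed.

Lemma regular_subf f g : regular_forms f -> regular_forms g ->
  regular_forms (subf f g).
Proof.
move=> [sf Cf bf] [sg Cg bg]; split.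
- exact: symmetric_subf.
- move=> n; have [U [oU WU hU]] := Cf n; have [U' [oU' WU' hU']] := Cg n.
  exists (U `&` U'); split; first exact: openI.
    by move=> M WM; split; [exact: WU|exact: WU'].
  move=> M [UM U'M]; have [dfM cfM] := hU M UM; have [dgM cgM] := hU' M U'M.
  split; first exact: differentiableB.
  move=> i j.
  (* Continuity of the derivative of a difference needs the formula for this derivative near [M],
     not only at [M]; hence the intersection of the two neighbourhoods. *)
  have nE : {near M, ('D_(delta_mx i j) (f n) \- 'D_(delta_mx i j) (g n)) =1
      'D_(delta_mx i j) (subf f g n)}.
    have : nbhs M (U `&` U') by apply: open_nbhs_nbhs; split => //; exact: openI.
    apply: filterS => N [UN U'N] /=; rewrite deriveB//; apply: diff_derivable.
      by have [] := hU N UN.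
    by have [] := hU' N U'N.
  have /= eM := nbhs_singleton nE; rewrite /prop_for /continuous_at -eM.
  apply: cvg_trans (cvgB (cfM i j) (cgM i j)).
  exact: near_eq_cvg nE.
- move=> n; have [C hC] := bf n; have [C' hC'] := bg n.
  exists (C + C') => M WM; have [fC DfC] := hC M WM; have [gC DgC] := hC' M WM.
  split; first by rewrite (le_trans (ler_normB _ _))// lerD.
  move=> i j; rewrite deriveB; first by rewrite (le_trans (ler_normB _ _))// lerD.
    by apply: diff_derivable; exact: (C1_formsP Cf WM).1.
  by apply: diff_derivable; exact: (C1_formsP Cg WM).1.
Qed.

Lemma euler_subf f g n M : C1_forms f -> C1_forms g -> unit_ballX n M ->
  euler (subf f g) n M = euler f n M - euler g n M.
Proof.
move=> Cf Cg WM; rewrite /euler -sumrB; apply: eq_bigr => i _.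
rewrite -sumrB; apply: eq_bigr => j _; rewrite -mulrBr deriveB//.
  by apply: diff_derivable; exact: (C1_formsP Cf WM).1.
by apply: diff_derivable; exact: (C1_formsP Cg WM).1.
Qed.

Lemma expRN01 (t : R) : 0 <= t -> 0 <= expR (- t) <= 1.
Proof. by move=> t0; rewrite expR_ge0 expR_le1 oppr_le0. Qed.

(** The velocity of e^{-t} M is its own opposite, so at every time the derivative is the Euler
    derivative at the moved point, up to sign. *)
Lemma is_derive_flow f n M (t : R) : C1_forms f -> unit_ballX n M -> 0 <= t ->
  is_derive t 1 (fun t => f n (expR (- t) *: M)) (- euler f n (expR (- t) *: M)).
Proof.
move=> C1 WM t0.
have WtM : unit_ballX n (expR (- t) *: M) by apply: ballX_scale => //; exact: expRN01.
have [df _] := C1_formsP C1 WtM.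
have de : is_derive t 1 (fun t => expR (- t)) (- expR (- t)).
  by apply: is_derive_eq; rewrite mulrN1.
have dde : differentiable (fun t : R => expR (- t)) t.
  by apply/derivable1_diffP; case: de.
have dg : differentiable (fun t : R => expR (- t) *: M) t by exact: differentiableZl.
have dfg : differentiable ((f n) \o (fun t : R => expR (- t) *: M)) t.
  exact: differentiable_comp.
apply: DeriveDef; first exact: diff_derivable dfg.
have de' : 'd (fun t : R => expR (- t)) t 1 = - expR (- t).
  by rewrite -deriveE//; exact: derive_val.
rewrite deriveE// diff_comp//= diffZl//= de'.
by rewrite eulerE// scaleNr linearN.
Qed.

Lemma euler_bound f n C M : (forall M, unit_ballX n M ->
    forall i j, `|'D_(delta_mx i j) (f n) M| <= C) -> unit_ballX n M ->
  `|euler f n M| <= (n * d)%:R * C.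
Proof.
move=> hC WM; rewrite /euler (le_trans (ler_norm_sum _ _ _))//.
rewrite natrM -mulrA -[X in X%:R * _](card_ord n) mulr_natl -sumr_const ler_sum// => i _.
rewrite (le_trans (ler_norm_sum _ _ _))//.
rewrite -[X in X%:R * _](card_ord d) mulr_natl -sumr_const ler_sum// => j _.
rewrite normrM (le_trans _ (hC M WM i j))// -[leRHS]mul1r ler_wpM2r//.
have := entry_le_enorm (row i M) j; rewrite mxE => /le_trans; apply; exact: WM.
Qed.

(** Mean value theorem along the trajectory, which stays in W^n because dilations with ratio at most
    1 preserve it. *)
Lemma flow_diff_bound f n C M (t : R) : C1_forms f ->
  (forall M, unit_ballX n M -> `|euler f n M| <= C) -> unit_ballX n M -> 0 <= t ->
  `|f n M - f n (expR (- t) *: M)| <= C * t.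
Proof.
move=> C1 hC WM; rewrite le_eqVlt => /predU1P[<-|t0].
  by rewrite oppr0 expR0 scale1r subrr normr0 mulr0.
pose g (t : R) := f n (expR (- t) *: M).
have dflow (x : R) : 0 <= x -> is_derive x 1 g (- euler f n (expR (- x) *: M)).
  exact: is_derive_flow.
have [||c ct] := @MVT R g (fun x => - euler f n (expR (- x) *: M)) 0 t t0.
- move=> x; rewrite in_itv/= => /andP[x0 _]; exact: dflow (ltW x0).
- apply: derivable_within_continuous => x; rewrite in_itv/= => /andP[x0 _].
  by have [] := dflow x x0.
rewrite subr0 /g oppr0 expR0 scale1r => e; rewrite distrC e normrM normrN (gtr0_norm t0).
rewrite ler_wpM2r ?(ltW t0)//; apply: hC; apply: ballX_scale => //.
by apply: expRN01; move: ct; rewrite in_itv/= => /andP[/ltW].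
Qed.

Lemma flow_diff_cvg f n M (t_ : nat -> R) : C1_forms f -> unit_ballX n M ->
  (forall K, 0 < t_ K) -> t_ @ \oo --> 0 ->
  (f n M - f n (expR (- t_ K) *: M)) / t_ K @[K --> \oo] --> euler f n M.
Proof.
move=> C1 WM t_gt0 t_cvg.
have [dv] := is_derive_flow C1 WM (lexx 0); rewrite oppr0 expR0 scale1r /derive => dE.
move: dv; rewrite /derivable dE oppr0 expR0 scale1r => dv.
apply: cvg_trans (_ : - ((t_ K)^-1 *: (f n (expR (- (t_ K *: 1 + 0)) *: M) - f n M)) @[K --> \oo] `=>` _).
  apply: near_eq_cvg; apply: nearW => K /=.
  by rewrite -scalerN opprB /GRing.scale/= mulr1 addr0 mulrC.
rewrite -[euler f n M]opprK; apply: cvgN.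
apply: (@cvg_comp _ _ _ t_ (fun h : R => h^-1 *: (f n (expR (- (h *: 1 + 0)) *: M) - f n M)) _ _ _ _ dv).
(* No [t_ K] is 0, so convergence to 0 is convergence in the punctured neighbourhoods on which
   derivatives are defined. *)
move=> A nA.
have nA' : \forall K \near \oo, t_ K != 0 -> A (t_ K) := t_cvg _ nA.
by apply: filterS nA' => K; apply; rewrite (gt_eqF (t_gt0 K)).
Qed.

(** A limit of symmetric difference quotients is symmetric; this avoids permuting partial
    derivatives. *)
Lemma symmetric_euler f : symmetric_forms f -> C1_forms f ->
  symmetric_forms (euler f).
Proof.
move=> sf C1 n p M WM.
have WpM : unit_ballX n (row_perm p M).
  by move=> i; rewrite (_ : row i _ = row (p i) M)//; apply/rowP => j; rewrite !mxE.
have h0 K : 0 < K.+1%:R^-1 :> R by [].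
have hc : (fun K => K.+1%:R^-1 : R) @ \oo --> 0 by exact: cvg_harmonic.
have e1 := flow_diff_cvg C1 WM h0 hc; have e2 := flow_diff_cvg C1 WpM h0 hc.
apply: cvg_unique e2 _ => //; apply: cvg_trans e1; apply: near_eq_cvg; apply: nearW => K /=.
rewrite (sf n p M)//; congr ((_ - _) / _).
rewrite -(sf n p (expR (- K.+1%:R^-1) *: M)).
  by congr (f n _); apply/matrixP => i j; rewrite !mxE.
by apply: ballX_scale => //; exact: expRN01.
Qed.

End regular_forms.
Arguments subf {R d} f g n M.
Arguments euler {R d} f n M.

(** * Closability of the Euler derivative *)

Section closability.
Context {R : realType} {d : nat}.
Context {disp : measure_display} {Omega : measurableType disp}.
Variables (P : probability Omega R) (X : Omega -> set 'rV[R]_d) (theta : R).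
Hypotheses (theta_gt0 : 0 < theta) (PX : poisson_process P X theta).
Local Notation W := (@unit_ball R d).
Implicit Types (f h : @forms R d).

Definition event n := [set w | count X W w = n].

Lemma measurable_event n : measurable (event n).
Proof.
apply: (measurable_countE PX); [exact: measurable_unit_ball|exact: bounded_unit_ball].
Qed.

(** The L^1 seminorm on {N = n}: the scaling inequality is about nonnegative functionals and costs a
    factor depending on n, hence L^1 and a single n. *)
Definition nrm n (Z : Omega -> R) : \bar R := (\int[P]_(w in event n) `|Z w|%:E)%E.

Lemma nrm_ge0 n Z : (0 <= nrm n Z)%E.
Proof. by apply: integral_ge0 => w _; rewrite lee_fin. Qed.

Lemma nrmD n (Z Z' : Omega -> R) : measurable_fun setT Z -> measurable_fun setT Z' ->
  (nrm n (fun w => Z w + Z' w)%R <= nrm n Z + nrm n Z')%E.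
Proof.
move=> mZ mZ'; have mN := measurable_event n.
have mabs (Y : Omega -> R) : measurable_fun setT Y -> measurable_fun (event n) (fun w => `|Y w|%:E).
  by move=> mY; apply/measurable_EFinP; apply: measurable_funTS; exact: measurableT_comp.
rewrite -ge0_integralD//; [|exact: mabs|exact: mabs].
apply: ge0_le_integral => //.
- by apply: mabs; exact: measurable_funD.
- by apply: emeasurable_funD; exact: mabs.
- by move=> w _; rewrite -EFinD lee_fin ler_normD.
Qed.

Lemma nrmZ n (Z : Omega -> R) (c : R) : measurable_fun setT Z -> 0 <= c ->
  nrm n (fun w => c * Z w)%R = (c%:E * nrm n Z)%E.
Proof.
move=> mZ c0; rewrite -ge0_integralZl//.
- by apply: eq_integral => w _; rewrite normrM ger0_norm// EFinM.
- exact: measurable_event.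
- by apply/measurable_EFinP; apply: measurable_funTS; exact: measurableT_comp.
Qed.

Lemma nrm_eq n (Z Z' : Omega -> R) : (forall w, event n w -> Z w = Z' w) -> nrm n Z = nrm n Z'.
Proof. by move=> ZZ'; apply: eq_integral => w; rewrite inE => /ZZ' ->. Qed.

Lemma nrmN n (Z : Omega -> R) : nrm n (fun w => - Z w) = nrm n Z.
Proof. by apply: eq_integral => w _; rewrite normrN. Qed.

Lemma functional_event n w : event n w -> exists2 M, unit_ballX n M &
  forall f, functional X f w = f n M.
Proof.
move=> nw; exists (\matrix_(i < n) nth 0 (points X w) i).
  by apply: ballX_seq => // x; exact: (points_ball PX).
by move=> g; rewrite functionalE; exact: form_seqE.
Qed.

Definition absf f : forms := fun n M => `|f n M|.
Arguments absf f n M : clear implicits.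

(** [functional_scale] for |h|: contracting the points by r costs at most a factor r^{-dn} in
    L^1. *)
Lemma nrm_scale h n (r C : R) : 0 < r < 1 -> symmetric_forms h ->
  continuous_forms h -> (forall M, unit_ballX n M -> `|h n M| <= C) ->
  (nrm n (functional X (scalef r h)) <=
   ((r ^+ (d * n))^-1)%:E * nrm n (functional X h))%E.
Proof.
move=> r01 sh ch hC; have /andP[r0 r1] := r01.
have rn0 : 0 < r ^+ (d * n) by rewrite exprn_gt0.
have := @functional_scale _ _ _ _ P X theta PX (absf h) n r C r01.
rewrite -/(event n) => H.
rewrite muleC lee_pdivlMr// muleC; apply: H.
- by move=> m p M WM; rewrite /absf sh.
- move=> m M WM; apply: (@continuous_comp _ _ _ (h m) Num.norm); first exact: ch.
  exact: norm_continuous.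
- by move=> M WM; rewrite normr_ge0 hC.
Qed.

Definition flow_diff h (t : R) : forms := subf h (scalef (expR (- t)) h).
Arguments flow_diff h t n M : clear implicits.

Lemma flow_diffP h (t : R) : symmetric_forms h -> C1_forms h -> 0 <= t ->
  symmetric_forms (flow_diff h t) /\ continuous_forms (flow_diff h t).
Proof.
move=> sh C1 t0; have t01 := expRN01 t0.
have sth := symmetric_scalef t01 sh.
have cth := continuous_scalef t01 (C1_continuous C1).
split; first exact: symmetric_subf.
by apply: continuous_subf => //; exact: C1_continuous.
Qed.

Lemma measurable_flow_diff h (t : R) : symmetric_forms h -> C1_forms h -> 0 <= t ->
  measurable_fun setT (functional X (flow_diff h t)).
Proof.
move=> sh C1 t0; have [sfh cfh] := flow_diffP sh C1 t0.
exact: (measurable_functional PX).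
Qed.

Lemma nrm_flow_cvg h n (t_ : nat -> R) : regular_forms h ->
  (forall K, 0 < t_ K) -> t_ @ \oo --> 0 ->
  (((t_ K)^-1)%:E * nrm n (functional X (flow_diff h (t_ K))) @[K --> \oo] -->
   nrm n (functional X (euler h)))%E.
Proof.
move=> [sh C1 bh] t0 t_cvg.
have [C0 hC0] := bh n.
have hC M : unit_ballX n M -> `|euler h n M| <= (n * d)%:R * C0.
  by move=> WM; apply: euler_bound => // N WN; exact: (hC0 N WN).2.
have mq K : measurable_fun setT (functional X (flow_diff h (t_ K))).
  by apply: measurable_flow_diff => //; exact: ltW.
under eq_fun => K do rewrite -nrmZ ?invr_ge0 ?(ltW (t0 K))//.
apply: (@bounded_convergence _ _ _ P _ _ _ ((n * d)%:R * C0)).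
- exact: measurable_event.
- move=> K; apply: measurable_funTS; apply: measurableT_comp => //.
  exact: measurable_funM.
- move=> w nw; have [M WM fM] := functional_event nw.
  apply: cvg_norm; rewrite fM; under eq_fun do rewrite fM mulrC.
  exact: flow_diff_cvg.
- move=> K w nw; have [M WM ->] := functional_event nw.
  rewrite normr_id normrM gtr0_norm ?invr_gt0// mulrC ler_pdivrMr//.
  by apply: flow_diff_bound => //; exact: ltW.
Qed.

(* [h - h(r^k .)] telescopes into [k] differences scaled by powers of [r]. *)
Lemma nrm_flow_iter h n (r : R) (K k : nat) : regular_forms h -> 0 < r < 1 ->
  (k <= K)%N ->
  (nrm n (functional X (subf h (scalef (r ^+ k) h))) <=
   (k%:R * (r ^+ (K * (d * n)))^-1)%:E *
     nrm n (functional X (subf h (scalef r h))))%E.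
Proof.
move=> [sh C1 bh] /andP[r0 r1].
have r01 : 0 <= r <= 1 by rewrite !ltW.
pose u := subf h (scalef r h).
have ch := C1_continuous C1.
have rk j : 0 <= r ^+ j <= 1 by rewrite exprn_ge0 ?exprn_ile1// ltW.
have sfh (g : @forms R d) : symmetric_forms g -> forall j, symmetric_forms (subf g (scalef (r ^+ j) g)).
  by move=> sg j; apply: symmetric_subf => //; exact: symmetric_scalef.
have cfh (g : @forms R d) : continuous_forms g -> forall j, continuous_forms (subf g (scalef (r ^+ j) g)).
  by move=> cg j; apply: continuous_subf => //; exact: continuous_scalef.
have su : symmetric_forms u by rewrite /u -[r]expr1; exact: sfh.
have cu : continuous_forms u by rewrite /u -[r]expr1; exact: cfh.
have [C0 hC0] := bh n.
have uC M : unit_ballX n M -> `|u n M| <= C0 + C0.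
  move=> WM; rewrite (le_trans (ler_normB _ _))// lerD//; first exact: (hC0 M WM).1.
  by apply: (hC0 _ _).1; exact: ballX_scale.
have mu (g : @forms R d) : symmetric_forms g -> continuous_forms g -> measurable_fun setT (functional X g).
  by move=> *; exact: (measurable_functional PX).
elim: k => [|k IH] kK.
  rewrite mul0r mul0e expr0 (_ : nrm _ _ = 0%E)//.
  rewrite /nrm; under eq_integral => w _ do
    rewrite functionalE /form_seq /subf /scalef scale1r subrr normr0.
  by rewrite integral0.
have sk : symmetric_forms (scalef (r ^+ k) u) by exact: symmetric_scalef.
have ck : continuous_forms (scalef (r ^+ k) u) by exact: continuous_scalef.
rewrite (@nrm_eq n _ (fun w => functional X (subf h (scalef (r ^+ k) h)) w +
    functional X (scalef (r ^+ k) u) w)); last first.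
  move=> w nw; have [M WM fM] := functional_event nw.
  by rewrite !fM /u /subf /scalef scalerA -exprS; ring.
have m1 := mu _ (sfh _ sh k) (cfh _ ch k); have m2 := mu _ sk ck.
apply: (le_trans (nrmD _ m1 m2)).
rewrite -natr1 mulrDl EFinD ge0_muleDl ?lee_fin; last 2 first.
  by rewrite mulr_ge0// invr_ge0 exprn_ge0// ltW.
  by rewrite mul1r invr_ge0 exprn_ge0// ltW.
apply: leeD; first exact/IH/ltnW.
(* Every scaling factor is replaced by the largest one, reached at [K], so that the bound is linear
   in [k]. *)
rewrite mul1r; have rK : (r ^+ k ^+ (d * n))^-1 <= (r ^+ (K * (d * n)))^-1.
  rewrite -exprM lef_pV2 ?posrE ?exprn_gt0//.
  by rewrite ler_wiXn2l ?ltW// leq_mul// ltnW.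
have [k0|k0] := posnP k.
  rewrite k0 expr0 -[X in (X <= _)%E]mul1e.
  have -> : functional X (scalef 1 u) = functional X u.
    by apply/funext => w; rewrite !functionalE /form_seq /scalef scale1r.
  apply: lee_pmul => //; first exact: nrm_ge0.
  by rewrite lee_fin (le_trans _ rK)// k0 expr0 expr1n invr1.
apply: (le_trans (nrm_scale (C := C0 + C0) _ su cu uC)).
  by rewrite exprn_gt0// exprn_ilt1 ?ltW// -lt0n.
apply: lee_pmul => //.
  by rewrite lee_fin invr_ge0 exprn_ge0// exprn_ge0// ltW.
exact: nrm_ge0.
Qed.

Lemma invr_expRNX (t : R) m : (expR (- t) ^+ m)^-1 = expR (t * m%:R).
Proof. by rewrite -expRM_natl -expRN; congr expR; ring. Qed.

(** Time [t] is cut into K + 1 equal steps. Their total contraction is e^{-t}, so all scaling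
    factors are at most e^{tdn}; as K grows, the increment over one step divided by its length tends
    to the Euler derivative. No integral over time is formed. *)
Lemma nrm_flow h n (t : R) : regular_forms h -> 0 < t ->
  (nrm n (functional X (flow_diff h t)) <=
   (expR (t * (d * n)%:R) * t)%:E * nrm n (functional X (euler h)))%E.
Proof.
move=> rh t0; pose t_ K := t / K.+1%:R.
have t_gt0 K : 0 < t_ K by rewrite divr_gt0.
have t_cvg : t_ @ \oo --> 0.
  rewrite -[X in _ --> X](mulr0 t); apply: cvgM; first exact: cvg_cst.
  exact: cvg_harmonic.
have H : ((expR (t * (d * n)%:R) * t)%:E *
    (((t_ K)^-1)%:E * nrm n (functional X (flow_diff h (t_ K)))) @[K --> \oo] -->
    (expR (t * (d * n)%:R) * t)%:E * nrm n (functional X (euler h)))%E.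
  by apply: cvgeZl => //; exact: nrm_flow_cvg.
apply: (cvge_to_ge H); apply: nearW => K.
have rK : expR (- t_ K) ^+ K.+1 = expR (- t).
  rewrite -expRM_natl; congr expR; rewrite /t_ mulrN mulrCA divff ?mulr1//.
have := @nrm_flow_iter h n (expR (- t_ K)) K.+1 K.+1 rh.
rewrite expR_gt0 expR_lt1 oppr_lt0 t_gt0 => /(_ isT (leqnn _)).
rewrite exprM rK -/(flow_diff h t) -/(flow_diff h (t_ K)) => /le_trans; apply.
rewrite muleA -EFinM; apply: lee_pmul => //.
  exact: nrm_ge0.
rewrite lee_fin invr_expRNX -mulrA mulrC ler_wpM2l ?expR_ge0//.
by rewrite /t_ invf_div mulrCA divff ?mulr1// gt_eqF.
Qed.

(* In [nrm_flow] applied to [h m - h l], let [l] tend to infinity, then divide by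
   [t] and let [t] tend to 0: the norm of [euler (h m)] is bounded by its distance
   to [eta], and tends to 0. *)
Lemma euler_closable (h : nat -> @forms R d) n (eta : Omega -> R) :
  (forall l, regular_forms (h l)) -> measurable_fun setT eta ->
  (nrm n (functional X (h l)) @[l --> \oo] --> 0)%E ->
  (nrm n (fun w => functional X (euler (h l)) w - eta w)%R @[l --> \oo] --> 0)%E ->
  nrm n eta = 0%E.
Proof.
move=> rh meta h0 e0.
pose e l w := functional X (euler (h l)) w.
pose a l := nrm n (fun w => e l w - eta w).
have me l : measurable_fun setT (e l).
  have [sl C1 bl] := rh l; apply: (measurable_functional PX).
    exact: symmetric_euler.
  exact: continuous_euler.
have mh l : measurable_fun setT (functional X (h l)).
  by have [sl C1 bl] := rh l; apply: (measurable_functional PX) => //; exact: C1_continuous.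
have flow_le m t : 0 < t -> (nrm n (functional X (flow_diff (h m) t)) <=
    (expR (t * (d * n)%:R) * t)%:E * a m)%E.
  move=> t0; set c := expR (t * (d * n)%:R) * t.
  have c0 : 0 <= c by rewrite mulr_ge0 ?expR_ge0// ltW.
  have t01 := expRN01 (ltW t0).
  (* Split h_m = h_l + (h_m - h_l). The increment of h_l is bounded by the norm of h_l, which
     vanishes as l grows; that of the difference by its Euler derivative, estimated by passing
     through [eta]. *)
  have key l : (nrm n (functional X (flow_diff (h m) t)) <=
      (1 + expR (t * (d * n)%:R))%:E * nrm n (functional X (h l)) + c%:E * (a m + a l))%E.
    have [sm C1m bm] := rh m; have [sl C1l bl] := rh l.
    have rg := regular_subf (rh m) (rh l); have [sg C1g bg] := rg.
    rewrite (@nrm_eq n _ (fun w => functional X (flow_diff (h l) t) w +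
        functional X (flow_diff (subf (h m) (h l)) t) w)); last first.
      move=> w nw; have [M WM fM] := functional_event nw.
      by rewrite !fM /flow_diff /subf /scalef; ring.
    have mfl := measurable_flow_diff sl C1l (ltW t0).
    have mfg := measurable_flow_diff sg C1g (ltW t0).
    apply: (le_trans (nrmD _ mfl mfg)); apply: leeD.
      have mS : measurable_fun setT (functional X (scalef (expR (- t)) (h l))).
        apply: (measurable_functional PX); first exact: symmetric_scalef.
        by apply: continuous_scalef => //; exact: C1_continuous.
      have mNS : measurable_fun setT (fun w => - functional X (scalef (expR (- t)) (h l)) w).
        exact: measurableT_comp.
      rewrite (@nrm_eq n _ (fun w => functional X (h l) w +
        (- functional X (scalef (expR (- t)) (h l)) w)))//.
      apply: (le_trans (nrmD _ (mh l) mNS)).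
      rewrite EFinD ge0_muleDl ?lee_fin ?expR_ge0// mul1e; apply: leeD => //.
      rewrite (_ : nrm n (fun w => - _) = nrm n (functional X (scalef (expR (- t)) (h l)))); last first.
        exact: nrmN.
      have [C0 hC0] := bl n.
      have := @nrm_scale (h l) n (expR (- t)) C0 _ sl (C1_continuous C1l) (fun M WM => (hC0 M WM).1).
      rewrite expR_gt0 expR_lt1 oppr_lt0 t0 => /(_ isT) /le_trans; apply.
      by rewrite invr_expRNX.
    apply: (le_trans (@nrm_flow _ n _ rg t0)).
    apply: lee_pmul => //; first exact: nrm_ge0.
    rewrite (@nrm_eq n _ (fun w => (e m w - eta w) + (- (e l w - eta w)))); last first.
      move=> w nw; have [M WM fM] := functional_event nw.
      by rewrite /e !fM euler_subf//; ring.
    have mel j : measurable_fun setT (fun w => e j w - eta w) by exact: measurable_funB.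
    have mNel j : measurable_fun setT (fun w => - (e j w - eta w)) by exact: measurableT_comp.
    apply: (le_trans (nrmD _ (mel m) (mNel l))); apply: leeD => //.
    by rewrite nrmN.
  have lim : ((1 + expR (t * (d * n)%:R))%:E * nrm n (functional X (h l)) + c%:E * (a m + a l)
      @[l --> \oo] --> (1 + expR (t * (d * n)%:R))%:E * 0 + c%:E * (a m + 0))%E.
    have am0 : (0 <= a m)%E by exact: nrm_ge0.
    apply: cvgeD.
    - by rewrite mule0 fin_num_adde_defr.
    - exact: cvgeZl.
    - apply: cvgeZl => //; apply: cvgeD => //; last exact: cvg_cst.
      by rewrite fin_num_adde_defl.
  rewrite mule0 add0e adde0 in lim.
  by apply: (cvge_to_ge lim); apply: nearW.
(* Along t = 1/(K + 1) <= 1 the exponential is at most e^{dn}, and the increments divided by t tend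
   to the Euler derivative. *)
have e_le m : (nrm n (e m) <= (expR (d * n)%:R)%:E * a m)%E.
  have hc : (fun K => K.+1%:R^-1 : R) @ \oo --> 0 by exact: cvg_harmonic.
  have h_gt0 K : 0 < K.+1%:R^-1 :> R by [].
  apply: (cvge_to_le (@nrm_flow_cvg (h m) n _ (rh m) h_gt0 hc)); apply: nearW => K.
  rewrite invrK; have := flow_le m _ (h_gt0 K) => fl.
  apply: (@le_trans _ _ (K.+1%:R%:E * ((expR (K.+1%:R^-1 * (d * n)%:R) * K.+1%:R^-1)%:E * a m))%E).
    by apply: lee_pmul => //; exact: nrm_ge0.
  rewrite muleA -EFinM; apply: lee_pmul => //.
    exact: nrm_ge0.
  rewrite lee_fin mulrCA divff// mulr1 ler_expR ler_piMl// invf_le1//.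
  by rewrite ler1n.
have eta_le m : (nrm n eta <= (expR (d * n)%:R + 1)%:E * a m)%E.
  rewrite (@nrm_eq n _ (fun w => e m w + (- (e m w - eta w)))); last by move=> w _; ring.
  have mel : measurable_fun setT (fun w => e m w - eta w) by exact: measurable_funB.
  have mNel : measurable_fun setT (fun w => - (e m w - eta w)) by exact: measurableT_comp.
  apply: (le_trans (nrmD _ (me m) mNel)).
  rewrite EFinD ge0_muleDl ?lee_fin ?expR_ge0// mul1e; apply: leeD => //.
  by rewrite nrmN.
apply/eqP; rewrite eq_le nrm_ge0 andbT.
have lim : ((expR (d * n)%:R + 1)%:E * a l @[l --> \oo] --> (expR (d * n)%:R + 1)%:E * 0)%E.
  exact: cvgeZl.
rewrite mule0 in lim; by apply: (cvge_to_ge lim); apply: nearW.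
Qed.

End closability.

Lemma DomD_regular (R : realType) (d : nat) (f : @forms R d) :
  in_DomD f -> regular_forms f.
Proof.
move=> [[[_ sf] [C C0 hC]] _].
have sup_ge n (g : 'M[R]_(n, d) -> R) M : unit_ballX n M -> (`|g M|%:E <= sup_norm (unit_ballX n) g)%E.
  by move=> WM; apply: ereal_sup_ubound; exists M.
have W0 n : unit_ballX n (0 : 'M[R]_(n, d)).
  by move=> i; rewrite row0 /unit_ball/= /enorm /dotp big1 ?sqrtr0// => j _; rewrite mxE mul0r.
have sup_ge0 n (g : 'M[R]_(n, d) -> R) : (0 <= sup_norm (unit_ballX n) g)%E.
  by apply: le_trans (sup_ge n g _ (W0 n)); rewrite lee_fin.
split => //.
(* [in_S'] says nothing for n = 0, but ['M_(0, d)] has a single element, so the form is constant. *)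
- move=> [|n]; last by have [] := hC n.+1 isT.
  exists setT; split => //; first exact: openT.
  move=> M _; split; last by move=> [].
  rewrite (_ : f 0%N = cst (f 0%N 0)); first exact: differentiable_cst.
  by apply/funext => N; rewrite (flatmx0 N).
- move=> [|n].
    by exists `|f 0%N 0| => M _; rewrite (flatmx0 M); split => // -[].
  have [_ hn] := hC n.+1 isT; exists (C ^+ n.+1) => M WM.
  have hs : (forall i, 0 <= sup_norm (unit_ballX n.+1) (fun M => enorm (grad (f n.+1) i M)))%E.
    by move=> i; exact: sup_ge0.
  split.
    rewrite -lee_fin; apply: le_trans hn; apply: le_trans (sup_ge _ _ _ WM) _.
    by rewrite leeDl// sume_ge0.
  move=> i j; rewrite -lee_fin; apply: le_trans hn.
  rewrite (bigD1 i)//=; apply: (@le_trans _ _ (sup_norm (unit_ballX n.+1) (fun M => enorm (grad (f n.+1) i M)))).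
    apply: le_trans (sup_ge _ _ _ WM); rewrite lee_fin [X in _ <= X]ger0_norm ?enorm_ge0//.
    by have := entry_le_enorm (grad (f n.+1) i M) j; rewrite mxE.
  rewrite addeCA leeDl// adde_ge0//.
  exact: sume_ge0.
Qed.

Lemma Rintegral_sumr d' (T : measurableType d') (R : realType)
    (mu : {measure set T -> \bar R}) (D : set T) (I : Type) (r : seq I)
    (f : I -> T -> R) : measurable D ->
  (forall i, mu.-integrable D (EFin \o f i)) ->
  mu.-integrable D (EFin \o (fun x => \sum_(i <- r) f i x)) /\
  \int[mu]_(x in D) (\sum_(i <- r) f i x) = \sum_(i <- r) \int[mu]_(x in D) f i x.
Proof.
move=> mD fi.
elim: r => [|i r [IHi IH]].
  split.
    by under eq_fun do rewrite /= big_nil; exact: integrable0.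
  under eq_Rintegral do rewrite big_nil.
  by rewrite big_nil Rintegral_cst// mul0r.
split.
  rewrite (_ : EFin \o _ = ((EFin \o f i) \+ (EFin \o (fun x => (\sum_(i <- r) f i x)%R)))%E).
    exact: integrableD.
  by apply/funext => x /=; rewrite big_cons EFinD.
under eq_Rintegral do rewrite big_cons.
by rewrite RintegralD// IH big_cons.
Qed.

(** * Fields spanned by the orthonormal family *)

Section orthonormal.
Context {R : realType} {d : nat}.
Variable V : 'I_d -> 'rV[R]_d -> R.
Hypothesis oV : orthonormal_bounded V.
Local Notation W := (@unit_ball R d).
Local Notation leb := (lebesgue_mx 1 d).

Lemma integrable_VV l m : leb.-integrable W (EFin \o (fun x => V l x * V m x)).
Proof.
have [mV bV _] := oV; have [Cl hl] := bV l; have [Cm hm] := bV m.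
apply: measurable_bounded_integrable.
- exact: measurable_unit_ball.
- exact: lebesgue_eball_lty.
- exact: measurable_funM.
- exists (Cl * Cm); split; first exact: num_real.
  move=> M CM x Wx /=; rewrite (le_trans _ (ltW CM))// normrM.
  by rewrite ler_pM ?hl ?hm.
Qed.

(** Orthonormality turns the integral of a quadratic expression in V into the trace of its
    matrix. *)
Lemma integral_VV (A : 'I_d -> 'I_d -> R) :
  leb.-integrable W (EFin \o (fun x => \sum_l \sum_m A l m * (V l x * V m x))) /\
  \int[leb]_(x in W) (\sum_l \sum_m A l m * (V l x * V m x)) = \sum_m A m m.
Proof.
have mW := @measurable_unit_ball R d.
have [_ _ dV] := oV.
have iA l m : leb.-integrable W (EFin \o (fun x => A l m * (V l x * V m x))).
  rewrite (_ : EFin \o _ = (fun x => (A l m)%:E * (EFin \o (fun x => V l x * V m x)%R) x)%E).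
    by apply: integrableZl => //; exact: integrable_VV.
  by apply/funext => x /=; rewrite EFinM.
have iB l := Rintegral_sumr (index_enum 'I_d) mW (iA l).
have [i1 ->] := Rintegral_sumr (index_enum 'I_d) mW (fun l => (iB l).1).
split => //; apply: eq_bigr => l _; rewrite (iB l).2 (bigD1 l)//= big1 ?addr0.
  rewrite RintegralZl//; last exact: integrable_VV.
  by rewrite dV eqxx mulr1.
move=> m ml; rewrite RintegralZl//; last exact: integrable_VV.
by rewrite dV eq_sym (negbTE ml) mulr0.
Qed.

(** The field D F has this shape, with coefficients independent of x. By [integral_Hfield] its norm
    in x is a Frobenius norm, so convergence of D F reduces to that of d^2 real variables. *)
Definition Hfield (Omega : Type) (c : Omega -> 'I_d -> 'I_d -> R) (w : Omega)
  (x : 'rV[R]_d) : 'rV[R]_d := - \row_j \sum_m Vvec V x 0 m * c w m j.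

Lemma Vvec_mul x l m : (0 < d)%N ->
  Vvec V x 0 l * Vvec V x 0 m = d%:R^-1 * (V l x * V m x).
Proof.
move=> d0; rewrite /Vvec !mxE mulrACA -invfM -expr2 sqr_sqrtr ?ler0n//.
Qed.

Lemma integral_Hfield (Omega : Type) (c : Omega -> 'I_d -> 'I_d -> R) (w : Omega) :
  (0 < d)%N ->
  (\int[leb]_(x in W) ((enorm (Hfield c w x)) ^+ 2)%:E =
   (d%:R^-1 * \sum_m \sum_j c w m j ^+ 2)%:E)%E.
Proof.
move=> d0; pose A l m := d%:R^-1 * \sum_j c w l j * c w m j.
have [iA eA] := integral_VV A.
transitivity (\int[leb]_(x in W) (\sum_l \sum_m A l m * (V l x * V m x))%:E)%E.
  apply: eq_integral => x _; congr EFin; rewrite sqr_enorm /dotp /Hfield.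
  under eq_bigr => j _ do rewrite !mxE mulrNN big_distrlr/=.
  rewrite exchange_big/=; apply: eq_bigr => l _.
  rewrite exchange_big/=; apply: eq_bigr => m _.
  rewrite /A -mulrA mulr_suml mulr_sumr; apply: eq_bigr => j _.
  by rewrite mulrACA Vvec_mul//; ring.
rewrite -[LHS]fineK; last by apply: integrable_fin_num => //; exact: measurable_unit_ball.
congr EFin; rewrite -[LHS]/(\int[leb]_(x in W) (\sum_l \sum_m A l m * (V l x * V m x))) eA.
by rewrite mulr_sumr; apply: eq_bigr => m _; congr (_ * _).
Qed.

Definition coeff (f : @forms R d) (m j : 'I_d) : forms :=
  fun n M => \sum_i M i m * 'D_(delta_mx i j) (f n) M.

Context {disp : measure_display} {Omega : measurableType disp} (X : Omega -> set 'rV[R]_d).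

Lemma DopE (f : forms) w x :
  Dop X V f w x = Hfield (fun w m j => functional X (coeff f m j) w) w x.
Proof.
rewrite /Dop /Hfield; congr (- _); apply/rowP => j; rewrite summxE !mxE.
under eq_bigr do rewrite !mxE mulr_suml.
rewrite exchange_big/=; apply: eq_bigr => m _.
rewrite /functional /coeff mulr_sumr; apply: eq_bigr => i _.
by rewrite !mxE; ring.
Qed.

(** Integration against V keeps only the trace of the coefficients, and the trace of [coeff] is the
    Euler derivative; the choice of V disappears. *)
Lemma nablaE (f : forms) w : (0 < d)%N ->
  nabla X V f w = - d%:R^-1 * functional X (euler f) w.
Proof.
move=> d0; pose c m j := functional X (coeff f m j) w.
have [_ eA] := integral_VV (fun l m => - d%:R^-1 * c l m).
rewrite /nabla; transitivity (\sum_m - d%:R^-1 * c m m).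
  rewrite -eA; apply: eq_Rintegral => x _; rewrite DopE /dotp.
  rewrite [RHS]exchange_big/=; apply: eq_bigr => m _.
  rewrite !mxE mulNr mulr_suml -sumrN; apply: eq_bigr => l _.
  have vlm := Vvec_mul x l m d0; rewrite !mxE in vlm.
  by rewrite -/(c l m) !mxE mulrAC vlm; ring.
rewrite -mulr_sumr; congr (_ * _); rewrite /c /functional /euler /coeff exchange_big/=.
by [].
Qed.

End orthonormal.
Arguments coeff {R d} f m j n M.

Lemma cvge0_near (R : realType) (u : nat -> \bar R) : (forall l, 0 <= u l)%E ->
  (u @ \oo --> 0)%E <->
  forall eps : R, 0 < eps -> \forall l \near \oo, (u l <= eps%:E)%E.
Proof.
move=> u0; split.
  move=> /fine_cvgP[ufin /cvgrPdist_le uc] eps e0.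
  near=> l; rewrite -[u l]fineK; last by near: l.
  rewrite lee_fin; have : `|0 - fine (u l)| <= eps by near: l; exact: uc.
  by rewrite sub0r normrN; apply: le_trans; exact: ler_norm.
move=> h; apply/fine_cvgP.
have ufin eps l : (u l <= eps%:E)%E -> u l \is a fin_num.
  by move=> ule; rewrite ge0_fin_numE// (le_lt_trans ule)// ltry.
split; first by apply: filterS (h 1 ltr01) => l; exact: ufin.
apply/cvgrPdist_le => eps e0; apply: filterS (h eps e0) => l ule.
by rewrite sub0r normrN ger0_norm ?fine_ge0// -lee_fin fineK// (ufin eps).
Unshelve. all: by end_near. Qed.

(** * Uniqueness of the gradient on the closure *)

Section uniqueness.
Context {R : realType} {d : nat}.
Context {disp : measure_display} {Omega : measurableType disp}.
Variables (P : probability Omega R) (X : Omega -> set 'rV[R]_d) (theta : R).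
Hypotheses (theta_gt0 : 0 < theta) (PX : poisson_process P X theta).
Local Notation W := (@unit_ball R d).

(** Pointwise |y| <= eps + y^2 / eps: a substitute for the Cauchy-Schwarz inequality, valid whether
    or not [Y] is integrable. *)
Lemma nrm_le_sqr n (Y : Omega -> R) (eps : R) : measurable_fun setT Y -> 0 < eps ->
  (nrm P X n Y <= eps%:E + eps^-1%:E * 'E_P[fun w => (Y w ^+ 2)%R])%E.
Proof.
move=> mY e0; rewrite unlock.
have mY2 : measurable_fun setT (fun w => (Y w ^+ 2)%:E).
  by apply/measurable_EFinP; exact: measurable_funX.
have -> : (eps%:E + eps^-1%:E * \int[P]_w (Y w ^+ 2)%:E =
    \int[P]_w (eps%:E + eps^-1%:E * (Y w ^+ 2)%:E))%E.
  rewrite ge0_integralD//.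
  - rewrite integral_cst//= probability_setT mule1 ge0_integralZl//.
    + by move=> w _; rewrite lee_fin sqr_ge0.
    + by rewrite lee_fin invr_ge0 ltW.
  - by move=> w _; rewrite lee_fin ltW.
  - by move=> w _; rewrite mule_ge0// lee_fin ?sqr_ge0// invr_ge0 ltW.
  - by apply: measurable_funeM.
apply: (@le_trans _ _ (\int[P]_w `|Y w|%:E)%E).
  apply: ge0_subset_integral => //; first exact: (measurable_event PX).
  by apply/measurable_EFinP; exact: measurableT_comp.
apply: ge0_le_integral => //.
- by apply/measurable_EFinP; exact: measurableT_comp.
- by apply: emeasurable_funD => //; exact: measurable_funeM.
- move=> w _; rewrite -EFinM -EFinD lee_fin -(ler_pM2l e0) mulrDr mulrA.
  rewrite divff ?gt_eqF// mul1r -[Y w ^+ 2]real_normK ?num_real//.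
  have := normr_ge0 (Y w); set y := `|Y w|; nra.
Qed.

Lemma cvg_L2_nrm n (Y_ : nat -> Omega -> R) (Y : Omega -> R) :
  (forall l, measurable_fun setT (Y_ l)) -> measurable_fun setT Y ->
  cvg_L2 P Y_ Y ->
  (nrm P X n (fun w => Y_ l w - Y w)%R @[l --> \oo] --> 0)%E.
Proof.
move=> mY_ mY YY.
have E0 l : (0 <= 'E_P[fun w => ((Y_ l w - Y w) ^+ 2)%R])%E.
  by apply: expectation_ge0 => w; exact: sqr_ge0.
apply/cvge0_near => [l|eps e0]; first exact: nrm_ge0.
have e2 : 0 < eps / 2 by rewrite divr_gt0.
(* With parameter eps/2 and second moment at most (eps/2)^2, both terms of [nrm_le_sqr] are at most
   eps/2. *)
have e22 : 0 < (eps / 2) ^+ 2 by rewrite exprn_gt0.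
move/(cvge0_near E0)/(_ _ e22) : YY; apply: filterS => l El.
have mYl : measurable_fun setT (fun w => Y_ l w - Y w) by exact: measurable_funB.
apply: (le_trans (nrm_le_sqr n mYl e2)).
rewrite [leRHS](_ : _ = (eps / 2)%:E + (eps / 2)%:E)%E; last by rewrite -EFinD -splitr.
apply: leeD => //.
apply: (@le_trans _ _ ((eps / 2)^-1%:E * ((eps / 2) ^+ 2)%:E)%E).
  by apply: lee_pmul => //; rewrite lee_fin invr_ge0 ltW.
by rewrite -EFinM lee_fin expr2 mulKf ?gt_eqF.
Qed.

Lemma nrm0_ae (eta : Omega -> R) : measurable_fun setT eta ->
  (forall n, nrm P X n eta = 0%E) -> {ae P, forall w, eta w = 0}.
Proof.
move=> meta h.
have hn n : {ae P, forall w, event X n w -> eta w = 0}.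
  have mN := measurable_event PX n.
  have : (\int[P]_(w in event X n) `|(eta w)%:E| = 0)%E.
    by rewrite -[RHS](h n); apply: eq_integral.
  move/(ae_eq_integral_abs P mN _).1 => H.
  have {}H := H (measurable_funTS _).
  have := H (proj2 (measurable_EFinP _ _) meta).
  by apply: filterS => w /= hw nw; have [] := hw nw.
have /ae_foralln := hn; apply: filterS => w hw.
exact: (hw (count X W w)).
Qed.

Variable V : 'I_d -> 'rV[R]_d -> R.
Hypotheses (d_gt0 : (0 < d)%N) (oV : orthonormal_bounded V).

Lemma measurable_nabla (f : @forms R d) : regular_forms f ->
  measurable_fun setT (nabla X V f).
Proof.
move=> [sf C1 bf]; rewrite (_ : nabla X V f = fun w => - d%:R^-1 * functional X (euler f) w).
  apply: measurable_funM => //; apply: (measurable_functional PX).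
    exact: symmetric_euler.
  exact: continuous_euler.
by apply/funext => w; rewrite nablaE.
Qed.

(** Closability applied to f_l - g_l: these tend to 0, and their Euler derivatives tend to -d (G -
    G'). *)
Lemma nabla_unique (f g : nat -> @forms R d) (F G G' : Omega -> R) :
  (forall l, in_DomD (f l)) -> (forall l, in_DomD (g l)) ->
  measurable_fun setT F -> measurable_fun setT G -> measurable_fun setT G' ->
  cvg_L2 P (fun l => functional X (f l)) F ->
  cvg_L2 P (fun l => functional X (g l)) F ->
  cvg_L2 P (fun l => nabla X V (f l)) G -> cvg_L2 P (fun l => nabla X V (g l)) G' ->
  {ae P, forall w, G w = G' w}.
Proof.
move=> Df Dg mF mG mG' fF gF fG gG'.
have rf l := DomD_regular (Df l); have rg l := DomD_regular (Dg l).
have mfun h : regular_forms h -> measurable_fun setT (functional X h).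
  by move=> [sh C1 bh]; apply: (measurable_functional PX) => //; exact: C1_continuous.
have dn0 : d%:R != 0 :> R by rewrite pnatr_eq0 -lt0n.
pose eta w := - d%:R * (G w - G' w).
have meta : measurable_fun setT eta by apply: measurable_funM => //; exact: measurable_funB.
suff : {ae P, forall w, eta w = 0}.
  apply: filterS => w /eqP; rewrite mulf_eq0 oppr_eq0 (negbTE dn0)/= subr_eq0.
  by move/eqP.
apply: nrm0_ae => // n; apply: (euler_closable PX (h := fun l => subf (f l) (g l))) => //.
- by move=> l; exact: regular_subf.
- have c1 := cvg_L2_nrm n (fun l => mfun _ (rf l)) mF fF.
  have c2 := cvg_L2_nrm n (fun l => mfun _ (rg l)) mF gF.
  have c12 := cvgeD (isT : (0 +? 0)%E) c1 c2.
  rewrite adde0 in c12.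
  apply: (squeeze_cvge _ (cvg_cst _) (c12 _)).
  apply: nearW => l; rewrite nrm_ge0/=.
  have m1 : measurable_fun setT (fun w => functional X (f l) w - F w).
    by apply: measurable_funB => //; exact: mfun.
  have m2 : measurable_fun setT (fun w => functional X (g l) w - F w).
    by apply: measurable_funB => //; exact: mfun.
  have m2' : measurable_fun setT (fun w => - (functional X (g l) w - F w)) by exact: measurableT_comp.
  rewrite -[X in (_ <= _ + X)%E]nrmN; apply: le_trans (nrmD PX n m1 m2').
  rewrite le_eqVlt; apply/orP; left; apply/eqP; apply: nrm_eq => w _.
  by rewrite /functional /subf; ring.
- have mnf l : measurable_fun setT (nabla X V (f l)) by exact: measurable_nabla.
  have mng l : measurable_fun setT (nabla X V (g l)) by exact: measurable_nabla.
  have c1 := cvg_L2_nrm n mnf mG fG; have c2 := cvg_L2_nrm n mng mG' gG'.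
  have dfin : d%:R%:E \is a @fin_num R by [].
  have c12 := cvgeZl dfin (cvgeD (isT : (0 +? 0)%E) c1 c2).
  rewrite adde0 mule0 in c12.
  apply: (squeeze_cvge _ (cvg_cst _) (c12 _)).
  apply: nearW => l; rewrite nrm_ge0/=.
  have m1 : measurable_fun setT (fun w => nabla X V (f l) w - G w) by exact: measurable_funB.
  have m2 : measurable_fun setT (fun w => nabla X V (g l) w - G' w) by exact: measurable_funB.
  have m2' : measurable_fun setT (fun w => - (nabla X V (g l) w - G' w)) by exact: measurableT_comp.
  rewrite -[X in (_ <= _ * (_ + X))%E]nrmN.
  apply: le_trans (lee_pmul _ _ (lexx _) (nrmD PX n m1 m2')) => //; last exact: nrm_ge0.
  have m12 : measurable_fun setT (fun w => nabla X V (f l) w - G w + - (nabla X V (g l) w - G' w)).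
    exact: measurable_funD.
  rewrite -(nrmZ PX n m12)// -nrmN.
  rewrite le_eqVlt; apply/orP; left; apply/eqP; apply: nrm_eq => w nw.
  have [M WM fM] := functional_event PX nw.
  rewrite !nablaE// !fM euler_subf//; [|by have [] := rf l|by have [] := rg l].
  by rewrite /eta; field.
Qed.

End uniqueness.

(** * Smooth approximations of order statistics *)

Section smoothstep.
Context {R : realType}.
Implicit Types u v h : R.

Definition ramp2 u : R := Num.max 0 u ^+ 2.

(* C^1, piecewise quadratic, 0 for [u <= 0] and 1 for [1 <= u]. *)
Definition sstep u : R := 2 * ramp2 u - 4 * ramp2 (u - 2^-1) + 2 * ramp2 (u - 1).

(** A tent supported by [0, 1], of height 2 at 1/2. *)
Definition dsstep u : R :=
  4 * Num.max 0 u - 8 * Num.max 0 (u - 2^-1) + 4 * Num.max 0 (u - 1).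

Lemma ramp2_err u h : `|ramp2 (u + h) - ramp2 u - 2 * Num.max 0 u * h| <= h ^+ 2.
Proof.
rewrite /ramp2 /Num.max ler_norml; case: ltP => h1; case: ltP => h2; apply/andP; split; nra.
Qed.

(** Quadratic remainders serve twice: they give the derivative and, summed over a mesh, the error of
    Riemann sums. The constant is 2 + 4 + 2. *)
Lemma sstep_err u h : `|sstep (u + h) - sstep u - dsstep u * h| <= 8 * h ^+ 2.
Proof.
have := ramp2_err u h; have := ramp2_err (u - 2^-1) h; have := ramp2_err (u - 1) h.
rewrite /sstep /dsstep (addrAC u h (- 2^-1)) (addrAC u h (- 1)).
rewrite !ler_norml => /andP[a1 a2] /andP[b1 b2] /andP[c1 c2]; apply/andP; split; nra.
Qed.

Lemma sstep_le0 u : u <= 0 -> sstep u = 0.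
Proof.
move=> u0; rewrite /sstep /ramp2.
have -> : Num.max 0 u = 0 by apply/max_idPl.
have -> : Num.max 0 (u - 2^-1) = 0 by apply/max_idPl; lra.
have -> : Num.max 0 (u - 1) = 0 by apply/max_idPl; lra.
ring.
Qed.

Lemma sstep_ge1 u : 1 <= u -> sstep u = 1.
Proof.
move=> u0; rewrite /sstep /ramp2.
have -> : Num.max 0 u = u by apply/max_idPr; lra.
have -> : Num.max 0 (u - 2^-1) = u - 2^-1 by apply/max_idPr; lra.
have -> : Num.max 0 (u - 1) = u - 1 by apply/max_idPr; lra.
by field.
Qed.

Lemma dsstep_le0 u : u <= 0 -> dsstep u = 0.
Proof.
move=> u0; rewrite /dsstep.
have -> : Num.max 0 u = 0 by apply/max_idPl.
have -> : Num.max 0 (u - 2^-1) = 0 by apply/max_idPl; lra.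
have -> : Num.max 0 (u - 1) = 0 by apply/max_idPl; lra.
ring.
Qed.

Lemma dsstep_ge1 u : 1 <= u -> dsstep u = 0.
Proof.
move=> u0; rewrite /dsstep.
have -> : Num.max 0 u = u by apply/max_idPr; lra.
have -> : Num.max 0 (u - 2^-1) = u - 2^-1 by apply/max_idPr; lra.
have -> : Num.max 0 (u - 1) = u - 1 by apply/max_idPr; lra.
by field.
Qed.

Lemma dsstep_itv u : 0 <= dsstep u <= 2.
Proof.
rewrite /dsstep /Num.max.
by case: ltP => h1; case: ltP => h2; case: ltP => h3; apply/andP; split; lra.
Qed.

Lemma is_derive_err (g : R -> R) u (D C : R) :
  (forall h, `|g (u + h) - g u - D * h| <= C * h ^+ 2) -> is_derive u 1 g D.
Proof.
move=> err.
have C0 : 0 <= C by have := le_trans (normr_ge0 _) (err 1); rewrite expr1n mulr1.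
suff c : h^-1 *: (g (h *: 1 + u) - g u) @[h --> 0^'] --> D.
  by apply: DeriveDef; [apply/cvg_ex; exists D|exact/cvg_lim].
apply/cvgrPdist_le => e e0.
have ec : 0 < e / (C + 1) by rewrite divr_gt0// ltr_wpDl.
near=> h.
have h0 : h != 0 by near: h; exact: nbhs_dnbhs_neq.
have hle : `|h| <= e / (C + 1) by near: h; exact: dnbhs0_le.
have h0' : 0 < `|h| by rewrite normr_gt0.
have -> : D - h^-1 *: (g (h *: 1 + u) - g u) = - (g (u + h) - g u - D * h) / h.
  by rewrite /GRing.scale/= mulr1 (addrC h); field.
rewrite normrM normrN normfV ler_pdivrMr//; apply: le_trans (err h) _.
rewrite -[h ^+ 2]real_normK ?num_real// expr2 mulrA ler_wpM2r ?(ltW h0')//.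
have : (C + 1) * `|h| <= e by rewrite mulrC -ler_pdivlMr// ltr_wpDl.
by apply: le_trans; rewrite ler_wpM2r ?(ltW h0')// lerDl.
Unshelve. all: by end_near. Qed.

Lemma is_derive_sstep u : is_derive u 1 sstep (dsstep u).
Proof. exact: is_derive_err (sstep_err u). Qed.

Lemma continuous_max0 (c : R) : continuous (fun u => Num.max 0 (u - c)).
Proof.
move=> u; apply/cvgrPdist_le => e e0; near=> v.
have : `|u - v| < e by near: v; exact: (nbhsx_ballx u e e0).
rewrite ltr_norml => /andP[? ?]; rewrite /Num.max ler_norml.
by case: ltP => h1; case: ltP => h2; apply/andP; split; lra.
Unshelve. all: by end_near. Qed.

Lemma continuous_dsstep : continuous dsstep.
Proof.
have c0 : continuous (fun u : R => Num.max 0 u).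
  have := @continuous_max0 0; rewrite (_ : (fun u => _) = (fun u => Num.max 0 u))//.
  by apply/funext => u; rewrite subr0.
move=> u; rewrite /dsstep; apply: cvgD; first apply: cvgB.
- by apply: cvgM; [exact: cvg_cst|exact: c0].
- by apply: cvgM; [exact: cvg_cst|exact: continuous_max0].
- by apply: cvgM; [exact: cvg_cst|exact: continuous_max0].
Qed.

Lemma continuous_sstep : continuous sstep.
Proof.
move=> u; apply: differentiable_continuous; apply/derivable1_diffP.
by have [] := is_derive_sstep u.
Qed.

Lemma sstep_mvt u v : u <= v -> 0 <= sstep v - sstep u <= 2 * (v - u).
Proof.
rewrite le_eqVlt => /predU1P[->|uv]; first by rewrite !subrr mulr0 lexx.
have [||c _ ->] := @MVT R sstep dsstep u v uv.
- by move=> x _; exact: is_derive_sstep.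
- by apply: continuous_subspaceT; exact: continuous_sstep.
have /andP[h1 h2] := dsstep_itv c; apply/andP; split; nra.
Qed.

Lemma sstep_homo : {homo sstep : u v / u <= v}.
Proof. by move=> u v /sstep_mvt/andP[]; rewrite subr_ge0. Qed.

Lemma sstep_itv u : 0 <= sstep u <= 1.
Proof.
apply/andP; split.
  have [u0|/ltW u0] := leP u 0; first by rewrite sstep_le0.
  by rewrite -(sstep_le0 (lexx 0)) sstep_homo.
have [u1|/ltW u1] := leP 1 u; first by rewrite sstep_ge1.
by rewrite -(sstep_ge1 (lexx 1)) sstep_homo.
Qed.

(** Near a squared norm shared by b points, the outer step of the approximating form is this
    function, [a] being the number of closer points minus k - 1. *)
Definition sstep2 (a b u : R) : R := sstep (a + b * sstep u).
Definition dsstep2 (a b u : R) : R := dsstep (a + b * sstep u) * (b * dsstep u).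

(** As the slope of the step is at most 2, |D| <= 2 |h|; the outer remainder is then at most 8 (2 b
    h)^2 = 32 b^2 h^2. The inner one, 8 h^2, is multiplied by b and by an outer slope at most 2. *)
Lemma sstep2_err (a b u h : R) : 0 <= b ->
  `|sstep2 a b (u + h) - sstep2 a b u - dsstep2 a b u * h| <=
  (32 * b ^+ 2 + 16 * b) * h ^+ 2.
Proof.
move=> b0; rewrite /sstep2 /dsstep2; set D := sstep (u + h) - sstep u.
have -> : sstep (u + h) = sstep u + D by rewrite /D; ring.
have e1 := sstep_err (a + b * sstep u) (b * D); have e2 := sstep_err u h.
rewrite -/D in e2; rewrite mulrDr addrA.
have D2 : D ^+ 2 <= 4 * h ^+ 2.
  have [h0|/ltW h0] := leP 0 h.
    have := @sstep_mvt u (u + h); rewrite lerDl h0 -/D => /(_ isT)/andP[]; nra.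
  have := @sstep_mvt (u + h) u; rewrite gerDl h0 -opprB -/D => /(_ isT)/andP[]; nra.
have /andP[d1 d2] := dsstep_itv (a + b * sstep u).
have bD2 : (b * D) ^+ 2 <= 4 * (b ^+ 2 * h ^+ 2).
  by have := ler_wpM2l (sqr_ge0 b) D2; rewrite exprMn; lra.
set S := dsstep (a + b * sstep u) in e1 d1 d2 *.
set s := dsstep u in e2 *.
have -> : sstep (a + b * sstep u + b * D) - sstep (a + b * sstep u) - S * (b * s) * h =
    (sstep (a + b * sstep u + b * D) - sstep (a + b * sstep u) - S * (b * D)) +
    S * b * (D - s * h) by ring.
rewrite (le_trans (ler_normD _ _))// [leRHS]mulrDl lerD//; first by apply: (le_trans e1); lra.
rewrite normrM (ger0_norm (_ : 0 <= S * b)) ?mulr_ge0//.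
have -> : 16 * b * h ^+ 2 = 2 * b * (8 * h ^+ 2) by ring.
by apply: ler_pM; rewrite ?mulr_ge0// ler_wpM2r.
Qed.

End smoothstep.

(** * Abel summation and Riemann sums of the steps *)

Section sums.
Context {R : realType}.

(* Abel summation writes the left-hand side as an average of the values of [psi] at
   the points where [p] increases, all close to [y]. *)
Lemma abel_close (N : nat) (psi : R -> R) (p : nat -> R) (y dl e : R) :
  (0 < N)%N -> 0 <= y <= 1 -> 0 <= dl ->
  (forall q, 0 <= p q <= 1) -> (forall q, p q <= p q.+1) ->
  (forall q, (q <= N)%N -> q%:R / N%:R < y -> p q = 0) ->
  (forall q, (q <= N)%N -> y + dl <= q%:R / N%:R -> p q = 1) ->
  (forall t : R, 0 <= t <= 1 -> `|t - y| <= dl + N%:R^-1 -> `|psi t - psi y| <= e) ->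
  `|psi 1 - \sum_(q < N) (psi (q.+1%:R / N%:R) - psi (q%:R / N%:R)) * p q.+1
    - psi y| <= e.
Proof.
move=> N0 /andP[y0 y1] dl0 p01 pm pl pr psic.
have NR : 0 < N%:R :> R by rewrite ltr0n.
have e0 : 0 <= e.
  by have := psic y; rewrite y0 y1 subrr normr0 addr_ge0 ?invr_ge0 ?ler0n// subrr normr0; apply.
pose t q : R := q%:R / N%:R.
have abel n : \sum_(q < n) (psi (t q.+1) - psi (t q)) * p q.+1 =
    psi (t n) * p n - psi (t 0%N) * p 0%N - \sum_(q < n) psi (t q) * (p q.+1 - p q).
  elim: n => [|n IH]; first by rewrite !big_ord0; ring.
  by rewrite !big_ord_recr/= IH; ring.
rewrite -[X in _ - X - _]/(\sum_(q < N) (psi (t q.+1) - psi (t q)) * p q.+1) abel.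
have tN : t N = 1 by rewrite /t divff// gt_eqF.
have tele : p N = p 0%N + \sum_(q < N) (p q.+1 - p q).
  have : forall n, p n = p 0%N + \sum_(q < n) (p q.+1 - p q).
    by elim=> [|n IH]; [rewrite big_ord0 addr0|rewrite big_ord_recr/= addrA -IH; ring].
  exact.
have t01 q : (q <= N)%N -> 0 <= t q <= 1.
  by move=> qN; rewrite /t divr_ge0 ?ler0n//= ler_pdivrMr// mul1r ler_nat.
(* The weights 1 - p N, p 0 and the increments of [p] are nonnegative with sum 1. In each of the
   three groups, a value of [psi] taken far from [y] has weight 0. *)
rewrite (_ : _ - _ = (psi 1 - psi y) * (1 - p N) + (psi (t 0%N) - psi y) * p 0%N +
    \sum_(q < N) (psi (t q) - psi y) * (p q.+1 - p q)); last first.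
  rewrite tN; under [in RHS]eq_bigr do rewrite mulrBl.
  by rewrite sumrB -mulr_sumr tele; ring.
have b1 : `|(psi 1 - psi y) * (1 - p N)| <= e * (1 - p N).
  have /andP[p0 p1] := p01 N; rewrite normrM (ger0_norm (_ : 0 <= 1 - p N)) ?subr_ge0//.
  have [yd|yd] := leP (y + dl) 1.
    by rewrite (pr N)// ?subrr ?mulr0// -/(t N) tN.
  rewrite ler_wpM2r ?subr_ge0//; apply: psic; first by rewrite ler01 lexx.
  have : 0 <= N%:R^-1 :> R by rewrite invr_ge0 ltW.
  by rewrite ger0_norm ?subr_ge0//; lra.
have b2 : `|(psi (t 0%N) - psi y) * p 0%N| <= e * p 0%N.
  have /andP[p0 p1] := p01 0%N; rewrite normrM (ger0_norm p0).
  have [yd|yd] := ltP 0 y; first by rewrite pl// ?mulr0// mul0r.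
  rewrite ler_wpM2r//; apply: psic; first exact: t01.
  have -> : y = 0 by apply/le_anti; rewrite y0 yd.
  by rewrite /t mul0r subrr normr0 addr_ge0// invr_ge0 ltW.
have b3 : `|\sum_(q < N) (psi (t q) - psi y) * (p q.+1 - p q)| <=
    \sum_(q < N) e * (p q.+1 - p q).
  rewrite (le_trans (ler_norm_sum _ _ _))// ler_sum// => -[q qN] _ /=.
  have pq : 0 <= p q.+1 - p q by rewrite subr_ge0.
  rewrite normrM (ger0_norm pq).
  have [yq|yq] := ltP (t q.+1) y.
    have tq : t q < y by apply: le_lt_trans yq; rewrite /t ler_pM2r ?invr_gt0// ler_nat.
    by rewrite (pl q.+1)// (pl q (ltnW qN))// subrr !mulr0.
  have [yd|yd] := leP (y + dl) (t q).
    have tq : y + dl <= t q.+1 by apply: le_trans yd _; rewrite /t ler_pM2r ?invr_gt0// ler_nat.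
    by rewrite (pr q.+1)// (pr q (ltnW qN))// subrr !mulr0.
  rewrite ler_wpM2r//; apply: psic; first by apply: t01; exact: ltnW.
  have : t q.+1 = t q + N%:R^-1 by rewrite /t -natr1 mulrDl mul1r.
  have : 0 <= N%:R^-1 :> R by rewrite invr_ge0 ltW.
  by rewrite ler_norml; lra.
rewrite -mulr_sumr in b3.
have -> : e = e * (1 - p N) + e * p 0%N + e * \sum_(q < N) (p q.+1 - p q).
  by rewrite {1}tele; ring.
by rewrite (le_trans (ler_normD _ _))// lerD// (le_trans (ler_normD _ _))// lerD.
Qed.

Lemma sumr_cst (N : nat) (c : R) : \sum_(q < N) c = c * N%:R.
Proof. by rewrite sumr_const card_ord mulr_natr. Qed.

(** In the variable u the mesh is (L+1)/(L+1)^3 = (L+1)^{-2}; the (L+1)^3 errors, each of order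
    (L+1)^{-4}, add up to order 1/(L+1). *)
Lemma riemann_sstep2 (L : nat) (a b s : R) (u : nat -> R) : 0 <= b ->
  (forall q, u q = L.+1%:R * (q%:R / (L.+1 ^ 3)%:R - s)) ->
  `|\sum_(q < L.+1 ^ 3) dsstep2 a b (u q.+1) / L.+1%:R ^+ 2 -
    (sstep2 a b (u (L.+1 ^ 3)%N) - sstep2 a b (u 0%N))| <=
  (32 * b ^+ 2 + 16 * b) / L.+1%:R.
Proof.
move=> b0 uE; set c := 32 * b ^+ 2 + 16 * b; have L0 : L.+1%:R != 0 :> R by rewrite pnatr_eq0.
pose h : R := (L.+1%:R ^+ 2)^-1.
have uS q : u q.+1 = u q + h.
  by rewrite !uE /h -(natr1 q) natrX; move: (q%:R : R) L0 => Q; set x : R := _%:R => L0; field.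
have tele : forall n, sstep2 a b (u n) - sstep2 a b (u 0%N) =
    \sum_(q < n) (sstep2 a b (u q.+1) - sstep2 a b (u q)).
  by elim=> [|n IH]; [rewrite big_ord0 subrr|rewrite big_ord_recr/= -IH; ring].
rewrite tele -sumrB (le_trans (ler_norm_sum _ _ _))//.
apply: (@le_trans _ _ (\sum_(q < L.+1 ^ 3) c * h ^+ 2)).
  apply: ler_sum => q _; have := sstep2_err a (u q.+1) (- h) b0.
  rewrite uS addrK sqrrN -/h; apply: le_trans; rewrite le_eqVlt; apply/orP; left.
  by apply/eqP; congr `|_|; ring.
rewrite sumr_cst /h natrX le_eqVlt; apply/orP; left; apply/eqP.
by move: L0; set x : R := _%:R => L0; field.
Qed.

(** 9 = 1 + 8: the total increase of [sstep] is at most 1, and the errors add up to 8/(L+1). *)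
Lemma riemann_sstep2_bound (L : nat) (s : R) :
  \sum_(q < L.+1 ^ 3) dsstep (L.+1%:R * (q.+1%:R / (L.+1 ^ 3)%:R - s)) / L.+1%:R ^+ 2
    <= 9.
Proof.
have L0 : L.+1%:R != 0 :> R by rewrite pnatr_eq0.
pose u q : R := L.+1%:R * (q%:R / (L.+1 ^ 3)%:R - s).
pose h : R := (L.+1%:R ^+ 2)^-1.
have uS q : u q.+1 = u q + h.
  by rewrite /u /h -(natr1 q) natrX; move: (q%:R : R) L0 => Q; set x : R := _%:R => L0; field.
have tele : forall n, sstep (u n) - sstep (u 0%N) =
    \sum_(q < n) (sstep (u q.+1) - sstep (u q)).
  by elim=> [|n IH]; [rewrite big_ord0 subrr|rewrite big_ord_recr/= -IH; ring].
apply: (@le_trans _ _ (\sum_(q < L.+1 ^ 3) ((sstep (u q.+1) - sstep (u q)) + 8 * h ^+ 2))).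
  apply: ler_sum => q _; have := sstep_err (u q.+1) (- h).
  by rewrite {1}uS addrK sqrrN ler_norml -/(u q.+1) -/h => /andP[]; lra.
rewrite big_split/= -tele sumr_cst /h natrX.
have -> : 8 * (L.+1%:R ^+ 2)^-1 ^+ 2 * L.+1%:R ^+ 3 = 8 / L.+1%:R :> R.
  by move: L0; set x : R := _%:R => L0; field.
have h3 : 8 / L.+1%:R <= 8 :> R by rewrite ler_pdivrMr// ler_peMr// ler1n.
have /andP[_ h1] := sstep_itv (u (L.+1 ^ 3)%N); have /andP[h2 _] := sstep_itv (u 0%N).
move: h1 h2 h3; set s1 := sstep _; set s2 := sstep _; set x := 8 / _; lra.
Qed.

End sums.

Section C1_functions.
Context {R : realType}.

Definition C1_01 (psi psi1 : R -> R) :=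
  [/\ {within `[0, 1], continuous psi}, {within `[0, 1], continuous psi1} &
    forall t : R, t \in `]0, 1[ -> is_derive t (1 : R) psi (psi1 t)].

Variables (psi psi1 : R -> R).
Hypothesis C1psi : C1_01 psi psi1.

Lemma C1_01_mvt (u v : R) : 0 <= u -> u < v -> v <= 1 ->
  exists2 c, u < c < v & psi v - psi u = psi1 c * (v - u).
Proof.
move=> u0 uv v1; have [cpsi _ dpsi] := C1psi.
have dp x : x \in `]u, v[ -> is_derive x (1 : R) psi (psi1 x).
  rewrite in_itv/= => /andP[ux xv]; apply: dpsi.
  by rewrite in_itv/= (le_lt_trans u0 ux) (lt_le_trans xv v1).
have cp : {within `[u, v], continuous psi}.
  apply: continuous_subspaceW cpsi => x /=; rewrite !in_itv/= => /andP[ux xv].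
  by rewrite (le_trans u0 ux) (le_trans xv v1).
have [c cuv e] := MVT uv dp cp.
by exists c => //; move: cuv; rewrite in_itv.
Qed.

Lemma within_cvg (g : R -> R) (y e : R) : {within `[0, 1], continuous g} ->
  0 <= y <= 1 -> 0 < e -> \forall t \near y, 0 <= (t : R) <= 1 -> `|g t - g y| <= e.
Proof.
move=> cg y01 e0; have yin : `[0, 1]%classic y by rewrite /= in_itv.
have /cvgrPdist_le/(_ e e0) H := cg y.
have H' : within `[0, 1] (nbhs y) (fun t => `|g y - g t| <= e).
  by rewrite (nbhs_subspace_in yin); exact: H.
rewrite /within/= in H'; apply: (@filterS _ (nbhs y) _ _ _ _ H') => t h t01; rewrite distrC; apply: h.
by rewrite in_itv.
Qed.

(** Heine's theorem, from compactness in its near-covering form; the modulus runs over the right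
    neighbourhoods of 0. *)
Lemma unif_cont01 (g : R -> R) (e : R) : {within `[0, 1], continuous g} -> 0 < e ->
  exists2 dl : R, 0 < dl & forall t y : R, 0 <= t <= 1 -> 0 <= y <= 1 -> `|t - y| <= dl ->
    `|g t - g y| <= e.
Proof.
move=> cg e0.
have /compact_near_coveringP cpt := @segment_compact R 0 1.
have e2 : 0 < e / 2 by rewrite divr_gt0.
have := cpt R (0^'+) (fun dl y => forall t, 0 <= t <= 1 -> 0 <= y <= 1 -> `|t - y| <= dl ->
    `|g t - g y| <= e) _ _.
move=> H; have {}H : \forall dl \near 0^'+, `[0, 1] `<=` (fun y => forall t, 0 <= t <= 1 ->
    0 <= y <= 1 -> `|t - y| <= dl -> `|g t - g y| <= e).
  apply: H => y; rewrite /= in_itv/= => y01.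
  have /nbhs_ballP[r /= r0 hr] := within_cvg cg y01 e2.
  have r2 : 0 < r / 2 by rewrite divr_gt0.
  exists (ball y (r / 2), [set dl | dl < r / 2]) => /=.
    split; first exact: nbhsx_ballx.
    exact: nbhs_right_lt.
  move=> [y' dl]/= [yy' dlr] t t01 y'01 ty'.
  have h1 := hr y' _ y'01; have h2 := hr t _ t01.
  have {}h1 : `|g y' - g y| <= e / 2.
    by apply: h1; rewrite /ball/= (lt_trans yy')// ltr_pdivrMr// ltr_pMr// ltr1n.
  have {}h2 : `|g t - g y| <= e / 2.
    apply: h2; rewrite /ball/=; move: yy' ty'; rewrite /ball/= !ltr_norml !ler_norml.
    by move=> /andP[? ?] /andP[? ?]; apply/andP; split; lra.
  move: h1 h2; rewrite !ler_norml => /andP[? ?] /andP[? ?]; apply/andP; split; lra.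
have [dl [hdl dl0]] := filter_ex (filterI H (@nbhs_right_gt R 0)).
by exists dl => // t y t01 y01; apply: hdl => //=; rewrite in_itv.
Qed.

Lemma C1_01_bound (g : R -> R) : {within `[0, 1], continuous g} ->
  exists2 B : R, 0 < B & forall t : R, 0 <= t <= 1 -> `|g t| <= B.
Proof.
move=> cg; have cng : {within `[0, 1], continuous (fun t => `|g t|)}.
  by move=> x; apply: cvg_norm; exact: cg.
have [c _ hc] := @EVT_max R _ 0 1 ler01 cng.
exists (`|g c| + 1); first by rewrite ltr_wpDl.
by move=> t t01; rewrite (le_trans (hc t _)) ?lerDl// in_itv.
Qed.

End C1_functions.

Section gamma.
Context {R : realType}.
Variables (psi psi1 : R -> R) (k : nat).
Hypothesis C1psi : C1_01 psi psi1.
Hypothesis k_gt0 : (0 < k)%N.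

(* A mesh finer than the square of the width [1 / (L + 1)] of the steps, so that the
   sums over the grid are Riemann sums of the derivative of the steps. *)
Definition grid (L q : nat) : R := q%:R / (L.+1 ^ 3)%:R.

Lemma grid_gt0 L : 0 < (L.+1 ^ 3)%:R :> R.
Proof. by rewrite ltr0n expn_gt0. Qed.

Lemma gridS L q : grid L q.+1 = grid L q + (L.+1 ^ 3)%:R^-1.
Proof. by rewrite /grid -(natr1 q) mulrDl mul1r. Qed.

Lemma grid_itv L q : (q <= L.+1 ^ 3)%N -> 0 <= grid L q <= 1.
Proof.
by move=> qL; rewrite divr_ge0 ?ler0n//= ler_pdivrMr ?grid_gt0// mul1r ler_nat.
Qed.

Lemma gridN L : grid L (L.+1 ^ 3) = 1.
Proof. by rewrite /grid divff// gt_eqF// grid_gt0. Qed.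

Lemma grid_diff L q : (q < L.+1 ^ 3)%N -> exists2 c, grid L q < c < grid L q.+1 &
  psi (grid L q.+1) - psi (grid L q) = psi1 c / (L.+1 ^ 3)%:R.
Proof.
move=> qL; have /andP[g0 _] := grid_itv (ltnW qL); have /andP[_ g1] := grid_itv qL.
have gg : grid L q < grid L q.+1 by rewrite gridS ltrDl invr_gt0 grid_gt0.
have [c cg ->] := C1_01_mvt C1psi g0 gg g1.
by exists c => //; rewrite gridS addrAC subrr add0r.
Qed.

Lemma grid_diff_bound L q (B : R) : (forall t : R, 0 <= t <= 1 -> `|psi1 t| <= B) ->
  (q < L.+1 ^ 3)%N -> `|psi (grid L q.+1) - psi (grid L q)| <= B / (L.+1 ^ 3)%:R.
Proof.
move=> hB qL; have [c /andP[c1 c2] ->] := grid_diff qL.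
have /andP[g0 _] := grid_itv (ltnW qL); have /andP[_ g1] := grid_itv qL.
rewrite normrM normfV (gtr0_norm (grid_gt0 L)) ler_wpM2r ?invr_ge0//.
by apply: hB; rewrite (ltW (le_lt_trans g0 c1)) (ltW (lt_le_trans c2 g1)).
Qed.

(* With [A] the smoothed count of the points and [s] the squared norm of one of
   them, [2 * gamma * x] is the gradient of the approximation at this point [x]. *)
Definition gamma (L : nat) (A : R -> R) (s : R) : R :=
  \sum_(q < L.+1 ^ 3) (psi (grid L q.+1) - psi (grid L q)) *
    (dsstep (A (grid L q.+1) - k.-1%:R) * (L.+1%:R * dsstep (L.+1%:R * (grid L q.+1 - s)))).

(** Uniform in [L] and in [A], which provides the domination of the gradients: an increment of [psi]
    is at most B/(L+1)^3, the outer slope at most 2, and the remaining Riemann sum at most 9. *)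
Lemma gamma_bound L (A : R -> R) (s B : R) : (forall t : R, 0 <= t <= 1 -> `|psi1 t| <= B) ->
  `|gamma L A s| <= 18 * B.
Proof.
move=> hB; have B0 : 0 <= B by apply: le_trans (hB 0 _); rewrite ?lexx ?ler01.
rewrite /gamma (le_trans (ler_norm_sum _ _ _))//.
pose D q := dsstep (L.+1%:R * (grid L q.+1 - s)) / L.+1%:R ^+ 2.
apply: (@le_trans _ _ (\sum_(q < L.+1 ^ 3) 2 * B * D q)); last first.
  have h9 : \sum_(q < L.+1 ^ 3) D q <= 9 := @riemann_sstep2_bound R L s.
  by rewrite -mulr_sumr; nra.
apply: ler_sum => q _; rewrite normrM.
have gd := grid_diff_bound hB (ltn_ord q).
have /andP[d0 d2] := dsstep_itv (A (grid L q.+1) - k.-1%:R).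
have /andP[e0 e2] := dsstep_itv (L.+1%:R * (grid L q.+1 - s)).
set x := dsstep _ in d0 d2 *; set y := dsstep _ in e0 e2 *.
rewrite (ger0_norm (_ : 0 <= x * (L.+1%:R * y))); last by rewrite !mulr_ge0.
have L0 : L.+1%:R != 0 :> R by rewrite pnatr_eq0.
apply: (@le_trans _ _ (B / (L.+1 ^ 3)%:R * (2 * (L.+1%:R * y)))).
  apply: ler_pM => //; first by rewrite !mulr_ge0.
  by rewrite ler_wpM2r// mulr_ge0.
rewrite le_eqVlt; apply/orP; left; apply/eqP; rewrite /D -/y natrX.
by move: L0; set z : R := _%:R => L0; field.
Qed.

Lemma grid_near (x y z s c dl : R) : 0 < dl -> x < c + y -> c < x -> s < x ->
  x < s + z -> y <= z -> z <= dl / 4 -> - dl < s - c < dl.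
Proof. by move=> *; apply/andP; split; lra. Qed.

(* [m] points are closer than [s] and [j] are at [s]: the limit vanishes unless the
   k-th closest is one of the [j] tied points, which share [psi1 s] equally. *)
Lemma gamma_cvg (A : nat -> R -> R) (s gap : R) (m j : nat) : (0 < j)%N -> 0 <= s < 1 -> 0 < gap ->
  (forall L t, L.+1%:R^-1 <= gap -> s < t < s + L.+1%:R^-1 ->
     A L t = m%:R + j%:R * sstep (L.+1%:R * (t - s))) ->
  gamma L (A L) s @[L --> \oo] --> psi1 s * ((m <= k.-1 < m + j)%N%:R / j%:R).
Proof.
move=> j0 /andP[s0 s1] gap0 hA; set bb := (m <= _ < _)%N.
have jn0 : j%:R != 0 :> R by rewrite pnatr_eq0 -lt0n.
have j1 : 1 <= j%:R :> R by rewrite ler1n.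
have [_ cpsi1 _] := C1psi.
have s01 : 0 <= s <= 1 by rewrite s0 ltW.
pose a : R := m%:R - k.-1%:R.
have sa : sstep (a + j%:R * 1) - sstep (a + j%:R * 0) = bb%:R.
  rewrite mulr1 mulr0 addr0 /a /bb; case: (leqP m k.-1) => mk /=; last first.
    have : k.-1.+1%:R <= m%:R :> R by rewrite ler_nat.
    by rewrite -natr1 => h; rewrite !sstep_ge1 ?subrr//; lra.
  have mk' : m%:R - k.-1%:R <= 0 :> R by rewrite subr_le0 ler_nat.
  rewrite (sstep_le0 mk') subr0; case: (ltnP k.-1 (m + j)) => kmj.
    have : k.-1.+1%:R <= (m + j)%:R :> R by rewrite ler_nat.
    by rewrite natrD -natr1 => h; rewrite sstep_ge1//; lra.
  have : (m + j)%:R <= k.-1%:R :> R by rewrite ler_nat.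
  by rewrite natrD => h; rewrite sstep_le0//; lra.
apply/cvgrPdist_le => /= e e0.
pose c : R := 32 * j%:R ^+ 2 + 16 * j%:R.
have c0 : 0 < c by rewrite /c; nra.
(* The outer slope is at most 2 and the Riemann sum at most 9, so an error e/36 on [psi1]
   contributes at most e/2. *)
have e36 : 0 < e / 36 by rewrite divr_gt0.
have [dl /= dl0 hdl] := (nbhs_ballP _ _).1 (within_cvg cpsi1 s01 e36).
have small (x : R) : 0 < x -> \forall L \near \oo, L.+1%:R^-1 <= x.
  move=> x0; near=> L; apply: ltW; near: L.
  exact: (near_infty_natSinv_lt (PosNum x0)).
near=> L.
have L0 : 0 < L.+1%:R :> R by [].
have L1 : 1 <= L.+1%:R :> R by rewrite ler1n.
have hgap : L.+1%:R^-1 <= gap by near: L; exact: small.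
(* The step starting at [s] is completed inside [0, 1]. This is where s < 1 enters: at a point of
   the sphere the step would be cut off. *)
have hs : L.+1%:R^-1 <= 1 - s by near: L; apply: small; rewrite subr_gt0.
have hdl' : L.+1%:R^-1 <= dl / 4 by near: L; apply: small; rewrite divr_gt0.
have hps : L.+1%:R^-1 <= e / (2 * c * (`|psi1 s| + 1)).
  near: L; apply: small; rewrite divr_gt0// !mulr_gt0// ltr_wpDl//.
pose v q := L.+1%:R * (grid L q - s).
pose h : R := (L.+1%:R ^+ 2)^-1.
have h0 : 0 <= h by rewrite invr_ge0 exprn_ge0// ltW.
have L3 : (L.+1 ^ 3)%:R^-1 <= L.+1%:R^-1 :> R.
  by rewrite lef_pV2 ?posrE ?grid_gt0// ler_nat -[X in (X <= _)%N]expn1 leq_pexp2l.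
have inside q : dsstep (v q) != 0 -> s < grid L q < s + L.+1%:R^-1.
  move=> dn0; have v0 : 0 < v q by rewrite ltNge; apply: contra dn0 => /dsstep_le0 ->.
  have v1 : v q < 1 by rewrite ltNge; apply: contra dn0 => /dsstep_ge1 ->.
  move: v0 v1; rewrite /v pmulr_rgt0// subr_gt0 => -> /=.
  by rewrite mulrC -ltr_pdivlMr// div1r ltrBlDl.
(* Outside the support of the inner slope both sides vanish, so the formula for [A] is needed only
   just above [s]. *)
have termE q : (psi (grid L q.+1) - psi (grid L q)) *
    (dsstep (A L (grid L q.+1) - k.-1%:R) * (L.+1%:R * dsstep (v q.+1))) =
    (psi (grid L q.+1) - psi (grid L q)) * L.+1%:R / j%:R * dsstep2 a j%:R (v q.+1).
  have [dv0|dn0] := eqVneq (dsstep (v q.+1)) 0; first by rewrite /dsstep2 dv0 !mulr0.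
  rewrite (hA _ _ hgap (inside _ dn0)) /dsstep2 -/(v q.+1) /a.
  have -> : m%:R + j%:R * sstep (v q.+1) - k.-1%:R =
      m%:R - k.-1%:R + j%:R * sstep (v q.+1) by ring.
  by field.
pose T := \sum_(q < L.+1 ^ 3) dsstep2 a j%:R (v q.+1) * h.
have e1 : `|gamma L (A L) s - psi1 s * (T / j%:R)| <= e / 2.
  rewrite /gamma /T mulr_suml mulr_sumr.
  under eq_bigr do rewrite -/(v _) termE.
  rewrite -sumrB (le_trans (ler_norm_sum _ _ _))//.
  apply: (@le_trans _ _ (\sum_(q < L.+1 ^ 3) e / 36 * 2 * (dsstep (v q.+1) * h))); last first.
    have h9 : \sum_(q < L.+1 ^ 3) dsstep (v q.+1) * h <= 9 := @riemann_sstep2_bound R L s.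
    by rewrite -mulr_sumr; nra.
  apply: ler_sum => q _.
  have [dv0|dn0] := eqVneq (dsstep (v q.+1)) 0.
    by rewrite /dsstep2 dv0 !(mul0r, mulr0) subrr normr0.
  have [t /andP[c1 c2] ->] := grid_diff (ltn_ord q).
  have /andP[g1 g2] := inside _ dn0.
  have /andP[q0 _] := @grid_itv L q (ltnW (ltn_ord q)).
  have /andP[_ q1] := @grid_itv L q.+1 (ltn_ord q).
  have hc : `|psi1 t - psi1 s| <= e / 36.
    apply: hdl; last by rewrite (ltW (le_lt_trans q0 c1)) (ltW (lt_le_trans c2 q1)).
    rewrite /ball/= ltr_norml; move: c1; rewrite -(ltrD2r (L.+1 ^ 3)%:R^-1) -gridS => c1.
    exact: (grid_near dl0 c1 c2 g1 g2 L3 hdl').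
  have /andP[x0 x2] := dsstep_itv (a + j%:R * sstep (v q.+1)).
  have /andP[y0 y2] := dsstep_itv (v q.+1).
  rewrite (_ : _ - _ = (psi1 t - psi1 s) * (dsstep (a + j%:R * sstep (v q.+1)) * (dsstep (v q.+1) * h))); last first.
    rewrite /dsstep2 /h natrX; move: (lt0r_neq0 L0); move: (L.+1%:R : R) => z z0.
    have := jn0; move: (j%:R : R) => J jn.
    by field; rewrite jn z0.
  rewrite normrM -mulrA; apply: ler_pM => //.
  rewrite ger0_norm; last by rewrite !mulr_ge0.
  by rewrite ler_wpM2r// mulr_ge0.
have e2 : `|T - bb%:R| <= c / L.+1%:R.
  have := @riemann_sstep2 R L a j%:R s v (ler0n _ _) (fun q => erefl).
  rewrite /sstep2 (_ : sstep (v (L.+1 ^ 3)%N) = 1); last first.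
    rewrite sstep_ge1// /v gridN.
    by rewrite mulrC -ler_pdivrMr// div1r.
  rewrite (_ : sstep (v 0%N) = 0) ?sa//.
  by rewrite sstep_le0// /v /grid mul0r sub0r mulrN oppr_le0 mulr_ge0// ltW.
rewrite distrC (_ : _ - _ = (gamma L (A L) s - psi1 s * (T / j%:R)) +
  psi1 s * (T - bb%:R) / j%:R); last first.
  by have := jn0; move: (j%:R : R) => J jn; field.
rewrite (le_trans (ler_normD _ _))// [leRHS]splitr lerD// 2!normrM normfV.
apply: (@le_trans _ _ (`|psi1 s| * `|T - bb%:R|)).
  have jp : 0 < j%:R :> R by rewrite ltr0n.
  by rewrite (gtr0_norm jp) ler_pdivrMr// ler_peMr// mulr_ge0.
apply: (@le_trans _ _ ((`|psi1 s| + 1) * (c * (e / (2 * c * (`|psi1 s| + 1)))))).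
  apply: ler_pM => //; first by rewrite lerDl.
  by apply: (le_trans e2); rewrite ler_wpM2l// ltW.
rewrite le_eqVlt; apply/orP; left; apply/eqP.
move: (`|psi1 s|) (normr_ge0 (psi1 s)) => p p0; have p1 : p + 1 != 0 by rewrite gt_eqF// ltr_wpDl.
by move: (lt0r_neq0 c0) => cn0; field; rewrite ?p1 ?cn0.
Unshelve. all: by end_near. Qed.

End gamma.

(** * Calculus of gradients on matrices *)

Section gradients.
Context {R : realType} {n d : nat}.
Implicit Types (f : 'M[R]_(n, d) -> R) (g : 'M[R]_(n, d) -> 'I_n -> 'I_d -> R)
  (M : 'M[R]_(n, d)).

Definition has_grad f g := forall M : 'M[R]_(n, d), differentiable f M /\
  forall i j, 'D_(delta_mx i j) f M = g M i j.

Lemma has_grad_continuous f g : has_grad f g -> continuous f.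
Proof. by move=> hf M; apply: differentiable_continuous; case: (hf M). Qed.

Lemma has_grad_eq f g g' : has_grad f g -> (forall M i j, g M i j = g' M i j) ->
  has_grad f g'.
Proof. by move=> hf gg M; have [h1 h2] := hf M; split=> // i j; rewrite h2. Qed.

Lemma has_grad_cst (c : R) : has_grad (fun=> c) (fun _ _ _ => 0).
Proof.
by move=> M; split=> [|i j]; [exact: differentiable_cst|rewrite derive_cst].
Qed.

Lemma has_gradD f f' g g' : has_grad f g -> has_grad f' g' ->
  has_grad (fun M => f M + f' M) (fun M i j => g M i j + g' M i j).
Proof.
move=> hf hf' M; have [h1 h2] := hf M; have [h1' h2'] := hf' M.
split=> [|i j]; first exact: differentiableD.
by rewrite deriveD ?h2 ?h2'//; exact: diff_derivable.
Qed.

Lemma has_gradZ (c : R) f g : has_grad f g ->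
  has_grad (fun M => c * f M) (fun M i j => c * g M i j).
Proof.
move=> hf M; have [h1 h2] := hf M; split=> [|i j].
  by rewrite (_ : (fun _ => _) = c *: f)//; exact: differentiableZ.
rewrite (_ : (fun _ => _) = c *: f)// deriveZ ?h2//; exact: diff_derivable.
Qed.

Lemma has_grad_sum (I : Type) (r : seq I) (f : I -> 'M[R]_(n, d) -> R)
    (g : I -> 'M[R]_(n, d) -> 'I_n -> 'I_d -> R) :
  (forall i, has_grad (f i) (g i)) ->
  has_grad (fun M => \sum_(i <- r) f i M) (fun M i j => \sum_(l <- r) g l M i j).
Proof.
move=> hf; elim: r => [|x r IH].
  rewrite (_ : (fun _ => _) = fun=> 0); last by apply/funext => M; rewrite big_nil.
  by apply: has_grad_eq (has_grad_cst 0) _ => M i j; rewrite big_nil.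
rewrite (_ : (fun _ => _) = fun M => f x M + \sum_(i <- r) f i M).
  by apply: has_grad_eq (has_gradD (hf x) IH) _ => M i j; rewrite big_cons.
by apply/funext => M; rewrite big_cons.
Qed.

Lemma has_grad_comp (h h1 : R -> R) f g : (forall u : R, is_derive u 1 h (h1 u)) ->
  has_grad f g -> has_grad (fun M => h (f M)) (fun M i j => h1 (f M) * g M i j).
Proof.
move=> hh hf M; have [h1f h2f] := hf M.
have dh : differentiable h (f M) by apply/derivable1_diffP; case: (hh (f M)).
have dc : differentiable (h \o f) M by exact: differentiable_comp.
split=> // i j; rewrite -h2f (_ : (fun _ => _) = h \o f)//.
rewrite deriveE// diff_comp//= deriveE//.
have -> : h1 (f M) = 'd h (f M) 1 by rewrite -deriveE//; case: (hh (f M)).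
by rewrite mulrC -[in LHS](mulr1 ('d f M _)) -linearZ.
Qed.

Lemma has_grad_coord i0 j0 :
  has_grad (fun M => M i0 j0) (fun _ i j => ((i == i0) && (j == j0))%:R).
Proof.
move=> M; split=> [|i j]; first exact: differentiable_coord.
rewrite deriveE; last exact: differentiable_coord.
pose l : 'M[R]_(n, d) -> R := fun M => M i0 j0.
have ll : linear l by move=> a u v; rewrite /l !mxE.
pose L : {linear 'M[R]_(n, d) -> R} := HB.pack l (@GRing.isLinear.Build _ _ _ _ l ll).
rewrite (_ : (fun _ => _) = L)// diff_lin; last exact: coord_continuous.
by rewrite /= /l mxE ![_ == i0]eq_sym ![_ == j0]eq_sym.
Qed.

(** The squared norm of a point; unlike the norm it is differentiable at the origin. *)
Definition sqrow M (i : 'I_n) : R := dotp (row i M) (row i M).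

Lemma sqrowE M i : sqrow M i = \sum_j M i j ^+ 2.
Proof. by apply: eq_bigr => j _; rewrite !mxE expr2. Qed.

Lemma has_grad_sqrow i0 : has_grad (fun M => sqrow M i0)
  (fun M i j => (i == i0)%:R * (2 * M i j)).
Proof.
have dsq (u : R) : is_derive u 1 (fun u : R => u ^+ 2) (2 * u).
  apply: (@is_derive_err _ _ _ _ 1) => h.
  by rewrite mul1r (_ : _ - _ = h ^+ 2) ?ger0_norm ?sqr_ge0//; ring.
rewrite (_ : (fun _ => _) = fun M => \sum_j M i0 j ^+ 2).
  apply: has_grad_eq (has_grad_sum _ (fun j => has_grad_comp dsq (has_grad_coord i0 j))) _.
  move=> M i j; rewrite (bigD1 j)//= big1 ?addr0 => [|l /negPf lj].
    by rewrite eqxx andbT; case: eqP => [->|_]; rewrite ?mulr1 ?mulr0 ?mul1r ?mul0r.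
  by rewrite [j == l]eq_sym lj andbF mulr0.
by apply/funext => M; rewrite sqrowE.
Qed.

Lemma continuous_sqrow i0 : continuous (fun M => sqrow M i0).
Proof. exact: has_grad_continuous (has_grad_sqrow i0). Qed.

End gradients.

Section approximating_forms.
Context {R : realType} {d : nat}.
Variables (psi psi1 : R -> R) (k : nat).
Hypothesis C1psi : C1_01 psi psi1.
Hypothesis k_gt0 : (0 < k)%N.

(** A smoothed number of points of squared norm below [t]. The steps start at 0 rather than being
    centred there, so points at [t] or beyond are not counted at all. *)
Definition soft_count n (l : nat) (M : 'M[R]_(n, d)) (t : R) : R :=
  \sum_i sstep (l.+1%:R * (t - sqrow M i)).

(** With exact counts the outer step would be the indicator that k points have squared norm at most
    t, and the sum would telescope, up to the mesh, to psi(1) - psi(Y). *)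
Definition approx_form (l : nat) : @forms R d := fun n M =>
  psi 1 - \sum_(q < l.+1 ^ 3) (psi (grid l q.+1) - psi (grid l q)) *
    sstep (soft_count l M (grid l q.+1) - k.-1%:R).

Definition approx_weight (l : nat) n (M : 'M[R]_(n, d)) (i : 'I_n) : R :=
  gamma psi k l (soft_count l M) (sqrow M i).

Lemma has_grad_soft_count n l (t : R) : has_grad (fun M : 'M[R]_(n, d) => soft_count l M t)
  (fun M i j => - (l.+1%:R * (dsstep (l.+1%:R * (t - sqrow M i)) * (2 * M i j)))).
Proof.
pose A i0 (M : 'M[R]_(n, d)) := l.+1%:R * t + - l.+1%:R * sqrow M i0.
have hA i0 : has_grad (A i0) _ := has_gradD (has_grad_cst (l.+1%:R * t))
  (has_gradZ (- l.+1%:R) (has_grad_sqrow i0)).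
rewrite (_ : (fun _ => _) = fun M => \sum_i sstep (A i M)); last first.
  by apply/funext => M; apply: eq_bigr => i _; rewrite /A mulNr -mulrBr.
apply: has_grad_eq (has_grad_sum _ (fun i => has_grad_comp is_derive_sstep (hA i))) _.
move=> M i j; rewrite (bigD1 i)//= big1 ?addr0 => [|i1 /negPf i1i].
  have -> : A i M = l.+1%:R * (t - sqrow M i) by rewrite /A mulNr -mulrBr.
  by rewrite eqxx mul1r; ring.
by rewrite [i == i1]eq_sym i1i mul0r mulr0 addr0 mulr0.
Qed.

Lemma has_grad_approx_form l n : has_grad (@approx_form l n)
  (fun M i j => 2 * M i j * approx_weight l M i).
Proof.
have h t := has_grad_comp is_derive_sstep (has_gradD (@has_grad_soft_count n l t)
  (has_grad_cst (- k.-1%:R))).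
rewrite (_ : @approx_form l n = fun M => psi 1 + -1 * \sum_(q < l.+1 ^ 3)
    (psi (grid l q.+1) - psi (grid l q)) *
    sstep (soft_count l M (grid l q.+1) + - k.-1%:R)); last first.
  by apply/funext => M; rewrite mulN1r.
apply: (has_grad_eq (has_gradD (has_grad_cst (psi 1)) (has_gradZ (-1) (has_grad_sum
  (index_enum 'I_(l.+1 ^ 3)) (fun q => has_gradZ _ (h (grid l q.+1))))))).
move=> M i j; rewrite add0r /approx_weight /gamma !mulr_sumr; apply: eq_bigr => q _.
by ring.
Qed.


Lemma sqrow_perm n (p : 'S_n) (M : 'M[R]_(n, d)) i :
  sqrow (row_perm p M) i = sqrow M (p i).
Proof. by rewrite !sqrowE; apply: eq_bigr => j _; rewrite mxE. Qed.

Lemma soft_count_perm n l (p : 'S_n) (M : 'M[R]_(n, d)) (t : R) :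
  soft_count l (row_perm p M) t = soft_count l M t.
Proof.
rewrite /soft_count [RHS](reindex_inj (@perm_inj _ p)).
by apply: eq_bigr => i _; rewrite sqrow_perm.
Qed.

Lemma approx_form_perm l n (p : 'S_n) M :
  approx_form l (row_perm p M) = approx_form l M.
Proof.
by congr (_ - _); apply: eq_bigr => q _; rewrite soft_count_perm.
Qed.

Lemma approx_weight_perm l n (p : 'S_n) (M : 'M[R]_(n, d)) i :
  approx_weight l (row_perm p M) i = approx_weight l M (p i).
Proof.
rewrite /approx_weight sqrow_perm; congr (gamma _ _ _ _ _).
by apply/funext => t; rewrite soft_count_perm.
Qed.

(** The source of the boundary condition of [in_DomD]: the step vanishes on nonpositive arguments,
    so a point of the sphere is invisible at all levels t <= 1. *)
Lemma soft_count_sphere l n (M : 'M[R]_(n, d)) (z : 'rV[R]_d) (t : R) :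
  unit_sphere z -> t <= 1 -> soft_count l (col_mx M z) t = soft_count l M t.
Proof.
move=> z1 t1; have zz : dotp z z = 1 by rewrite -sqr_enorm z1 expr1n.
rewrite /soft_count big_split_ord/= [X in _ + X]big1 ?addr0.
  by apply: eq_bigr => i _; rewrite /sqrow rowKu.
move=> i _; rewrite /sqrow rowKd (ord1 i) (_ : row 0 z = z) ?zz; last first.
  by apply/rowP => j; rewrite mxE.
by rewrite sstep_le0// mulr_ge0_le0// subr_le0.
Qed.

Lemma approx_form_sphere l n (M : 'M[R]_(n, d)) (z : 'rV[R]_d) :
  unit_sphere z -> approx_form l (col_mx M z) = approx_form l M.
Proof.
move=> z1; congr (_ - _); apply: eq_bigr => q _; rewrite soft_count_sphere//.
by have /andP[] := @grid_itv R l q.+1 (ltn_ord q).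
Qed.

Lemma continuous_approx_weight l n (i : 'I_n) :
  continuous (fun M : 'M[R]_(n, d) => approx_weight l M i).
Proof.
move=> M; rewrite /approx_weight /gamma; apply: (@cvg_sumr R _ (nbhs M)) => q.
apply: cvgM; first exact: cvg_cst.
apply: cvgM.
  apply: (@continuous_cvg _ _ _ (nbhs M) _ _ dsstep); first exact: continuous_dsstep.
  apply: cvgB; last exact: cvg_cst.
  exact: (has_grad_continuous (@has_grad_soft_count n l _)).
apply: cvgM; first exact: cvg_cst.
apply: (@continuous_cvg _ _ _ (nbhs M) _ _ dsstep); first exact: continuous_dsstep.
apply: cvgM; first exact: cvg_cst.
apply: cvgB; first exact: cvg_cst.
exact: continuous_sqrow.
Qed.

Lemma continuous_approx_grad l n (i : 'I_n) (j : 'I_d) :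
  continuous ('D_(delta_mx i j) (@approx_form l n)).
Proof.
rewrite (_ : 'D_(delta_mx i j) (@approx_form l n) =
    fun M : 'M[R]_(n, d) => 2 * M i j * approx_weight l M i); last first.
  by apply/funext => M; rewrite (has_grad_approx_form l M).2.
move=> M; apply: (@cvgM _ _ (nbhs M)); last exact: continuous_approx_weight.
by apply: (@cvgM _ _ (nbhs M)); [exact: cvg_cst|exact: coord_continuous].
Qed.

Lemma approx_form_bound l (B : R) : (forall t : R, 0 <= t <= 1 -> `|psi1 t| <= B) ->
  forall n (M : 'M[R]_(n, d)), `|approx_form l M| <= `|psi 1| + B.
Proof.
move=> hB n M; rewrite /approx_form (le_trans (ler_normB _ _))// lerD2l.
apply: (le_trans (ler_norm_sum _ _ _)).
apply: (@le_trans _ _ (\sum_(q < l.+1 ^ 3) B / (l.+1 ^ 3)%:R)).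
  apply: ler_sum => q _; rewrite normrM.
  have h1 := grid_diff_bound C1psi hB (ltn_ord q).
  have /andP[h2 h3] := sstep_itv (soft_count l M (grid l q.+1) - k.-1%:R).
  by rewrite -[leRHS]mulr1 ler_pM// ger0_norm.
by rewrite sumr_cst divfK// gt_eqF// grid_gt0.
Qed.

Lemma approx_weight_bound l (B : R) : (forall t : R, 0 <= t <= 1 -> `|psi1 t| <= B) ->
  forall n (M : 'M[R]_(n, d)) i, `|approx_weight l M i| <= 18 * B.
Proof. by move=> hB n M i; exact: (gamma_bound k C1psi). Qed.

Lemma grad_approx_form l n (M : 'M[R]_(n, d)) i :
  grad (@approx_form l n) i M = (2 * approx_weight l M i) *: row i M.
Proof.
by apply/rowP => j; rewrite !mxE (has_grad_approx_form l M).2 mulrAC.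
Qed.

Lemma measurable_unit_ballX n : measurable (@unit_ballX R d n).
Proof.
rewrite (_ : unit_ballX n =
    \bigcap_(i in [set: 'I_n]) [set M : 'M[R]_(n, d) | unit_ball (row i M)]); last first.
  by apply/seteqP; split => [M h i _|M h i]; [exact: h|exact: (h i)].
apply: fin_bigcap_measurable => // i _; rewrite -[X in measurable X]setTI.
apply: (@measurable_fun_mx _ (measurableTypeR R) 1 d) => //; last exact: measurable_unit_ball.
move=> i' j; rewrite (_ : (fun _ => _) = fun M : 'M[R]_(n, d) => M i j).
  exact: (@measurable_mx_entry _ (measurableTypeR R)).
by apply/funext => M; rewrite mxE.
Qed.

Lemma lebesgue_unit_ballX_lty n : (lebesgue_mx n d (@unit_ballX R d n) < +oo)%E.
Proof.
pose C := fun (_ : 'I_n) (_ : 'I_d) => `[- 1 : R, 1]%classic.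
have mC i j : measurable (C i j) by exact: measurable_itv.
apply: (@le_lt_trans _ _ (lebesgue_mx n d [set M | forall i j, C i j (M i j)])).
  apply: le_measure; rewrite ?inE//.
  - exact: measurable_unit_ballX.
  - exact: measurable_boxE.
  - move=> M hM i j; rewrite /C/= in_itv/= -ler_norml.
    by have := entry_le_enorm (row i M) j; rewrite mxE => /le_trans; apply; exact: hM.
rewrite lebesgue_mx_box// ltey_eq fin_numElt; apply/orP; left.
rewrite -fin_numElt; apply: (big_ind (fun x => x \is a fin_num)) => //.
  by move=> x y; exact: fin_numM.
move=> i _; apply: (big_ind (fun x => x \is a fin_num)) => //.
  by move=> x y; exact: fin_numM.
by move=> j _; rewrite lebesgue_measure_itv/=; case: ifPn.
Qed.

Lemma measurable_approx_form l n :
  measurable_fun [set: 'M[R]_(n, d)] (@approx_form l n).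
Proof.
apply: measurable_funB => //; apply: measurable_sum => q.
apply: measurable_funM => //.
apply: (measurableT_comp (continuous_measurable_fun continuous_sstep)).
apply: measurable_funB => //; apply: measurable_sum => i.
apply: (measurableT_comp (continuous_measurable_fun continuous_sstep)).
apply: measurable_funM => //; apply: measurable_funB => //.
rewrite (_ : (fun _ => _) = fun M : 'M[R]_(n, d) => \sum_j M i j ^+ 2).
  apply: measurable_sum => j; apply: measurable_funX.
  exact: (@measurable_mx_entry _ (measurableTypeR R)).
by apply/funext => M; rewrite sqrowE.
Qed.

Lemma approx_form_DomD l : in_DomD (approx_form l).
Proof.
have [_ cpsi1 _] := C1psi.
have [B B0 hB] := C1_01_bound cpsi1.
have A0 : 0 <= `|psi 1| + B by rewrite addr_ge0// ltW.
split; last by move=> n M z _ z1; exact: approx_form_sphere.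
split.
  split=> [n _|n s M _]; last exact: approx_form_perm.
  apply: measurable_bounded_integrable.
  - exact: measurable_unit_ballX.
  - exact: lebesgue_unit_ballX_lty.
  - apply: (@measurable_funS _ _ _ _ setT) => //; exact: measurable_approx_form.
  - exists (`|psi 1| + B); split; first exact: num_real.
    move=> C BC M _ /=; apply: le_trans (ltW BC); exact: approx_form_bound.
(* With A = |psi 1| + B bounding the form and 36 B = 2 * 18 B bounding each of the n gradients,
   Bernoulli's inequality gives A + 36 B n <= (1 + A + 36 B)^n for n >= 1. *)
exists (1 + (`|psi 1| + B + 36 * B)) => [|n n0].
  by rewrite ltr_pwDl// addr_ge0// mulr_ge0// ltW.
split.
  exists setT; split=> [||M _]; [exact: openT|by []|].
  split; first exact: (has_grad_approx_form l M).1.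
  by move=> i j; exact: continuous_approx_grad.
apply: (@le_trans _ _ ((`|psi 1| + B)%:E + \sum_(i < n) (36 * B)%:E)%E).
  apply: leeD.
    by apply: ge_ereal_sup => _ [M _ <-]; rewrite lee_fin approx_form_bound.
  apply: lee_sum => i _; apply: ge_ereal_sup => _ [M WM <-]; rewrite lee_fin.
  rewrite grad_approx_form ger0_norm ?enorm_ge0//.
  have hw := approx_weight_bound l hB M i.
  rewrite /enorm dotpZ sqrtrM ?sqr_ge0// sqrtr_sqr normrM (ger0_norm (_ : 0 <= 2))//.
  have := WM i; rewrite /unit_ball/= => h1.
  rewrite -[leRHS]mulr1; apply: ler_pM => //; lra.
rewrite sumEFin -EFinD lee_fin sumr_cst.
have [n' ->] : exists n', n = n'.+1 by exists n.-1; rewrite prednK.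
move: A0 (ltW B0); move: (`|psi 1| + B) => A A0 B0'.
elim: n' => [|m IH]; first by rewrite expr1; nra.
rewrite exprS -(natr1 m.+1) mulrDr mulr1.
have p1 : 1 <= (1 + (A + 36 * B)) ^+ m.+1 by rewrite exprn_ege1// lerDl; nra.
move: IH p1; move: (_ ^+ m.+1) (m.+1%:R : R) => x y IH p1; nra.
Qed.

Lemma approx_form_symmetric l : symmetric_forms (approx_form l).
Proof. by move=> n p M _; exact: approx_form_perm. Qed.

Lemma coeff_approx_form l m j n (M : 'M[R]_(n, d)) :
  coeff (approx_form l) m j n M = \sum_i 2 * M i m * M i j * approx_weight l M i.
Proof.
by apply: eq_bigr => i _; rewrite (has_grad_approx_form l M).2; ring.
Qed.

Lemma symmetric_coeff_approx l m j : symmetric_forms (coeff (approx_form l) m j).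
Proof.
move=> n p M _; rewrite !coeff_approx_form [RHS](reindex_inj (@perm_inj _ p)).
by apply: eq_bigr => i _; rewrite approx_weight_perm !mxE.
Qed.

Lemma continuous_coeff_approx l m j : continuous_forms (coeff (approx_form l) m j).
Proof.
move=> n M _; rewrite (_ : coeff _ m j n = fun M : 'M[R]_(n, d) =>
    \sum_i 2 * M i m * M i j * approx_weight l M i); last first.
  by apply/funext => N; exact: coeff_approx_form.
apply: (@cvg_sumr R _ (nbhs M)) => i; apply: (@cvgM _ _ (nbhs M)); last exact: continuous_approx_weight.
apply: (@cvgM _ _ (nbhs M)); last exact: coord_continuous.
by apply: (@cvgM _ _ (nbhs M)); [exact: cvg_cst|exact: coord_continuous].
Qed.

Lemma euler_approx_form l n (M : 'M[R]_(n, d)) :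
  euler (approx_form l) n M = \sum_i 2 * sqrow M i * approx_weight l M i.
Proof.
apply: eq_bigr => i _; rewrite sqrowE mulr_sumr mulr_suml; apply: eq_bigr => j _.
by rewrite (has_grad_approx_form l M).2; ring.
Qed.

End approximating_forms.

(** * Order statistics of locally finite sets *)

Section order_statistics.
Context {R : realType} {d : nat}.
Implicit Types (A : set 'rV[R]_d) (x : 'rV[R]_d) (r : R).
Local Notation W := (@unit_ball R d).

Lemma seq_argmax (T : eqType) (s : seq T) (f : T -> R) : s != [::] ->
  exists2 x, x \in s & forall y, y \in s -> f y <= f x.
Proof.
elim: s => // a [|b s] IH _.
  by exists a; rewrite ?mem_head// => y; rewrite inE => /eqP ->.
have [x xs xm] := IH isT.
have [fax|/ltW fxa] := leP (f a) (f x).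
  exists x; first by rewrite inE xs orbT.
  by move=> y; rewrite inE => /orP[/eqP ->|/xm].
exists a; first exact: mem_head.
by move=> y; rewrite inE => /orP[/eqP ->//|/xm /le_trans]; apply.
Qed.

Definition ltball r : set 'rV[R]_d := [set x | enorm x < r].

Lemma ltball_eball r : ltball r `<=` eball r.
Proof. by move=> x /ltW. Qed.

Lemma finite_setI_sub A (B C : set 'rV[R]_d) : B `<=` C -> finite_set (A `&` C) ->
  finite_set (A `&` B).
Proof. by move=> BC; apply: sub_finite_set => x [? /BC]. Qed.

Lemma le_npointsI A (B C : set 'rV[R]_d) : B `<=` C -> finite_set (A `&` C) ->
  (npoints (A `&` B) <= npoints (A `&` C))%N.
Proof. by move=> BC fC; apply: le_npoints => // x [? /BC]. Qed.

Lemma npoints_argmax A (B : set 'rV[R]_d) : finite_set (A `&` B) ->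
  (0 < npoints (A `&` B))%N ->
  exists2 x, (A `&` B) x & forall y, (A `&` B) y -> enorm y <= enorm x.
Proof.
move=> fAB n0; have [|x xs xm] := @seq_argmax _ (fset_set (A `&` B)) (@enorm R d).
  by apply: contraL n0; rewrite /npoints => /eqP ->.
exists x; first by move: xs; rewrite in_fset_set// inE.
by move=> y yAB; apply: xm; rewrite in_fset_set// inE.
Qed.

Lemma kth_closestP k A r : (forall r, finite_set (A `&` eball r)) -> (0 < k)%N ->
  (k <= npoints (A `&` eball r))%N ->
  let x := kth_closest k A in [/\ A x, enorm x <= r &
    (npoints (A `&` ltball (enorm x)) < k <= npoints (A `&` eball (enorm x)))%N].
Proof.
move=> fA k0 kr.
have [x [Ax xr] kx] : exists2 x, (A `&` eball r) x &
    (npoints (A `&` ltball (enorm x)) < k <= npoints (A `&` eball (enorm x)))%N.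
  (* Take a point of least norm among those whose closed ball holds at least [k] points. If its open
     ball already held [k] points, the farthest of these would be a candidate of smaller norm. *)
  pose s := [seq x <- fset_set (A `&` eball r) | (k <= npoints (A `&` eball (enorm x)))%N].
  have mem_s y : (y \in s) = (y \in A `&` eball r) && (k <= npoints (A `&` eball (enorm y)))%N.
    by rewrite mem_filter (in_fset_set (fA r)) andbC.
  have [x0 Ax0 x0m] := npoints_argmax (fA _) (leq_trans k0 kr).
  have [|x xs xm] := @seq_argmax _ s (fun y => - enorm y).
    have : x0 \in s.
      rewrite mem_s mem_set//= (leq_trans kr)// le_npoints//.
      by move=> y Ay; split; [case: Ay|exact: x0m].
    by case: (s).
  move: xs; rewrite mem_s => /andP[/set_mem Ax kx].
  exists x => //; rewrite kx andbT ltnNge; apply/negP => kx'.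
  have fl : finite_set (A `&` ltball (enorm x)).
    exact: finite_setI_sub (@ltball_eball _) (fA _).
  have [y [Ay yx] ym] := npoints_argmax fl (leq_trans k0 kx').
  have Ay' : (A `&` eball r) y by split => //; apply: le_trans (ltW yx) Ax.2.
  have : y \in s.
    rewrite mem_s mem_set//= (leq_trans kx')// le_npoints//.
    by move=> z Az; split; [case: Az|exact: ym].
  by move=> /xm; rewrite lerN2 leNgt => /negP; apply.
have Px : [set x | A x /\ (npoints (A `&` [set y | (enorm y < enorm x)%R]) < k
     <= npoints (A `&` [set y | (enorm y <= enorm x)%R]))%N] x by [].
have := xgetPex 0 (ex_intro _ _ Px); rewrite -/(kth_closest k A) => -[Ay ky] /=.
(* [xget] may return another point than [x]. Were its norm larger than [r], its open ball would
   contain the ball of radius [r] and hence [k] points. *)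
split=> //; rewrite leNgt; apply/negP => ry.
have ky' : (npoints (A `&` ltball (enorm (kth_closest k A))) < k)%N by case/andP: ky.
have kl : (k <= npoints (A `&` ltball (enorm (kth_closest k A))))%N.
  apply: (leq_trans kr); apply: le_npoints.
    by apply: finite_setI_sub (@ltball_eball _) (fA _).
  by move=> z [Az zr]; split => //; exact: le_lt_trans zr ry.
by move: ky'; rewrite ltnNge kl.
Qed.


(** The norm of the k-th closest point is determined by the counts of balls. The radius [r0]
    certifies that k points exist; otherwise [kth_closest] is the default value 0. *)
Lemma kth_closest_le k A r0 r : (forall r, finite_set (A `&` eball r)) -> (0 < k)%N ->
  (k <= npoints (A `&` eball r0))%N ->
  (enorm (kth_closest k A) <= r) = (k <= npoints (A `&` eball r))%N.
Proof.
move=> fA k0 kr0; have [Ax xr0 /andP[k1 k2]] := kth_closestP fA k0 kr0.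
apply/idP/idP => [xr|kr]; last by case: (kth_closestP fA k0 kr).
apply: (leq_trans k2); apply: le_npointsI => // z zx; exact: le_trans zx xr.
Qed.

End order_statistics.

Section kth_norm.
Context {R : realType} {d : nat}.
Context {disp : measure_display} {Omega : measurableType disp}.
Variables (P : probability Omega R) (X : Omega -> set 'rV[R]_d) (theta : R).
Hypotheses (theta_gt0 : 0 < theta) (PX : poisson_process P X theta).
Variable k : nat.
Hypothesis k_gt0 : (0 < k)%N.
Local Notation W := (@unit_ball R d).
Local Notation G := (g_sigma_algebraType (FW_gen X)).
Local Notation N := (count X W).

(* Y_(k) computed from the points in W only, so that it is F_W-measurable; it
   agrees with [Yk] as soon as there are [k] points in the space. *)
Definition Ystat (w : Omega) : R :=
  if (k <= N w)%N then enorm (kth_closest k (X w `&` W)) ^+ 2 else 1.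

Lemma finite_points_ball w r : finite_set (X w `&` eball r).
Proof. by apply: (finite_points PX); exact: (@bounded_eball _ _ r). Qed.

Lemma finite_pointsW_ball w r : finite_set (X w `&` W `&` eball r).
Proof. exact: finite_setIl (finite_pointsW PX w). Qed.

Lemma npointsW_ball w r : r <= 1 -> npoints (X w `&` W `&` eball r) = count X (eball r) w.
Proof.
move=> r1; rewrite /count -setIA (_ : W `&` eball r = eball r)//.
by apply: setIidr => x /le_trans; apply.
Qed.

Lemma npointsW_ball1 w : npoints (X w `&` W `&` eball 1) = N w.
Proof. by rewrite npointsW_ball. Qed.

Lemma kth_pointsW w : (k <= N w)%N -> let x := kth_closest k (X w `&` W) in
  [/\ (X w `&` W) x, enorm x <= 1 &
    (npoints (X w `&` W `&` ltball (enorm x)) < k <= npoints (X w `&` W `&` eball (enorm x)))%N].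
Proof.
by move=> kN; apply: kth_closestP => //; [exact: finite_pointsW_ball|rewrite npointsW_ball1].
Qed.

Lemma Ystat_itv w : 0 <= Ystat w <= 1.
Proof.
rewrite /Ystat; case: ifPn => [kN|_]; last by rewrite ler01 lexx.
have [_ x1 _] := kth_pointsW kN.
by rewrite sqr_ge0/= expr_le1// enorm_ge0.
Qed.

(** For r = 1 the left-hand side would always hold, since Y = 1 when W has fewer than k points. *)
Lemma Ystat_le w r : 0 <= r < 1 -> (Ystat w <= r ^+ 2) = (k <= count X (eball r) w)%N.
Proof.
move=> /andP[r0 r1]; rewrite /Ystat; case: leqP => kN.
  rewrite ler_sqr ?nnegrE ?enorm_ge0// (@kth_closest_le _ _ _ _ 1)//.
  - by rewrite npointsW_ball// ltW.
  - exact: finite_pointsW_ball.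
  - by rewrite npointsW_ball1.
have /negPf-> : ~~ (1 <= r ^+ 2) by rewrite -ltNge expr_lt1.
apply/esym/negbTE; rewrite -ltnNge; apply: leq_ltn_trans kN.
by apply: (le_count PX) => [|x]; [exact: bounded_unit_ball|move=> /le_trans; apply; exact: ltW].
Qed.

Lemma FW_measurable_Ystat : measurable_fun setT (Ystat : G -> R).
Proof.
apply: (@measurability _ _ _ _ _ _ (@RGenOInfty.G R)) => [|/= _ [_] [t] -> <-].
  exact: RGenOInfty.measurableE.
rewrite setTI (_ : _ @^-1` _ = ~` [set w | Ystat w <= t]); last first.
  by apply/seteqP; split => w /=; rewrite in_itv/= andbT ltNge => /negP.
apply: measurableC; have [t1|t1] := leP 1 t.
  rewrite (_ : [set w | _] = setT) ?measurableT//; apply/seteqP; split => // w _ /=.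
  by have /andP[_ /le_trans] := Ystat_itv w; apply.
have [t0|t0] := leP 0 t; last first.
  rewrite (_ : [set w | _] = set0)//; apply/seteqP; split => // w /= wt.
  by have /andP[/le_trans/(_ wt)] := Ystat_itv w; rewrite leNgt t0.
have st : 0 <= Num.sqrt t < 1.
  by rewrite sqrtr_ge0/= -sqrtr1 ltr_sqrt.
rewrite (_ : [set w | _] = [set w | [set n | (k <= n)%N] (count X (eball (Num.sqrt t)) w)]).
  apply: FW_measurable_count; first exact: measurable_eball.
  by move=> x /le_trans; apply; case/andP: st => _ /ltW.
by apply/seteqP; split => w /=; rewrite -Ystat_le// sqr_sqrtr.
Qed.

Lemma sqrtF_Ystat phi w : sqrtF X k phi w = phi (Ystat w).
Proof. by rewrite /sqrtF /Ystat; case: ifP. Qed.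

Lemma Yk_Ystat w r : (k <= count X (eball r) w)%N ->
  Yk X k w = Ystat w /\ kth_in_ball X k w = ((k <= N w)%N)%:R :> R.
Proof.
move=> kr; have fA := finite_points_ball w.
have kib : (enorm (kth_closest k (X w)) <= 1) = (k <= N w)%N.
  exact: (kth_closest_le 1 fA k_gt0 kr).
rewrite /Yk /kth_in_ball kib; split=> //; rewrite /Ystat; case: ifPn => kN; last first.
  by rewrite mulr0 addr0.
rewrite mulr1 addrCA subrr addr0; congr (_ ^+ 2).
have x1 : enorm (kth_closest k (X w)) <= 1 by rewrite kib.
have [_ y1 _] := kth_pointsW kN.
(* With ties, the points selected in X and in its trace on W may differ; their norms agree because
   both are characterized by the counts of the balls of radius t <= 1. *)
have h t : t <= 1 -> (enorm (kth_closest k (X w)) <= t) =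
    (enorm (kth_closest k (X w `&` W)) <= t).
  move=> t1; rewrite (kth_closest_le t fA k_gt0 kr).
  rewrite (@kth_closest_le _ _ k _ 1 t (finite_pointsW_ball w))//.
    by rewrite npointsW_ball.
  by rewrite npointsW_ball1.
by apply/le_anti; rewrite h// lexx -h ?lexx.
Qed.

Lemma sum_obs (B : set 'rV[R]_d) w : B `<=` W ->
  (\sum_i (row i (obs X w) \in B) = count X B w)%N.
Proof.
move=> BW; rewrite [RHS](count_points PX)// -sum1_count -big_mkcond/=.
rewrite [RHS](big_nth 0) big_mkord; apply: eq_bigl => i.
suff -> : row i (obs X w) = nth 0 (points X w) i by [].
by apply/rowP => j; rewrite !mxE.
Qed.

Lemma sqrow_Ystat w : (k <= N w)%N ->
  [/\ exists i, dotp (row i (obs X w)) (row i (obs X w)) = Ystat w,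
      (\sum_i (dotp (row i (obs X w)) (row i (obs X w)) < Ystat w)%R < k)%N &
      (k <= \sum_i (dotp (row i (obs X w)) (row i (obs X w)) <= Ystat w)%R)%N].
Proof.
move=> kN; have [Ax x1 /andP[k1 k2]] := kth_pointsW kN.
rewrite /Ystat kN; set x := kth_closest _ _ in Ax x1 k1 k2 *.
split.
- have : x \in points X w by rewrite (mem_points PX) mem_set.
  move=> /(nthP 0)[i iN xE]; exists (Ordinal iN); rewrite sqr_enorm.
  suff -> : row (Ordinal iN) (obs X w) = x by [].
  by apply/rowP => j; rewrite !mxE -xE.
- rewrite (eq_bigr (fun i => (row i (obs X w) \in ltball (enorm x)) : nat)) => [|i _].
    rewrite sum_obs; last by move=> y /= /ltW /le_trans; apply.
    apply: leq_ltn_trans k1; rewrite /count -setIA (_ : W `&` _ = ltball (enorm x))//.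
    by apply: setIidr => y /ltW /le_trans; apply.
  congr nat_of_bool; apply/idP/idP; rewrite inE /ltball/= -sqr_enorm.
    by rewrite ltr_sqr ?nnegrE ?enorm_ge0.
  by rewrite ltr_sqr ?nnegrE ?enorm_ge0.
- rewrite (eq_bigr (fun i => (row i (obs X w) \in eball (enorm x)) : nat)) => [|i _].
    rewrite sum_obs; last by move=> y /= /le_trans; apply.
    by rewrite (leq_trans k2)// npointsW_ball.
  congr nat_of_bool; apply/idP/idP; rewrite inE /eball/= -sqr_enorm.
    by rewrite ler_sqr ?nnegrE ?enorm_ge0.
  by rewrite ler_sqr ?nnegrE ?enorm_ge0.
Qed.

(** From e^l >= l^(i+1) / (i+1)!. Any decay in l is enough for [ae_many_points]. *)
Lemma pois_le (l : R) i : 0 < l -> pois l i <= i.+1%:R / l.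
Proof.
move=> l0; have f0 n : 0 < n`!%:R :> R by rewrite ltr0n fact_gt0.
rewrite /pois expRN.
have e1 : l ^+ i.+1 / i.+1`!%:R <= expR l.
  by apply: le_trans (expR_ge1Dxn i (ltW l0)); rewrite lerDr.
have p0 : 0 < l ^+ i.+1 / i.+1`!%:R by rewrite divr_gt0// exprn_gt0.
apply: (@le_trans _ _ (l ^+ i / i`!%:R * (l ^+ i.+1 / i.+1`!%:R)^-1)).
  by rewrite ler_wpM2l ?lef_pV2 ?posrE ?expR_gt0// divr_ge0 ?exprn_ge0// ltW.
rewrite le_eqVlt; apply/orP; left; apply/eqP.
rewrite factS natrM exprS; move: (lt0r_neq0 (f0 i)) (lt0r_neq0 l0).
have : i.+1%:R != 0 :> R by rewrite pnatr_eq0.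
have : l ^+ i != 0 by rewrite expf_neq0// gt_eqF.
move: (l ^+ i) (i.+1%:R : R) (i`!%:R : R) => a b c a0 b0 c0 ln0.
by field; rewrite ?a0 ?b0 ?c0 ?ln0.
Qed.

Lemma pr_count_lt (B : set 'rV[R]_d) n : measurable B -> bounded_set B ->
  measurable [set w | (count X B w < n)%N] /\
  (P [set w | (count X B w < n)%N] <= (\sum_(i < n) pois (theta * volume B) i)%:E)%E.
Proof.
move=> mB bB; elim: n => [|n [mn IH]].
  by rewrite (_ : [set w | _] = set0) ?measure0 ?big_ord0//; apply/seteqP; split.
have E : [set w | (count X B w < n.+1)%N] =
    [set w | (count X B w < n)%N] `|` [set w | count X B w = n].
  apply/seteqP; split => w /=; first by rewrite ltnS leq_eqVlt => /orP[/eqP ->|]; [right|left].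
  by move=> [/ltnW|->].
have mc := measurable_countE PX n mB bB.
split; first by rewrite E; exact: measurableU.
rewrite E (le_trans (measureU2 _ mn mc))// big_ord_recr/= EFinD leeD//.
by rewrite (pr_count PX).
Qed.

Hypothesis d_gt0 : (0 < d)%N.

(** By [pois_le], the ball of radius q + 1 holds fewer than k points with probability at most k^2 /
    (theta |W| (q + 1)); here (q + 1)^d >= q + 1 because d > 0. *)
Lemma ae_many_points : {ae P, forall w, exists r, (k <= count X (eball r) w)%N}.
Proof.
have bB r : bounded_set (@eball R d r) by exact: (@bounded_eball _ _ r).
have a0 : 0 < theta * volume W by rewrite mulr_gt0// volume_unit_ball_gt0.
exists (\bigcap_q [set w | (count X (eball q.+1%:R) w < k)%N]); split.
- apply: bigcapT_measurable => q.
  by have [] := @pr_count_lt (eball q.+1%:R) k (@measurable_eball _ _ _) (bB _).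
- apply/eqP; rewrite eq_le measure_ge0 andbT; apply/lee_addgt0Pr => /= e e0.
  rewrite add0e.
  have [q qe] : exists q : nat, k%:R * k%:R / (theta * volume W * q.+1%:R) <= e.
    exists (Num.trunc (k%:R * k%:R / (theta * volume W) / e)).
    rewrite invfM mulrA ler_pdivrMr// mulrC -[leRHS]mulrC -ler_pdivrMr//.
    exact: (ltW (truncnS_gt _)).
  have [mq Pq] := @pr_count_lt (eball q.+1%:R) k (@measurable_eball _ _ _) (bB _).
  apply: (@le_trans _ _ (P [set w | (count X (eball q.+1%:R) w < k)%N])).
    apply: le_measure; rewrite ?inE//; last by move=> w; exact.
    apply: bigcapT_measurable => q'.
    by have [] := @pr_count_lt (eball q'.+1%:R) k (@measurable_eball _ _ _) (bB _).
  apply: (le_trans Pq); rewrite lee_fin; apply: le_trans qe.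
  apply: (@le_trans _ _ (\sum_(i < k) k%:R / (theta * volume W * q.+1%:R))); last first.
    by rewrite sumr_cst [leLHS]mulrC mulrA.
  apply: ler_sum => i _; rewrite volume_eball//.
  have qd : q.+1%:R <= q.+1%:R ^+ d :> R by rewrite ler_eXnr// ler1n.
  have l0 : 0 < theta * (q.+1%:R ^+ d * volume W).
    by rewrite mulr_gt0// mulr_gt0 ?exprn_gt0// volume_unit_ball_gt0.
  apply: (le_trans (pois_le i l0)); apply: ler_pM => //.
  - by rewrite invr_ge0 ltW.
  - by rewrite ler_nat.
  - rewrite lef_pV2 ?posrE ?mulr_gt0// ?volume_unit_ball_gt0//.
    by rewrite [leRHS]mulrCA [leLHS]mulrC ler_wpM2r// ltW.
- move=> w /= hw q _ /=; rewrite ltnNge; apply/negP => kq; apply: hw.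
  by exists q.+1%:R.
Qed.

Lemma bernoulli_le (e : R) n : 0 <= e <= 1 -> 1 - n%:R * e <= (1 - e) ^+ n.
Proof.
move=> /andP[e0 e1]; elim: n => [|n IH]; first by rewrite mul0r subr0 expr0.
rewrite exprS -natr1; have : 0 <= n%:R * e by rewrite mulr_ge0.
have : (1 - e) * (1 - n%:R * e) <= (1 - e) * (1 - e) ^+ n by rewrite ler_wpM2l// subr_ge0.
by move: (_ ^+ n) (n%:R : R) => x y; nra.
Qed.

Lemma measurable_unit_sphere : measurable (@unit_sphere R d).
Proof. exact: (@measurable_preimage_enorm R d [set 1]). Qed.

Lemma volume_unit_sphere : volume (@unit_sphere R d) = 0.
Proof.
apply/le_anti; rewrite volume_ge0 andbT; apply/ler_addgt0Pr => e e0; rewrite add0r.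
have w0 := @volume_unit_ball_gt0 R d.
have mS := measurable_unit_sphere.
have dW0 : 0 < d%:R * volume W by rewrite mulr_gt0 ?ltr0n.
(* The sphere and the ball of radius 1 - t are disjoint in W, so the sphere has volume at most (1 -
   (1 - t)^d) |W| <= d t |W|, which is at most [e] for this [t]. *)
pose t := Num.min 2^-1 (e / (d%:R * volume W)).
have t0 : 0 < t by rewrite lt_min invr_gt0 ltr0n divr_gt0.
have t1 : t <= 2^-1 by rewrite ge_min lexx.
have te : t * (d%:R * volume W) <= e by rewrite -ler_pdivlMr// ge_min lexx orbT.
have r0 : 0 < 1 - t by lra.
have SW : @unit_sphere R d `<=` eball 1 by move=> x /= h; rewrite /eball/= h.
have EW : @eball R d (1 - t) `<=` eball 1.
  by move=> x /le_trans; apply; rewrite gerBl ltW.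
have SE : @unit_sphere R d `&` eball (1 - t) = set0.
  apply/seteqP; split => // x [/= h]; rewrite /eball/= h; lra.
have := volumeD mS (measurable_eball (1 - t)) SW EW SE; rewrite volume_eball// => vD.
have : volume (@unit_sphere R d `|` eball (1 - t)) <= volume W.
  have mU : measurable (@unit_sphere R d `|` eball (1 - t)).
    by apply: measurableU => //; exact: measurable_eball.
  have UW : @unit_sphere R d `|` eball (1 - t) `<=` eball 1 by move=> x [/SW|/EW].
  rewrite -lee_fin (EFin_volume mU UW) (EFin_volume (@measurable_unit_ball R d) (r := 1))//.
  by apply: le_measure; rewrite ?inE//; exact: measurable_unit_ball.
have t01 : 0 <= t <= 1 by apply/andP; split; lra.
have := @bernoulli_le t d t01; rewrite vD.
have := w0; move: (volume W) te => v te v0; move: ((1 - t) ^+ d) => x; nra.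
Qed.

Lemma ae_sphere : {ae P, forall w, count X (@unit_sphere R d) w = 0%N}.
Proof.
have mS := measurable_unit_sphere.
have bS : bounded_set (@unit_sphere R d).
  by apply: (@bounded_eball _ _ 1) => x /= h; rewrite /eball/= h.
have m0 := measurable_countE PX 0 mS bS.
exists (~` [set w | count X (@unit_sphere R d) w = 0%N]); split => //.
  exact: measurableC.
rewrite probability_setC// (pr_count PX)// volume_unit_sphere mulr0 /pois.
by rewrite expr0 fact0 divr1 mul1r oppr0 expR0 subee.
Qed.

Lemma ae_Yk : {ae P, forall w, Yk X k w = Ystat w /\
  kth_in_ball X k w = ((k <= N w)%N)%:R :> R}.
Proof. by apply: filterS ae_many_points => w [r]; exact: Yk_Ystat. Qed.

End kth_norm.

(** * Moments of Poisson counts *)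

Section poisson_moments.
Context {R : realType} {disp : measure_display} {Omega : measurableType disp}.
Variable P : probability Omega R.

Lemma measurable_nat_law (D : set Omega) (K : Omega -> nat) (h : nat -> R) :
  measurable D -> (forall j, measurable (D `&` [set w | K w = j])) ->
  measurable_fun D (fun w => h (K w)).
Proof.
move=> mD mK _ B mB.
exact: (@measurable_preimage_countable_in _ _ _ D K (fun j => B (h j)) mK).
Qed.

Lemma integral_nat_law (D : set Omega) (K : Omega -> nat) (h : nat -> R) :
  measurable D -> (forall j, measurable (D `&` [set w | K w = j])) ->
  (forall j, 0 <= h j) ->
  (\int[P]_(w in D) (h (K w))%:E =
   \sum_(0 <= j <oo) (h j)%:E * P (D `&` [set w | K w = j]))%E.
Proof.
move=> mD mK h0; pose F j := D `&` [set w | K w = j].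
have DE : D = \bigcup_j F j.
  by apply/seteqP; split => [w Dw|w [j _ []]//]; exists (K w).
rewrite {1}DE ge0_integral_bigcup => //; last first.
- by apply/trivIsetP => i j _ _ /eqP ij; apply/seteqP; split => // w [[_ /= e] [_ /=]]; rewrite e => /ij.
- by move=> w _; rewrite lee_fin.
- by rewrite -DE; apply/measurable_EFinP; exact: measurable_nat_law.
apply: eq_eseriesr => j _; rewrite -(@integral_cst _ _ _ P (F j) (mK j) (h j)%:E).
by apply: eq_integral => w; rewrite inE => -[_ ->].
Qed.

Lemma pois_series (l : R) :
  (\sum_(0 <= j < n) pois l j) @[n --> \oo] --> (1 : R).
Proof.
rewrite (_ : (fun n => _) = fun n => series (exp_coeff l) n * expR (- l)).
  rewrite (_ : (1 : R) = expR l * expR (- l)); last by rewrite -expRD subrr expR0.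
  by apply: cvgM; [exact: is_cvg_series_exp_coeff|exact: cvg_cst].
by apply/funext => n; rewrite /series/= mulr_suml.
Qed.

(** Falling factorials merely shift the index of the Poisson weights. Factorial moments are thus
    immediate, and give the mean and the variance. *)
Lemma pois_ffact (l : R) m j : ((j + m) ^_ m)%:R * pois l (j + m) = l ^+ m * pois l j.
Proof.
rewrite /pois exprD; have fm := @ffact_fact (j + m) m (leq_addl _ _).
rewrite addnK in fm; rewrite -fm natrM.
have f0 : j`!%:R != 0 :> R by rewrite pnatr_eq0 -lt0n fact_gt0.
have g0 : ((j + m) ^_ m)%:R != 0 :> R by rewrite pnatr_eq0 -lt0n ffact_gt0 leq_addl.
move: (j`!%:R : R) (((j + m) ^_ m)%:R : R) f0 g0 => a b a0 b0.
by field; rewrite a0 b0.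
Qed.

Lemma pois_factorial_moment (l : R) m : 0 <= l ->
  (\sum_(0 <= j <oo) ((j ^_ m)%:R * pois l j)%:E = (l ^+ m)%:E)%E.
Proof.
move=> l0; apply/cvg_lim => //.
rewrite -(cvg_shiftn m)/=.
rewrite (_ : (fun n => _) = fun n => ((l ^+ m * \sum_(0 <= j < n) pois l j)%:E)).
  apply: cvg_EFin; first by near=> n.
  rewrite -[X in _ --> X]mulr1; apply: cvgM; [exact: cvg_cst|exact: pois_series].
apply/funext => n; rewrite sumEFin; congr EFin.
rewrite addnC (big_cat_nat _ (n := m))//= ?leq_addr// big_nat big1 => [|j /andP[_ jm]].
  rewrite add0r -{1}[m]add0n big_addn addnC addnK mulr_sumr.
  by apply: eq_bigr => j _; exact: pois_ffact.
by rewrite ffact_small// mul0r.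
Unshelve. all: by end_near. Qed.

(** The hypothesis says that [K] is Poisson and independent of [D], with c = P(D). It is used for
    [D] the whole space, and for [D] prescribing the count of a ball while [K] counts the
    annulus. *)
Lemma integral_poisson (D : set Omega) (K : Omega -> nat) (c l : R) m :
  measurable D -> (forall j, measurable (D `&` [set w | K w = j])) -> 0 <= l ->
  (forall j, P (D `&` [set w | K w = j]) = (c * pois l j)%:E) ->
  (\int[P]_(w in D) ((K w ^_ m)%:R)%:E = (c * l ^+ m)%:E)%E.
Proof.
move=> mD mK l0 PK; have c0 : 0 <= c.
  have : (0 <= (c * pois l 0)%:E)%E by rewrite -PK.
  by rewrite lee_fin /pois expr0 fact0 divr1 mul1r pmulr_lge0 ?expR_gt0.
rewrite (@integral_nat_law _ _ (fun j => (j ^_ m)%:R))//.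
under eq_eseriesr do rewrite PK -EFinM mulrCA EFinM.
rewrite nneseriesZl; last by move=> j _; rewrite lee_fin mulr_ge0// pois_ge0.
by rewrite pois_factorial_moment.
Qed.

End poisson_moments.

Section poisson_counts.
Context {R : realType} {d : nat}.
Context {disp : measure_display} {Omega : measurableType disp}.
Variables (P : probability Omega R) (X : Omega -> set 'rV[R]_d) (theta : R).
Hypotheses (theta_gt0 : 0 < theta) (PX : poisson_process P X theta).
Local Notation W := (@unit_ball R d).
Local Notation N := (count X W).
Local Notation a := (theta * volume W).
Local Notation integrable Z := (P.-integrable setT (EFin \o Z)).

Lemma mean_ge0 : 0 <= a.
Proof. by rewrite mulr_ge0// ?volume_ge0// ltW. Qed.

Lemma measurable_N (h : nat -> R) : measurable_fun setT (fun w => h (N w)).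
Proof.
apply: (@measurable_nat_law _ _ _ setT N h) => // j; rewrite setTI.
exact: (measurable_event PX).
Qed.

Lemma integral_N_ffact m : (\int[P]_w ((N w ^_ m)%:R)%:E = (a ^+ m)%:E)%E.
Proof.
rewrite (@integral_poisson _ _ _ P setT N 1 a m) ?mul1r//.
- by move=> j; rewrite setTI; exact: (measurable_event PX).
- exact: mean_ge0.
- move=> j; rewrite setTI mul1r (pr_count PX)//; first exact: measurable_unit_ball.
  exact: bounded_unit_ball.
Qed.

Lemma integrable_N_ffact m : integrable (fun w => (N w ^_ m)%:R : R).
Proof.
apply/integrableP; split.
  apply/measurable_EFinP; exact: (measurable_N (fun n => (n ^_ m)%:R)).
under eq_integral do rewrite /= ger0_norm//.
by rewrite integral_N_ffact ltry.
Qed.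

Lemma sqrN_ffact w : (N w)%:R ^+ 2 = (N w ^_ 2)%:R + (N w ^_ 1)%:R :> R.
Proof.
rewrite -natrX -natrD; congr (_%:R); rewrite ffactn1.
by case: (N w) => // n; rewrite !ffactnS ffactn0; lia.
Qed.

Lemma integrableD_EFin (Z Z' : Omega -> R) : integrable Z -> integrable Z' ->
  integrable (fun w => Z w + Z' w).
Proof. by move=> iZ iZ'; have := integrableD measurableT iZ iZ'. Qed.

Lemma integrable_sqrN : integrable (fun w => (N w)%:R ^+ 2 : R).
Proof.
rewrite (_ : (fun _ => _) = fun w => (N w ^_ 2)%:R + (N w ^_ 1)%:R).
  by apply: integrableD_EFin; exact: integrable_N_ffact.
by apply/funext => w; rewrite sqrN_ffact.
Qed.

Lemma integrable_dom (Z : Omega -> R) (C : R) : measurable_fun setT Z ->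
  (forall w, `|Z w| <= C * (1 + (N w)%:R ^+ 2)) -> integrable Z.
Proof.
move=> mZ ZC; have i1 : integrable (fun w => (N w ^_ 0)%:R : R) := integrable_N_ffact 0.
have /(integrableZl measurableT C) iC := integrableD measurableT i1 integrable_sqrN.
apply: (le_integrable measurableT _ _ iC); first exact/measurable_EFinP.
move=> w _ /=; rewrite ffactn0 lee_fin (le_trans (ZC w))// ler_norm//.
Qed.

Lemma E_N : \int[P]_w (N w)%:R = a.
Proof.
have := integral_N_ffact 1; under eq_integral do rewrite ffactn1.
by rewrite /Rintegral => ->.
Qed.

Lemma N_le_sqr w : (N w)%:R <= 1 + (N w)%:R ^+ 2 :> R.
Proof. by move: (N w)%:R => x; have := sqr_ge0 (x - 2^-1); nra. Qed.

Lemma integrable_N : integrable (fun w => (N w)%:R : R).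
Proof.
apply: (@integrable_dom _ 1); first exact: (measurable_N (fun n => n%:R)).
by move=> w; rewrite mul1r ger0_norm// N_le_sqr.
Qed.

Lemma integrable_centered : integrable (fun w => (N w)%:R - a).
Proof.
apply: (@integrable_dom _ (1 + a)); first exact: (measurable_N (fun n => n%:R - a)).
move=> w; have := N_le_sqr w; have := mean_ge0; have : 0 <= (N w)%:R :> R by [].
by rewrite ler_norml; move: (N w)%:R => x *; apply/andP; split; nra.
Qed.

Lemma integrable_centered_sqr : integrable (fun w => ((N w)%:R - a) ^+ 2).
Proof.
apply: (@integrable_dom _ (2 + 2 * a ^+ 2)).
  exact: (measurable_N (fun n => (n%:R - a) ^+ 2)).
move=> w; rewrite ger0_norm ?sqr_ge0//; have := N_le_sqr w; have := mean_ge0.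
have := sqr_ge0 ((N w)%:R + a); have : 0 <= (a * (N w)%:R) ^+ 2 by rewrite sqr_ge0.
by move: (N w)%:R => x *; nra.
Qed.

Lemma Rintegral_cst1 (c : R) : \int[P]_w c = c.
Proof. rewrite Rintegral_cst// -[RHS]mulr1; congr (_ * _).
by have -> : fine (P setT) = 1 by rewrite probability_setT. Qed.

Lemma integrable_cst1 (c : R) : integrable (fun=> c).
Proof.
apply: (@integrable_dom _ `|c|) => // w.
by rewrite ler_peMr// lerDl sqr_ge0.
Qed.

Lemma E_centered : \int[P]_w ((N w)%:R - a) = 0.
Proof.
rewrite RintegralB//; [|exact: integrable_N|exact: integrable_cst1].
by rewrite E_N Rintegral_cst1 subrr.
Qed.

Lemma E_centered_sqr : \int[P]_w (((N w)%:R - a) ^+ 2) = a.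
Proof.
have h : \int[P]_w (((N w)%:R - a) ^+ 2 + 2 * a * (N w)%:R) =
    \int[P]_w ((N w ^_ 2)%:R + ((N w)%:R + a ^+ 2)).
  by apply: eq_Rintegral => w _; have := sqrN_ffact w; rewrite ffactn1; lra.
move: h; rewrite !RintegralD//.
- rewrite RintegralZl// ?E_N ?Rintegral_cst1; last exact: integrable_N.
  by rewrite {2}/Rintegral integral_N_ffact/=; lra.
- exact: integrable_N.
- exact: integrable_cst1.
- exact: integrable_N_ffact.
- by apply: integrableD_EFin; [exact: integrable_N|exact: integrable_cst1].
- exact: integrable_centered_sqr.
- have := integrableZl measurableT (2 * a) integrable_N; exact.
Qed.

Variable r : R.
Hypothesis r01 : 0 <= r <= 1.
Local Notation B := (@eball R d r).
Local Notation M := (count X B).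
Local Notation lam := (theta * volume B).

Lemma eball_sub : B `<=` W.
Proof. by move=> x /le_trans; apply; case/andP: r01. Qed.

Lemma annulus_volume : theta * volume (W `\` B) = a - lam.
Proof.
have mB := @measurable_eball R d r; have mW := @measurable_unit_ball R d.
have := @volumeD R d 1 B (W `\` B) mB (measurableD mW mB) eball_sub (@subDsetl _ _ _).
rewrite setDE setICA setICr setI0 => /(_ erefl).
rewrite -setDE -[X in volume X]/(B `|` (W `\` B)) setDUK; last exact: eball_sub.
by move=> ->; ring.
Qed.

Lemma pr_ball_annulus i j : P ([set w | M w = i] `&` [set w | count X (W `\` B) w = j]) =
  (pois lam i * pois (a - lam) j)%:E.
Proof.
pose C (b : bool) := if b then B else W `\` B.
pose K (b : bool) := if b then i else j.
have := @pr_counts R d disp Omega P X theta PX bool C K.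
rewrite big_bool/= annulus_volume => <-.
- congr (P _); apply/seteqP; split => w /=; first by move=> [? ?] [].
  by move=> h; split; [exact: (h true)|exact: (h false)].
- case; first exact: measurable_eball.
  by apply: measurableD; [exact: measurable_unit_ball|exact: measurable_eball].
- case; apply: bounded_subW; first exact: eball_sub.
  exact: subDsetl.
- apply/trivIsetP => -[] [] _ _ //= _; rewrite /C.
    by rewrite setDE setICA setICr setI0.
  by rewrite setIC setDE setICA setICr setI0.
Qed.

Lemma measurable_M i : measurable [set w | M w = i].
Proof.
apply: (measurable_countE PX); first exact: measurable_eball.
by apply: bounded_subW; exact: eball_sub.
Qed.

Lemma integrable_sub (D : set Omega) (Z : Omega -> R) : measurable D ->
  integrable Z -> P.-integrable D (EFin \o Z).
Proof. by move=> mD; exact: integrableS. Qed.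

(** On {M = i}, N is i plus the count of the annulus, which is independent of M and has mean a -
    lam. *)
Lemma E_centered_ball i : \int[P]_(w in [set w | M w = i]) ((N w)%:R - a) =
  (i%:R - lam) * pois lam i.
Proof.
have mD := measurable_M i; set D := [set w | M w = i] in mD *.
have mA j : measurable [set w | count X (W `\` B) w = j].
  apply: (measurable_countE PX); last by apply: bounded_subW; exact: subDsetl.
  by apply: measurableD; [exact: measurable_unit_ball|exact: measurable_eball].
have PD : fine (P D) = pois lam i.
  by rewrite (pr_count PX)//; [exact: measurable_eball|apply: bounded_subW; exact: eball_sub].
have NE w : D w -> (N w)%:R = i%:R + (count X (W `\` B) w)%:R :> R.
  move=> Dw; rewrite -natrD -Dw -(countD PX).
  - by rewrite setDUK//; exact: eball_sub.
  - by apply: bounded_subW; exact: eball_sub.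
  - by apply: bounded_subW; exact: subDsetl.
  - by rewrite setDE setICA setICr setI0.
transitivity (\int[P]_(w in D) (N w)%:R - \int[P]_(w in D) a).
  rewrite RintegralB//; apply: integrable_sub => //; first exact: integrable_N.
  exact: integrable_cst1.
rewrite Rintegral_cst// PD.
have iA : \int[P]_(w in D) (count X (W `\` B) w)%:R = pois lam i * (a - lam).
  have := @integral_poisson _ _ _ P D (count X (W `\` B)) (pois lam i) (a - lam) 1 mD.
  under eq_integral do rewrite ffactn1.
  rewrite /Rintegral => ->//.
  - by move=> j; apply: measurableI.
  - by rewrite -annulus_volume mulr_ge0 ?volume_ge0// ltW.
  - by move=> j; rewrite pr_ball_annulus.
have -> : \int[P]_(w in D) (N w)%:R = i%:R * pois lam i + pois lam i * (a - lam).
  rewrite -iA -PD -Rintegral_cst// -RintegralD//.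
  - by apply: eq_Rintegral => w; rewrite inE; exact: NE.
  - by apply: integrable_sub => //; exact: integrable_cst1.
  - apply: (le_integrable mD _ _ (integrable_sub mD integrable_N)).
      apply/measurable_EFinP; apply: (@measurable_nat_law _ _ _ D _ (fun j => j%:R : R)) => // j.
      exact: measurableI.
    move=> w Dw /=; rewrite lee_fin !ger0_norm// ler_nat.
    by apply: (le_count PX); [exact: bounded_unit_ball|exact: subDsetl].
ring.
Qed.

Lemma pois_mul (l : R) k : k.+1%:R * pois l k.+1 = l * pois l k.
Proof.
rewrite /pois factS exprS natrM.
have : k.+1%:R != 0 :> R by rewrite pnatr_eq0.
have : k`!%:R != 0 :> R by rewrite pnatr_eq0 -lt0n fact_gt0.
by move: (k`!%:R : R) (k.+1%:R : R) => x y x0 y0; field; rewrite x0 y0.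
Qed.

Lemma measurable_Mlt k : measurable [set w | (M w < k)%N].
Proof.
exact: (@measurable_preimage_countable _ _ _ M (fun j => (j < k)%N) measurable_M).
Qed.

(** By [pois_mul], (i - lam) pois(i) = lam (pois(i-1) - pois(i)), and the sum telescopes. *)
Lemma E_centered_lt k :
  \int[P]_(w in [set w | (M w < k.+1)%N]) ((N w)%:R - a) = - (lam * pois lam k).
Proof.
elim: k => [|k IH].
  rewrite (_ : [set w | _] = [set w | M w = 0%N]).
    by rewrite E_centered_ball sub0r mulNr.
  by apply/seteqP; split => w /=; [case: (M w)|move=> ->].
rewrite (_ : [set w | _] = [set w | (M w < k.+1)%N] `|` [set w | M w = k.+1]).
  rewrite Rintegral_setU//; first last.
  - apply/disj_setPS => w [/= h1 h2]; by rewrite h2 ltnn in h1.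
  - apply: integrable_sub integrable_centered.
    by apply: measurableU; [exact: measurable_Mlt|exact: measurable_M].
  - exact: measurable_M.
  - exact: measurable_Mlt.
  by rewrite IH E_centered_ball mulrBl pois_mul; ring.
apply/seteqP; split => w /=; first by rewrite ltnS leq_eqVlt => /orP[/eqP ->|]; [right|left].
by move=> [/ltnW|->].
Qed.

(** The complement of the previous event, N - a being centred. Here k < M means M >= k + 1, so the
    order of the statistic is k + 1. *)
Lemma E_centered_ge k :
  \int[P]_(w in [set w | (k < M w)%N]) ((N w)%:R - a) = lam * pois lam k.
Proof.
have mC := measurable_Mlt k.+1.
have E : [set w | (k < M w)%N] = ~` [set w | (M w < k.+1)%N].
  by apply/seteqP; split => w /=; rewrite ltnS leqNgt => /negP; rewrite ?negbK.
have := @Rintegral_setU _ _ _ P _ _ (fun w => (N w)%:R - a) mC (measurableC mC).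
rewrite setUv E_centered E_centered_lt -E => h.
have : 0 = - (lam * pois lam k) + \int[P]_(w in [set w | (k < M w)%N]) ((N w)%:R - a).
  by apply: h; [exact: integrable_centered|apply/disj_setPS; rewrite E => w []].
by lra.
Qed.

Lemma pr_M_lt k : P [set w | (M w < k)%N] = (\sum_(i < k) pois lam i)%:E.
Proof.
elim: k => [|k IH].
  by rewrite (_ : [set w | _] = set0) ?measure0 ?big_ord0//; apply/seteqP; split.
rewrite (_ : [set w | _] = [set w | (M w < k)%N] `|` [set w | M w = k]).
  transitivity (P [set w | (M w < k)%N] + P [set w | M w = k])%E.
    apply: measureU; [exact: measurable_Mlt|exact: measurable_M|].
    by apply/seteqP; split => // w [/= h1 h2]; rewrite h2 ltnn in h1.
  rewrite IH big_ord_recr/= EFinD (pr_count PX)//; first exact: measurable_eball.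
  by apply: bounded_subW; exact: eball_sub.
apply/seteqP; split => w /=; first by rewrite ltnS leq_eqVlt => /orP[/eqP ->|]; [right|left].
by move=> [/ltnW|->].
Qed.

End poisson_counts.

Section soft_counts.
Context {R : realType} {n d : nat}.
Implicit Types (M : 'M[R]_(n, d)) (s t u : R).

Lemma soft_count_homo l M : {homo soft_count l M : s t / s <= t}.
Proof.
move=> s t st; apply: ler_sum => i _; apply: sstep_homo.
by rewrite ler_wpM2l// lerD2r.
Qed.

Lemma soft_count_le l M t : soft_count l M t <= (\sum_i (sqrow M i < t)%R)%:R.
Proof.
rewrite natr_sum; apply: ler_sum => i _; case: ltP => h.
  by case/andP: (sstep_itv (l.+1%:R * (t - sqrow M i))).
by rewrite sstep_le0// mulr_ge0_le0// subr_le0.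
Qed.

Lemma soft_count_ge l M u t : u + l.+1%:R^-1 <= t ->
  (\sum_i (sqrow M i <= u)%R)%:R <= soft_count l M t.
Proof.
move=> ut; rewrite natr_sum; apply: ler_sum => i _; case: (leP (sqrow M i) u) => h.
  rewrite sstep_ge1// mulrC -ler_pdivrMr// div1r.
  by move: ut; move: (l.+1%:R^-1) => y ut; lra.
by case/andP: (sstep_itv (l.+1%:R * (t - sqrow M i))).
Qed.

Lemma sqrow_gap M s : exists2 gap : R, 0 < gap & forall i, sqrow M i != s ->
  gap <= `|sqrow M i - s|.
Proof.
exists (\big[Num.min/1]_(i | sqrow M i != s) `|sqrow M i - s|).
  by apply: lt_bigmin => // i; rewrite normr_gt0 subr_eq0.
by move=> i si; exact: bigmin_le_cond.
Qed.

(** Just above [s], within the gap to the other squared norms, closer points count fully, farther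
    ones not at all, and the tied ones all for the same fraction. *)
Lemma soft_count_split M (s gap : R) : (forall i, sqrow M i != s -> gap <= `|sqrow M i - s|) ->
  forall l t, l.+1%:R^-1 <= gap -> s < t < s + l.+1%:R^-1 ->
  soft_count l M t = (\sum_i (sqrow M i < s)%R)%:R +
    (\sum_i (sqrow M i == s))%:R * sstep (l.+1%:R * (t - s)).
Proof.
move=> hgap l t lgap /andP[st ts]; rewrite !natr_sum mulr_suml -big_split/=.
apply: eq_bigr => i _; case: (ltgtP (sqrow M i) s) => [h|h|->]; last by rewrite mul1r add0r.
- have := hgap i; rewrite lt_eqF// => /(_ isT); rewrite ltr0_norm ?subr_lt0// => g.
  have -> : sstep (l.+1%:R * (t - sqrow M i)) = 1.
    apply: sstep_ge1; rewrite mulrC -ler_pdivrMr// div1r.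
    by move: lgap; move: (l.+1%:R^-1) => y lgap; lra.
  by rewrite mul0r addr0.
- have := hgap i; rewrite gt_eqF// => /(_ isT); rewrite gtr0_norm ?subr_gt0// => g.
  have -> : sstep (l.+1%:R * (t - sqrow M i)) = 0.
    apply: sstep_le0; rewrite mulr_ge0_le0//.
    by move: lgap ts; move: (l.+1%:R^-1) => y lgap ts; lra.
  by rewrite mul0r addr0.
Qed.

End soft_counts.

(** * Functions of the order statistic in the closure *)

Section closure.
Context {R : realType} {d : nat}.
Context {disp : measure_display} {Omega : measurableType disp}.
Variables (P : probability Omega R) (X : Omega -> set 'rV[R]_d) (theta : R).
Hypotheses (theta_gt0 : 0 < theta) (PX : poisson_process P X theta).
Variable V : 'I_d -> 'rV[R]_d -> R.
Hypotheses (d_gt0 : (0 < d)%N) (oV : orthonormal_bounded V).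
Variables (k : nat) (psi psi1 : R -> R).
Hypotheses (k_gt0 : (0 < k)%N) (C1psi : C1_01 psi psi1).
Local Notation W := (@unit_ball R d).
Local Notation G := (g_sigma_algebraType (FW_gen X)).
Local Notation N := (count X W).
Local Notation Y := (Ystat X k).
Local Notation F_ l := (approx_form psi k l : forms).

Lemma sum_true_le (I : finType) (b : I -> bool) : (\sum_i b i <= #|I|)%N.
Proof. by rewrite -sum1_card; apply: leq_sum => i _; case: (b i). Qed.

Lemma count_lt_Ystat w : (\sum_i (sqrow (obs X w) i < Y w)%R < k)%N.
Proof.
case: (leqP k (N w)) => kN; first by have [_ h _] := sqrow_Ystat PX k_gt0 kN.
by apply: leq_ltn_trans kN; apply: leq_trans (sum_true_le _) _; rewrite card_ord.
Qed.

(** Uniform over all configurations: the outer step rises from 0 to 1 between Y and Y + 1/(l+1),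
    whatever the points and their ties, so [abel_close] applies with this width. *)
Lemma functional_approx_close (e : R) : 0 < e ->
  \forall l \near \oo, forall w, `|functional X (F_ l) w - psi (Y w)| <= e.
Proof.
move=> e0; have [cpsi _ _] := C1psi.
have [dl dl0 hdl] := unif_cont01 cpsi e0.
have dl2 : 0 < dl / 2 by rewrite divr_gt0.
near=> l; move=> w.
have ll : l.+1%:R^-1 <= dl / 2.
  by apply: ltW; near: l; exact: (near_infty_natSinv_lt (PosNum dl2)).
pose p q := sstep (soft_count l (obs X w) (grid l q) - k.-1%:R).
have Y01 := Ystat_itv PX k_gt0 w.
apply: (@abel_close R (l.+1 ^ 3) psi p (Y w) l.+1%:R^-1 e) => //.
- by move=> q; exact: sstep_itv.
- move=> q; apply: sstep_homo; rewrite lerD2r; apply: soft_count_homo.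
  by rewrite gridS lerDl invr_ge0.
- move=> q qN qY; apply: sstep_le0; rewrite subr_le0.
  apply: (le_trans (soft_count_le _ _ _)); rewrite ler_nat -ltnS prednK//.
  apply: leq_ltn_trans (count_lt_Ystat w); apply: leq_sum => i _.
  by case: ltP => // h; rewrite (lt_trans h qY).
- move=> q qN qY; apply: sstep_ge1.
  (* With fewer than [k] points in W, Y = 1 and no grid level reaches Y + 1/(l+1). *)
  have [kN|kN] := leqP k (N w); last first.
    have /andP[_ g1] := @grid_itv R l q qN.
    move: qY; rewrite /Ystat leqNgt kN/= => qY; exfalso.
    have : 0 < l.+1%:R^-1 :> R by rewrite invr_gt0.
    by move: qY g1; rewrite /grid; move: (q%:R / _) (_^-1) => *; lra.
  have [_ _ h] := sqrow_Ystat PX k_gt0 kN.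
  have : k%:R <= soft_count l (obs X w) (grid l q).
    by apply: le_trans (soft_count_ge _ qY); rewrite ler_nat.
  by rewrite -[X in X%:R <= _](prednK k_gt0) -natr1; lra.
- move=> t t01 tY; apply: hdl => //; apply: (le_trans tY).
  have : (l.+1 ^ 3)%:R^-1 <= l.+1%:R^-1 :> R.
    by rewrite lef_pV2 ?posrE ?grid_gt0// ler_nat -[X in (X <= _)%N]expn1 leq_pexp2l.
  by move=> h3; rewrite [leRHS]splitr lerD// (le_trans h3).
Unshelve. all: by end_near. Qed.

Lemma FW_measurable_Ystat_comp (g : R -> R) : {within `[0, 1], continuous g} ->
  measurable_fun setT ((fun w => g (Y w)) : G -> R).
Proof.
move=> cg; have mg : measurable_fun (`[0, 1]%classic : set (measurableTypeR R)) g.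
  exact: subspace_continuous_measurable_fun.
apply: (measurable_comp _ _ mg (FW_measurable_Ystat PX k_gt0)) => //.
by move=> _ [w _ <-] /=; rewrite in_itv/=; exact: (Ystat_itv PX).
Qed.

Lemma E_sqr_bound (Z : Omega -> R) (C : R) : measurable_fun setT Z ->
  (forall w, `|Z w| <= C) -> ('E_P[fun w => (Z w ^+ 2)%R] <= (C ^+ 2)%:E)%E.
Proof.
move=> mZ ZC; rewrite unlock.
apply: (@le_trans _ _ (\int[P]_w (C ^+ 2)%:E)%E); last first.
  by rewrite integral_cst// [X in (_ * X)%E](_ : _ = 1%E) ?mule1//; exact: probability_setT.
apply: ge0_le_integral => //.
- by move=> w _; rewrite lee_fin sqr_ge0.
- by apply/measurable_EFinP; exact: measurable_funX.
- move=> w _; rewrite lee_fin -real_normK ?num_real//.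
  by rewrite ler_sqr ?nnegrE// (le_trans _ (ZC w)).
Qed.

Lemma in_L2_Ystat (g : R -> R) : {within `[0, 1], continuous g} ->
  in_L2 P X (fun w => g (Y w)).
Proof.
move=> cg; have mg := FW_measurable_Ystat_comp cg; split=> //.
have [B B0 hB] := C1_01_bound cg.
apply: le_lt_trans (@E_sqr_bound _ B _ _) (ltry _).
  exact: (FW_measurable_fun PX).
by move=> w; apply: hB; exact: (Ystat_itv PX).
Qed.

Lemma measurable_functional_approx l : measurable_fun setT (functional X (F_ l)).
Proof.
apply: (measurable_functional PX); first exact: approx_form_symmetric.
move=> n M _; exact: (has_grad_continuous (@has_grad_approx_form R d psi k l n)).
Qed.

Lemma functional_approx_L2 : cvg_L2 P (fun l => functional X (F_ l)) (fun w => psi (Y w)).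
Proof.
have [cpsi _ _] := C1psi.
apply/cvge0_near => [l|e e0].
  by apply: expectation_ge0 => w; exact: sqr_ge0.
have se0 : 0 < Num.sqrt e by rewrite sqrtr_gt0.
have := functional_approx_close se0; apply: filterS => l hl.
rewrite -(sqr_sqrtr (ltW e0)); apply: E_sqr_bound => //.
apply: measurable_funB; first exact: measurable_functional_approx.
by apply: (FW_measurable_fun PX); exact: FW_measurable_Ystat_comp.
Qed.

End closure.

(** * Convergence of the gradients *)

Section gradient_closure.
Context {R : realType} {d : nat}.
Context {disp : measure_display} {Omega : measurableType disp}.
Variables (P : probability Omega R) (X : Omega -> set 'rV[R]_d) (theta : R).
Hypotheses (theta_gt0 : 0 < theta) (PX : poisson_process P X theta).
Variable V : 'I_d -> 'rV[R]_d -> R.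
Hypotheses (d_gt0 : (0 < d)%N) (oV : orthonormal_bounded V).
Variables (k : nat) (psi psi1 : R -> R).
Hypotheses (k_gt0 : (0 < k)%N) (C1psi : C1_01 psi psi1).
Local Notation W := (@unit_ball R d).
Local Notation G := (g_sigma_algebraType (FW_gen X)).
Local Notation N := (count X W).
Local Notation Y := (Ystat X k).
Local Notation F_ l := (approx_form psi k l : forms).

Definition no_sphere w := count X (@unit_sphere R d) w = 0%N.

Lemma row_obs_ball w i : unit_ball (row i (obs X w)).
Proof.
have -> : row i (obs X w) = nth 0 (points X w) i by apply/rowP => j; rewrite !mxE.
by apply: (points_ball PX (w := w)); rewrite mem_nth.
Qed.

Lemma sqrow_le1 w i : sqrow (obs X w) i <= 1.
Proof.
have := row_obs_ball i; rewrite /unit_ball/= /enorm -[X in _ <= X]sqrtr1.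
by rewrite ler_sqrt// dotp_ge0.
Qed.

Lemma sqrow_lt1 w i : no_sphere w -> sqrow (obs X w) i < 1.
Proof.
move=> w0; rewrite lt_neqAle sqrow_le1 andbT; apply/eqP => s1.
have SW : @unit_sphere R d `<=` W by move=> x h; rewrite /unit_ball/= h.
have := sum_obs PX w SW; rewrite w0 => /eqP; rewrite sum_nat_eq0 => /forallP/(_ i)/=.
rewrite eqb0 => /negP; apply; rewrite inE /unit_sphere/= /enorm.
by rewrite -/(sqrow (obs X w) i) s1 sqrtr1.
Qed.

Lemma sum_le_lt n (M : 'M[R]_(n, d)) s : (\sum_i (sqrow M i < s)%R +
  \sum_i (sqrow M i == s) = \sum_i (sqrow M i <= s)%R)%N.
Proof. by rewrite -big_split/=; apply: eq_bigr => i _; case: ltgtP. Qed.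

(** The rank condition of [gamma_cvg] singles out the k-th smallest squared norm. Off the sphere s <
    1, so [s] cannot be mistaken for the value 1 given to Y when N < k. *)
Lemma rank_Ystat w i : no_sphere w ->
  let s := sqrow (obs X w) i in
  (\sum_j (sqrow (obs X w) j < s)%R <= k.-1 <
   \sum_j (sqrow (obs X w) j < s)%R + \sum_j (sqrow (obs X w) j == s))%N = (s == Y w).
Proof.
move=> w0 s; rewrite sum_le_lt; set M := obs X w in s *.
have s1 : s < 1 by exact: sqrow_lt1.
have [kN|kN] := leqP k (N w); last first.
  have -> : (s == Y w) = false by rewrite /Ystat leqNgt kN lt_eqF.
  apply/negbTE; rewrite negb_and -leqNgt; apply/orP; right.
  rewrite -ltnS prednK// (leq_ltn_trans _ kN)//.
  by rewrite (leq_trans (sum_true_le _))// card_ord.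
have [_ h1 h2] := sqrow_Ystat PX k_gt0 kN.
case: (ltgtP s (Y w)) => sY.
- apply/negbTE; rewrite negb_and -leqNgt; apply/orP; right.
  rewrite -ltnS prednK//; apply: leq_ltn_trans h1; apply: leq_sum => j _.
  by case: (leP (sqrow M j) s) => // h; rewrite (le_lt_trans h sY).
- apply/negbTE; rewrite negb_and -ltnNge; apply/orP; left.
  rewrite prednK//; apply: leq_trans h2 _; apply: leq_sum => j _.
  by rewrite -/(sqrow M j); case: (leP (sqrow M j) (Y w)) => // h; rewrite (le_lt_trans h sY).
- by rewrite sY -ltnS prednK// h1.
Qed.

Definition nties w : nat := (\sum_j (sqrow (obs X w) j == Y w))%N.

Definition lim_weight w i : R :=
  psi1 (Y w) * ((sqrow (obs X w) i == Y w)%:R / (nties w)%:R).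

Lemma weight_cvg w i : no_sphere w ->
  approx_weight psi k l (obs X w) i @[l --> \oo] --> lim_weight i.
Proof.
move=> w0; set s := sqrow (obs X w) i.
have s0 : 0 <= s < 1 by rewrite sqrow_lt1// andbT dotp_ge0.
have [gap gap0 hgap] := sqrow_gap (obs X w) s.
pose j := (\sum_j (sqrow (obs X w) j == s))%N.
have j0 : (0 < j)%N by rewrite /j (bigD1 i)//= eqxx.
have := gamma_cvg C1psi j0 s0 gap0 (soft_count_split hgap).
have /= hr := rank_Ystat i w0; rewrite -/s -/j in hr.
move=> /(_ k); rewrite hr => h; rewrite /approx_weight.
have -> : lim_weight i = psi1 s * ((s == Y w)%:R / j%:R); last exact: h.
rewrite /lim_weight -/s /nties; case: eqP => [e|]; first by rewrite -e.
by rewrite !mul0r !mulr0.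
Qed.

Lemma lim_weight_bound (B : R) : (forall t : R, 0 <= t <= 1 -> `|psi1 t| <= B) ->
  forall w (i : 'I_(N w)), `|lim_weight i| <= B.
Proof.
move=> hB w i; rewrite normrM -[leRHS]mulr1 ler_pM//; first by apply: hB; exact: (Ystat_itv PX).
rewrite ger0_norm ?divr_ge0//; have [->|n0] := eqVneq (nties w) 0%N.
  by rewrite invr0 mulr0.
by rewrite ler_pdivrMr ?ltr0n ?lt0n// mul1r; case: eqP => _; rewrite ler_nat// lt0n.
Qed.

Lemma entry_obs w i m : `|obs X w i m| <= 1.
Proof.
have := entry_le_enorm (row i (obs X w)) m; rewrite [row _ _ _ _]mxE => /le_trans; apply.
exact: row_obs_ball.
Qed.

Lemma sum_obs_bound w (c : 'I_(N w) -> R) (C : R) : (forall i, `|c i| <= C) ->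
  `|\sum_i c i| <= C * (N w)%:R.
Proof.
move=> hc; rewrite (le_trans (ler_norm_sum _ _ _))// -sumr_cst.
by apply: ler_sum => i _; exact: hc.
Qed.

Lemma term_bound w i m j (t B : R) : `|t| <= B ->
  `|2 * obs X w i m * obs X w i j * t| <= 2 * B.
Proof.
move=> tB; rewrite !normrM (ger0_norm (_ : 0 <= 2))//.
have h1 := entry_obs i m; have h2 := entry_obs i j.
have h3 : `|obs X w i m| * `|obs X w i j| <= 1 by rewrite mulr_ile1.
rewrite -!mulrA ler_wpM2l// mulrA -[leRHS]mul1r ler_pM// mulr_ge0//.
Qed.

(* Cut off on the null event of a point on the sphere, where the approximations may
   fail to converge. *)
Definition lim_coeff w m j : R :=
  if count X (@unit_sphere R d) w == 0%N then
    \sum_i 2 * obs X w i m * obs X w i j * lim_weight i else 0.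

Lemma functional_coeff_approx l m j w : functional X (coeff (F_ l) m j) w =
  \sum_i 2 * obs X w i m * obs X w i j * approx_weight psi k l (obs X w) i.
Proof. exact: coeff_approx_form. Qed.

Lemma functional_euler_approx l w : functional X (euler (F_ l)) w =
  \sum_i 2 * sqrow (obs X w) i * approx_weight psi k l (obs X w) i.
Proof. exact: euler_approx_form. Qed.

Lemma coeff_cvg w m j : no_sphere w ->
  functional X (coeff (F_ l) m j) w @[l --> \oo] --> lim_coeff w m j.
Proof.
move=> w0; rewrite /lim_coeff w0 eqxx.
under eq_fun do rewrite functional_coeff_approx.
apply: cvg_sumr => i; apply: cvgM; [exact: cvg_cst|exact: weight_cvg].
Qed.

(** The tied points share [psi1 (Y w)] equally and each has squared norm Y, so their number cancels
    in the sum. *)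
Definition lim_euler w : R := 2 * Y w * psi1 (Y w) * (k <= N w)%N%:R.

Lemma euler_cvg w : no_sphere w ->
  functional X (euler (F_ l)) w @[l --> \oo] --> lim_euler w.
Proof.
move=> w0; under eq_fun do rewrite functional_euler_approx.
have -> : lim_euler w = \sum_i 2 * sqrow (obs X w) i * lim_weight i.
  (* The quotient is 1 if N >= k; otherwise it is 0 / 0 = 0 by convention, so it is the
     indicator. *)
  transitivity (2 * Y w * psi1 (Y w) * ((nties w)%:R / (nties w)%:R)).
    congr (_ * _); case: leqP => kN.
      have [[i hi] _ _] := sqrow_Ystat PX k_gt0 kN.
      by rewrite divff// pnatr_eq0 -lt0n /nties (bigD1 i)//= /sqrow hi eqxx.
    have -> : nties w = 0%N; last by rewrite mul0r.
    rewrite /nties big1// => i _; rewrite /Ystat leqNgt kN/= lt_eqF//.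
    exact: sqrow_lt1.
  rewrite [X in X / _]natr_sum mulr_suml mulr_sumr; apply: eq_bigr => i _.
  rewrite /lim_weight; case: eqP => [->|_]; first by ring.
  by rewrite !mul0r !mulr0.
apply: cvg_sumr => i; apply: cvgM; [exact: cvg_cst|exact: weight_cvg].
Qed.

Lemma dominated_cvg0 (S : nat -> Omega -> R) (C : R) :
  (forall l, measurable_fun setT (S l)) ->
  (forall l w, 0 <= S l w <= C * (N w)%:R ^+ 2) ->
  {ae P, forall w, S l w @[l --> \oo] --> (0 : R)} ->
  (\int[P]_w (S l w)%:E @[l --> \oo] --> 0)%E.
Proof.
move=> mS SC S0.
have iC := integrableZl measurableT C (integrable_sqrN theta_gt0 PX).
have := @dominated_convergence _ _ _ P setT measurableT (fun l w => (S l w)%:E)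
  (fun=> 0%E) _ _ _ _ iC _.
rewrite integral0; case => //.
- by move=> l; apply/measurable_EFinP.
- by apply: filterS S0 => w h _; apply: cvg_EFin; [exact: nearW|exact: h].
- apply: aeW => w l _ /=; have /andP[S1 S2] := SC l w.
  by rewrite lee_fin ger0_norm.
Qed.


Lemma psi1_bound : exists2 B : R, 0 < B & forall t : R, 0 <= t <= 1 -> `|psi1 t| <= B.
Proof. by have [_ cpsi1 _] := C1psi; exact: C1_01_bound. Qed.

Lemma functional_coeff_bound (B : R) : (forall t : R, 0 <= t <= 1 -> `|psi1 t| <= B) ->
  forall l m j w, `|functional X (coeff (F_ l) m j) w| <= 36 * B * (N w)%:R.
Proof.
move=> hB l m j w; rewrite functional_coeff_approx.
apply: sum_obs_bound => i; have -> : 36 * B = 2 * (18 * B) by ring.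
by apply: term_bound; apply: (approx_weight_bound k C1psi).
Qed.

Lemma lim_coeff_bound (B : R) : (forall t : R, 0 <= t <= 1 -> `|psi1 t| <= B) ->
  forall m j w, `|lim_coeff w m j| <= 2 * B * (N w)%:R.
Proof.
move=> hB m j w; have B0 : 0 <= B by apply: le_trans (hB 0 _); rewrite ?lexx ?ler01.
rewrite /lim_coeff; case: ifP => _; last by rewrite normr0 !mulr_ge0.
by apply: sum_obs_bound => i; apply: term_bound; exact: lim_weight_bound.
Qed.

Lemma FW_measurable_no_sphere :
  measurable ([set w | no_sphere w] : set G).
Proof.
apply: (@FW_measurable_count _ _ _ _ X (@unit_sphere R d) [set n | n = 0%N]).
  exact: measurable_unit_sphere.
by move=> x h; rewrite /unit_ball/= h.
Qed.

Lemma FW_measurable_lim_coeff m j : measurable_fun setT ((fun w => lim_coeff w m j) : G -> R).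
Proof.
pose T := [set w : G | no_sphere w].
apply: (@measurable_fun_cvg _ G R setT
  (fun l w => functional X (coeff (F_ l) m j) w * \1_T w)) => [l|w _].
  apply: measurable_funM; last exact: measurable_indic FW_measurable_no_sphere.
  apply: (FW_measurable_functional PX); first exact: symmetric_coeff_approx.
  exact: continuous_coeff_approx.
have [w0|w0] := eqVneq (count X (@unit_sphere R d) w) 0%N.
  rewrite indicE mem_set//; under eq_fun do rewrite mulr1; exact: coeff_cvg.
rewrite indicE memNset; last by move/eqP: w0.
under eq_fun do rewrite mulr0; rewrite /lim_coeff (negbTE w0); exact: cvg_cst.
Qed.

Lemma measurable_coeff l m j : measurable_fun setT (functional X (coeff (F_ l) m j)).
Proof.
apply: (measurable_functional PX); first exact: symmetric_coeff_approx.
exact: continuous_coeff_approx.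
Qed.

Lemma measurable_lim_coeff m j : measurable_fun setT (fun w => lim_coeff w m j).
Proof. by apply: (FW_measurable_fun PX); exact: FW_measurable_lim_coeff. Qed.

Definition lim_field : Omega -> 'rV[R]_d -> 'rV[R]_d := Hfield V lim_coeff.

Lemma HfieldB (c c' : Omega -> 'I_d -> 'I_d -> R) w x :
  Hfield V c w x - Hfield V c' w x = Hfield V (fun w m j => c w m j - c' w m j) w x.
Proof.
apply/rowP => j; rewrite !mxE -opprD -sumrB; congr (- _).
by apply: eq_bigr => m _; rewrite mulrBr.
Qed.

Lemma sqnormH_Hfield (c : Omega -> 'I_d -> 'I_d -> R) :
  sqnormH P (Hfield V c) = (\int[P]_w (d%:R^-1 * \sum_m \sum_j c w m j ^+ 2)%:E)%E.
Proof. by apply: eq_integral => w _; exact: integral_Hfield. Qed.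

Lemma measurable_sqr_coeffs (c : Omega -> 'I_d -> 'I_d -> R) :
  (forall m j, measurable_fun setT (fun w => c w m j)) ->
  measurable_fun setT (fun w => d%:R^-1 * \sum_m \sum_j c w m j ^+ 2).
Proof.
move=> mc; apply: measurable_funM => //; apply: measurable_sum => m.
by apply: measurable_sum => j; apply: measurable_funX.
Qed.

Lemma sqr_coeffs_bound (c : Omega -> 'I_d -> 'I_d -> R) (C : R) w :
  (forall m j, `|c w m j| <= C * (N w)%:R) ->
  0 <= d%:R^-1 * \sum_m \sum_j c w m j ^+ 2 <= d%:R * C ^+ 2 * (N w)%:R ^+ 2.
Proof.
move=> hc; have d0 : 0 < d%:R :> R by rewrite ltr0n.
rewrite mulr_ge0 ?invr_ge0//=; last first.
  by apply: sumr_ge0 => m _; apply: sumr_ge0 => j _; exact: sqr_ge0.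
rewrite ler_pdivrMl//.
apply: (@le_trans _ _ (\sum_(m < d) \sum_(j < d) (C * (N w)%:R) ^+ 2)).
  apply: ler_sum => m _; apply: ler_sum => j _; rewrite -[leLHS]real_normK ?num_real//.
  by rewrite ler_sqr ?nnegrE//; exact: le_trans (hc m j).
by rewrite !sumr_cst le_eqVlt; apply/orP; left; apply/eqP; ring.
Qed.

Lemma ae_no_sphere : {ae P, forall w, no_sphere w}.
Proof. exact: (ae_sphere PX). Qed.

Lemma Dop_approx_cvg : cvg_L2H P (fun l => Dop X V (F_ l)) lim_field.
Proof.
have [B B0 hB] := psi1_bound.
rewrite /cvg_L2H.
pose c l w m j := functional X (coeff (F_ l) m j) w - lim_coeff w m j.
rewrite (_ : (fun l => _) = fun l =>
    (\int[P]_w (d%:R^-1 * \sum_m \sum_j c l w m j ^+ 2)%:E)%E); last first.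
  apply/funext => l; rewrite -sqnormH_Hfield; apply: eq_integral => w _.
  by apply: eq_integral => x _; rewrite DopE HfieldB.
(* 38 = 36 + 2: the bounds 36 B N on the approximating coefficients and 2 B N on their limits. *)
apply: (@dominated_cvg0 _ (d%:R * (38 * B) ^+ 2)).
- move=> l; apply: measurable_sqr_coeffs => m j; apply: measurable_funB.
    exact: measurable_coeff.
  exact: measurable_lim_coeff.
- move=> l w; apply: sqr_coeffs_bound => m j; rewrite /c (le_trans (ler_normB _ _))//.
  have -> : 38 * B * (N w)%:R = 36 * B * (N w)%:R + 2 * B * (N w)%:R by ring.
  by rewrite lerD ?functional_coeff_bound ?lim_coeff_bound.
- apply: filterS ae_no_sphere => w w0.
  have e : d%:R^-1 * \sum_m \sum_j (lim_coeff w m j - lim_coeff w m j) ^+ 2 = 0.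
    by rewrite big1 ?mulr0// => m _; rewrite big1// => j _; rewrite subrr expr0n.
  have h0 : (d%:R^-1 * \sum_m \sum_j c l w m j ^+ 2) @[l --> \oo] -->
      d%:R^-1 * \sum_m \sum_j (lim_coeff w m j - lim_coeff w m j) ^+ 2.
    apply: cvgM; first exact: cvg_cst.
    apply: cvg_sumr => m; apply: cvg_sumr => j.
    have h : c l w m j @[l --> \oo] --> lim_coeff w m j - lim_coeff w m j.
      by apply: cvgB; [exact: coeff_cvg|exact: cvg_cst].
    exact: (cvgM h h).
  by rewrite e in h0.
Qed.

Lemma lim_field_L2H : in_L2H P X lim_field.
Proof.
have [B B0 hB] := psi1_bound; split.
  have mT : measurable ([set: G] `*` W) by apply: measurableX => //; exact: measurable_unit_ball.
  have mU i j : measurable_fun ([set: G] `*` W)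
      ((fun p : G * 'rV[R]_d => lim_field p.1 p.2 i j) : _ -> R).
    rewrite (_ : (fun _ => _) = fun p : G * 'rV[R]_d =>
      0 - \sum_m (Num.sqrt d%:R)^-1 * V m p.2 * lim_coeff p.1 m j); last first.
      by apply/funext => p; rewrite !mxE sub0r; congr (- _); apply: eq_bigr => m _; rewrite !mxE.
    apply: measurable_funB => //; apply: measurable_sum => m.
    apply: measurable_funM.
      apply: measurable_funM => //; have [mV _ _] := oV.
      apply: (measurable_comp (F := W) (f := V m) (g := snd)) => //.
      - exact: measurable_unit_ball.
      - by move=> _ [[w x] [_ Wx] <-].
      - exact: measurable_funTS.
    apply: (@measurableT_comp _ _ _ _ _ _ (fun w : G => lim_coeff w m j)).
      exact: FW_measurable_lim_coeff.
    exact: measurable_funTS.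
  apply: (@measurability _ _ _ _ _ _ (@mx_cylinders _ (measurableTypeR R) 1 d)) => //.
  move=> _ [_ [[i j] [A mA ->]] <-]; exact: mU.
rewrite sqnormH_Hfield.
have iC := integrableZl measurableT (d%:R * (2 * B) ^+ 2) (integrable_sqrN theta_gt0 PX).
apply: le_lt_trans (integrable_lty measurableT iC).
have b w : 0 <= d%:R^-1 * \sum_m \sum_j lim_coeff w m j ^+ 2 <=
    d%:R * (2 * B) ^+ 2 * (N w)%:R ^+ 2.
  by apply: sqr_coeffs_bound => m j; exact: lim_coeff_bound.
apply: ge0_le_integral => //.
- by move=> w _; rewrite lee_fin; case/andP: (b w).
- apply/measurable_EFinP; apply: measurable_sqr_coeffs => m j; exact: measurable_lim_coeff.
- by case/integrableP : iC.
- by move=> w _ /=; rewrite lee_fin; case/andP: (b w).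
Qed.

Lemma approx_form_approx_Dom :
  approx_Dom P X V (fun w => psi (Y w)) (fun l => F_ l).
Proof.
split.
- by move=> l; exact: (approx_form_DomD k C1psi).
- exact: (functional_approx_L2 PX k_gt0 C1psi).
- by exists lim_field; [exact: lim_field_L2H|exact: Dop_approx_cvg].
Qed.

Lemma in_closure_Ystat : in_closure_Dom P X V (fun w => psi (Y w)).
Proof.
have [cpsi _ _] := C1psi; split; first exact: (in_L2_Ystat PX).
by exists (fun l => F_ l); exact: approx_form_approx_Dom.
Qed.

Lemma functional_euler_bound (B : R) : (forall t : R, 0 <= t <= 1 -> `|psi1 t| <= B) ->
  forall l w, `|functional X (euler (F_ l)) w| <= 36 * B * (N w)%:R.
Proof.
move=> hB l w; have B0 : 0 <= B by apply: le_trans (hB 0 _); rewrite ?lexx ?ler01.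
rewrite functional_euler_approx; apply: sum_obs_bound => i.
have s0 : 0 <= sqrow (obs X w) i := dotp_ge0 _.
have s1 := sqrow_le1 i; have h := approx_weight_bound k C1psi l hB (obs X w) i.
rewrite !normrM (ger0_norm (_ : 0 <= 2))// (ger0_norm s0).
by move: (normr_ge0 (approx_weight psi k l (obs X w) i)); nra.
Qed.

Lemma lim_euler_bound (B : R) : (forall t : R, 0 <= t <= 1 -> `|psi1 t| <= B) ->
  forall w, `|lim_euler w| <= 2 * B * (N w)%:R.
Proof.
move=> hB w; have /andP[y0 y1] := Ystat_itv PX k_gt0 w.
have h : `|psi1 (Y w)| <= B by apply: hB; rewrite y0.
rewrite /lim_euler !normrM (ger0_norm (_ : 0 <= 2))// (ger0_norm y0) normr_nat.
apply: ler_pM => //; first by rewrite !mulr_ge0.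
  by move: (normr_ge0 (psi1 (Y w))); nra.
by case: (leqP k (N w)) => // kn; rewrite ler_nat (leq_trans k_gt0 kn).
Qed.

Lemma measurable_lim_euler : measurable_fun setT lim_euler.
Proof.
have [_ cpsi1 _] := C1psi.
apply: measurable_funM; last exact: (measurable_N PX (fun n => (k <= n)%N%:R)).
apply: measurable_funM; last first.
  by apply: (FW_measurable_fun PX); exact: (FW_measurable_Ystat_comp PX).
apply: measurable_funM => //.
by apply: (FW_measurable_fun PX); exact: (FW_measurable_Ystat PX).
Qed.

Lemma measurable_functional_euler l : measurable_fun setT (functional X (euler (F_ l))).
Proof.
have [sF CF _] := @DomD_regular R d _ (approx_form_DomD k C1psi l).
apply: (measurable_functional PX); first exact: symmetric_euler.
exact: continuous_euler.
Qed.

Lemma nabla_approx_cvg :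
  cvg_L2 P (fun l => nabla X V (F_ l)) (fun w => - d%:R^-1 * lim_euler w).
Proof.
have [B B0 hB] := psi1_bound; rewrite /cvg_L2.
pose S l w := (- d%:R^-1 * (functional X (euler (F_ l)) w - lim_euler w)) ^+ 2.
rewrite (_ : (fun l => _) = fun l => (\int[P]_w (S l w)%:E)%E); last first.
  apply/funext => l; rewrite unlock; apply: eq_integral => w _.
  by rewrite nablaE// -mulrBr.
apply: (@dominated_cvg0 _ ((d%:R^-1 * (38 * B)) ^+ 2)).
- move=> l; apply: measurable_funX; apply: measurable_funM => //.
  by apply: measurable_funB; [exact: measurable_functional_euler|exact: measurable_lim_euler].
- move=> l w; rewrite sqr_ge0/= -exprMn /S -[leLHS]real_normK ?num_real//.
  have d0 : 0 <= d%:R^-1 :> R by rewrite invr_ge0.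
  rewrite ler_sqr ?nnegrE//; last by rewrite !mulr_ge0// ltW.
  rewrite normrM normrN (ger0_norm d0) -mulrA ler_wpM2l// (le_trans (ler_normB _ _))//.
  have -> : 38 * B * (N w)%:R = 36 * B * (N w)%:R + 2 * B * (N w)%:R by ring.
  by rewrite lerD ?functional_euler_bound ?lim_euler_bound.
- apply: filterS ae_no_sphere => w w0.
  have h : - d%:R^-1 * (functional X (euler (F_ l)) w - lim_euler w) @[l --> \oo] -->
      - d%:R^-1 * (lim_euler w - lim_euler w).
    apply: cvgM; first exact: cvg_cst.
    by apply: cvgB; [exact: euler_cvg|exact: cvg_cst].
  by have := cvgM h h; rewrite subrr mulr0 mulr0; exact.
Qed.

End gradient_closure.

(** * The covariance identity *)

Section riemann_compare.
Context {R : realType}.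
Variables (g g1 : R -> R) (Pi beta : R -> R) (D : R).
Hypotheses (C1g : C1_01 g g1) (D0 : 0 < D).
Hypothesis cbeta : {within `[0, 1], continuous beta}.
Hypothesis dPi : forall u v : R, 0 <= u -> u < v -> v <= 1 ->
  exists2 c, u < c < v & Pi v - Pi u = D * beta c * (v - u).

Lemma sqr_diff_mvt (u v : R) : 0 <= u -> u < v -> v <= 1 ->
  exists2 c, u ^+ 2 < c < v ^+ 2 & g (v ^+ 2) - g (u ^+ 2) = g1 c * (v + u) * (v - u).
Proof.
move=> u0 uv v1; have v0 : 0 <= v by rewrite ltW// (le_lt_trans u0).
have h1 : 0 <= u ^+ 2 by rewrite sqr_ge0.
have h2 : u ^+ 2 < v ^+ 2 by rewrite ltr_sqr ?nnegrE.
have h3 : v ^+ 2 <= 1 by rewrite expr_le1.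
have [c cuv e] := C1_01_mvt C1g h1 h2 h3.
by exists c => //; rewrite e; ring.
Qed.

(** 4 K^2 pays for replacing r + h by r, since (2 r + h)(r + h) - 2 r^2 = h (3 r + h) and 3 r + h <=
    4; 6 K pays for the three oscillations, each at most [e1]. *)
Lemma compare_alg (r h e1 K x x0 b b' b0 : R) : 0 <= r <= 1 -> 0 <= h <= e1 ->
  r + h <= 1 -> `|x| <= K -> `|x0| <= K -> `|b| <= K -> `|b0| <= K -> `|b'| <= K ->
  `|x - x0| <= e1 -> `|b - b0| <= e1 -> `|b' - b0| <= e1 ->
  `|x * (r + h + r) * ((r + h) * b) - 2 * (r ^+ 2 * x0) * b'| <=
  (4 * K ^+ 2 + 6 * K) * e1.
Proof.
move=> /andP[r0 r1] /andP[h0 he] rh xK x0K bK b0K b'K xx bb bb'.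
have K0 : 0 <= K by apply: le_trans xK.
have e0 : 0 <= e1 by apply: le_trans he.
have -> : x * (r + h + r) * ((r + h) * b) - 2 * (r ^+ 2 * x0) * b' =
  h * (3 * r + h) * (x * b) + 2 * r ^+ 2 * ((x - x0) * b + x0 * (b - b0) - x0 * (b' - b0)).
  by ring.
have t1 : `|h * (3 * r + h) * (x * b)| <= e1 * 4 * (K * K).
  have p : 0 <= h * (3 * r + h) by rewrite mulr_ge0// addr_ge0// mulr_ge0.
  rewrite normrM (ger0_norm p) normrM; apply: ler_pM => //; last exact: ler_pM.
  by apply: ler_pM => //; [rewrite addr_ge0// mulr_ge0|lra].
have t2 : `|(x - x0) * b + x0 * (b - b0) - x0 * (b' - b0)| <= 3 * K * e1.
  have a1 : `|(x - x0) * b| <= e1 * K by rewrite normrM ler_pM.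
  have a2 : `|x0 * (b - b0)| <= K * e1 by rewrite normrM ler_pM.
  have a3 : `|x0 * (b' - b0)| <= K * e1 by rewrite normrM ler_pM.
  have := ler_normB ((x - x0) * b + x0 * (b - b0)) (x0 * (b' - b0)).
  have := ler_normD ((x - x0) * b) (x0 * (b - b0)); lra.
have t3 : `|2 * r ^+ 2 * ((x - x0) * b + x0 * (b - b0) - x0 * (b' - b0))| <= 2 * (3 * K * e1).
  have p : 0 <= 2 * r ^+ 2 by rewrite mulr_ge0// sqr_ge0.
  rewrite normrM (ger0_norm p); apply: ler_pM => //.
  by rewrite ler_piMr// expr_le1.
apply: (le_trans (ler_normD _ _)); apply: (le_trans (lerD t1 t3)); lra.
Qed.

(** To first order in the mesh h, both terms of a summand are 2 r^2 g1(r^2) beta(r) h. The two sums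
    are compared directly, without an integral over the radius. *)
Lemma riemann_compare (e : R) : 0 < e -> \forall n \near \oo,
  `|\sum_(q < n.+1) ((g ((q.+1%:R / n.+1%:R) ^+ 2) - g ((q%:R / n.+1%:R) ^+ 2)) *
      (q.+1%:R / n.+1%:R * beta (q.+1%:R / n.+1%:R)) -
    2 / D * ((q%:R / n.+1%:R) ^+ 2 * g1 ((q%:R / n.+1%:R) ^+ 2)) *
      (Pi (q.+1%:R / n.+1%:R) - Pi (q%:R / n.+1%:R)))| <= e.
Proof.
move=> e0; have [_ cg1 _] := C1g.
have [K1 K10 hK1] := C1_01_bound cg1; have [K2 K20 hK2] := C1_01_bound cbeta.
pose K := K1 + K2; have K0 : 0 < K by rewrite addr_gt0.
pose c0 := 4 * K ^+ 2 + 6 * K.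
have c00 : 0 < c0 by rewrite addr_gt0// mulr_gt0// exprn_gt0.
pose e1 := e / c0; have e10 : 0 < e1 by rewrite divr_gt0.
have [d1 d10 hd1] := unif_cont01 cg1 e10; have [d2 d20 hd2] := unif_cont01 cbeta e10.
(* [d1 / 2] because the squares of adjacent mesh points differ by at most 2 h. *)
have m0 : 0 < Num.min e1 (Num.min (d1 / 2) d2) by rewrite !lt_min e10 d20 divr_gt0.
near=> n.
have : n.+1%:R^-1 < Num.min e1 (Num.min (d1 / 2) d2).
  by near: n; exact: (near_infty_natSinv_lt (PosNum m0)).
pose h : R := n.+1%:R^-1; have h0 : 0 < h by rewrite invr_gt0.
rewrite -/h !lt_min => /andP[/ltW he /andP[/ltW hd1' /ltW hd2']].
apply: (le_trans (ler_norm_sum _ _ _)).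
apply: (@le_trans _ _ (\sum_(q < n.+1) e * h)); last first.
  by rewrite sumr_cst -mulrA mulVf ?mulr1// pnatr_eq0.
apply: ler_sum => q _; pose r : R := q%:R / n.+1%:R.
have rS : q.+1%:R / n.+1%:R = r + h by rewrite -(natr1 q) mulrDl mul1r.
have r0 : 0 <= r by rewrite divr_ge0.
have rh1 : r + h <= 1 by rewrite -rS ler_pdivrMr// mul1r ler_nat.
have rrh : r < r + h by rewrite ltrDl.
have r1 : r <= 1 by apply: le_trans rh1; exact: ltW.
rewrite rS -/r; have [c /andP[c1 c2] ->] := sqr_diff_mvt r0 rrh rh1.
have [c' /andP[c'1 c'2] ->] := dPi r0 rrh rh1.
rewrite (_ : r + h - r = h); last by ring.
rewrite (_ : _ - _ = (g1 c * (r + h + r) * ((r + h) * beta (r + h)) -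
    2 * (r ^+ 2 * g1 (r ^+ 2)) * beta c') * h); last first.
  by move: (lt0r_neq0 D0) => Dn; field.
rewrite normrM (gtr0_norm h0); apply: ler_wpM2r; first exact: ltW.
have rr0 : 0 <= r ^+ 2 by rewrite sqr_ge0.
have rr1 : r ^+ 2 <= 1 by rewrite expr_le1.
have rh0 : 0 <= r + h by rewrite addr_ge0// ltW.
have rrh1 : (r + h) ^+ 2 <= 1 by rewrite expr_le1.
have c01 : 0 <= c <= 1 by apply/andP; split; lra.
have c'01 : 0 <= c' <= 1 by apply/andP; split; lra.
have -> : e = c0 * e1 by rewrite /e1 mulrCA divff ?mulr1// gt_eqF.
apply: (@compare_alg r h e1 K _ _ _ _ (beta r)) => //.
- by rewrite r0.
- by rewrite ltW.
- by apply: le_trans (hK1 _ c01) _; rewrite lerDl ltW.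
- by apply: le_trans (hK1 _ _) _; rewrite ?rr0// lerDl ltW.
- by apply: le_trans (hK2 _ _) _; rewrite ?rh0// lerDr ltW.
- by apply: le_trans (hK2 r _) _; rewrite ?r0// lerDr ltW.
- by apply: le_trans (hK2 _ c'01) _; rewrite lerDr ltW.
- apply: hd1; rewrite ?rr0// ger0_norm ?subr_ge0 ?ltW//.
  have : (r + h) ^+ 2 - r ^+ 2 <= 2 * h by nra.
  by lra.
- by apply: hd2; rewrite ?rh0 ?r0// addrAC subrr add0r gtr0_norm.
- by apply: hd2; rewrite ?r0// gtr0_norm ?subr_gt0//; lra.
Unshelve. all: by end_near. Qed.

End riemann_compare.

(** * Poisson tail probabilities as functions of the radius *)

Section poisson_tail.
Context {R : realType}.

Lemma is_derive_exprn (x : R) n : is_derive x 1 (fun x => x ^+ n) (n%:R * x ^+ n.-1).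
Proof.
have h := is_deriveX n (is_derive_id x (1 : R)).
rewrite (_ : (fun _ => _) = id ^+ n); last by apply/funext => y; rewrite exprfctE.
by apply: is_derive_eq; rewrite /GRing.scale/= mulr1.
Qed.

Lemma is_derive_mul_fun (f g : R -> R) (x df dg : R) :
  is_derive x 1 f df -> is_derive x 1 g dg ->
  is_derive x 1 (fun x => f x * g x) (f x * dg + g x * df).
Proof. by move=> hf hg; have := is_deriveM hf hg. Qed.

Lemma is_derive_expRN (l : R) : is_derive l 1 (fun l => expR (- l)) (- expR (- l)).
Proof. by apply: is_derive_eq; rewrite mulrN1. Qed.

Lemma is_derive_pois_gen (l : R) i : is_derive l 1 (fun l => pois l i)
  (i%:R * l ^+ i.-1 / i`!%:R * expR (- l) - pois l i).
Proof.
have h1 := is_derive_mul_fun (is_derive_exprn l i) (is_derive_cst (i`!%:R^-1 : R) l 1).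
have h := is_derive_mul_fun h1 (is_derive_expRN l).
by apply: (is_derive_eq h); rewrite /pois/=; ring.
Qed.

Lemma is_derive_pois (l : R) i : is_derive l 1 (fun l => pois l i.+1) (pois l i - pois l i.+1).
Proof.
apply: (is_derive_eq (is_derive_pois_gen l i.+1)); congr (_ - _); rewrite /pois factS natrM/=.
have f0 : i`!%:R != 0 :> R by rewrite pnatr_eq0 -lt0n fact_gt0.
have i0 : i.+1%:R != 0 :> R by rewrite pnatr_eq0.
move: (i`!%:R : R) (i.+1%:R : R) f0 i0 => x y x0 y0.
by field; rewrite x0 y0.
Qed.

Lemma is_derive_pois0 (l : R) : is_derive l 1 (fun l => pois l 0) (- pois l 0).
Proof. by apply: (is_derive_eq (is_derive_pois_gen l 0)); rewrite !mul0r sub0r. Qed.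

(** The derivatives pois(i-1) - pois(i) telescope. *)
Lemma is_derive_pois_sum (l : R) k :
  is_derive l 1 (fun l => \sum_(i < k.+1) pois l i) (- pois l k).
Proof.
elim: k => [|k IH].
  rewrite (_ : (fun _ => _) = fun l => pois l 0); first exact: is_derive_pois0.
  by apply/funext => x; rewrite big_ord_recr/= big_ord0 add0r.
rewrite (_ : (fun _ => _) = (fun l => \sum_(i < k.+1) pois l i) + (fun l => pois l k.+1)).
  have d2 := is_derive_pois l k; apply: is_derive_eq; ring.
by apply/funext => x; rewrite big_ord_recr.
Qed.

Lemma continuous_pois k : continuous (fun l : R => pois l k).
Proof.
move=> l; apply: differentiable_continuous; apply/derivable1_diffP.
by case: k => [|k]; [case: (is_derive_pois0 l)|case: (is_derive_pois l k)].
Qed.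

Variables (a : R) (d k : nat).

(* [a * r ^ d.+1] is the mean count of the ball of radius [r]. *)
Definition tail (r : R) : R := 1 - \sum_(i < k.+1) pois (a * r ^+ d.+1) i.

(** The derivative of [tail] divided by the dimension. Multiplied by r it is lam P(M = k), the value
    found in [E_centered_ge]: this coincidence is the covariance identity at a single radius. *)
Definition tail_density (r : R) : R := a * r ^+ d * pois (a * r ^+ d.+1) k.

Lemma is_derive_tail (r : R) : is_derive r 1 tail (d.+1%:R * tail_density r).
Proof.
have d1 : is_derive r 1 (fun r : R => a * r ^+ d.+1) (a * (d.+1%:R * r ^+ d)).
  apply: (is_derive_eq (is_derive_mul_fun (is_derive_cst a r 1) (is_derive_exprn r d.+1))).
  by rewrite mulr0 addr0.
have d2 := is_derive_pois_sum (a * r ^+ d.+1) k.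
have d3 := @is_derive1_comp _ _ _ r _ _ d2 d1.
rewrite /tail (_ : (fun _ => _) = cst 1 - ((fun l => \sum_(i < k.+1) pois l i) \o (fun r => a * r ^+ d.+1)))//.
by apply: is_derive_eq; rewrite /tail_density; ring.
Qed.

Lemma continuous_tail_density : continuous tail_density.
Proof.
move=> r; have cX n : continuous (fun r : R => a * r ^+ n).
  by move=> x; apply: cvgM; [exact: cvg_cst|exact: exprn_continuous].
apply: cvgM; first exact: cX.
apply: (@continuous_cvg _ _ _ (nbhs r) _ _ (fun l => pois l k)); first exact: continuous_pois.
exact: cX.
Qed.

Lemma tail_mvt (u v : R) : 0 <= u -> u < v -> v <= 1 ->
  exists2 c, u < c < v & tail v - tail u = d.+1%:R * tail_density c * (v - u).
Proof.
move=> _ uv _; have dt x : x \in `]u, v[ -> is_derive x (1 : R) tail (d.+1%:R * tail_density x).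
  by move=> _; exact: is_derive_tail.
have ct : {within `[u, v], continuous tail}.
  apply: continuous_subspaceT => x; apply: differentiable_continuous.
  by apply/derivable1_diffP; case: (is_derive_tail x).
have [c cuv e] := MVT uv dt ct.
by exists c => //; move: cuv; rewrite in_itv.
Qed.

End poisson_tail.

Lemma compare_bounds (R : realType) (c t A I1 S2 I2 D e kz kh : R) :
  `|c * t - A - I1| <= e * kz -> `|S2 - I2| <= e * kh -> `|c| <= e ->
  `|A - D * S2| <= e -> 0 <= D -> `|I1 + D * I2| <= e * (kz + D * kh + `|t| + 1).
Proof.
move=> h1 h2 h3 h4 D0.
have -> : I1 + D * I2 = c * t - (c * t - A - I1) - D * (S2 - I2) - (A - D * S2) by ring.
have b1 : `|c * t| <= e * `|t| by rewrite normrM ler_wpM2r.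
have b2 : `|D * (S2 - I2)| <= D * (e * kh) by rewrite normrM ger0_norm// ler_wpM2l.
have -> : e * (kz + D * kh + `|t| + 1) = e * `|t| + e * kz + D * (e * kh) + e by ring.
apply: (le_trans (ler_normB _ _)); apply: lerD => //.
apply: (le_trans (ler_normB _ _)); apply: lerD => //.
by apply: (le_trans (ler_normB _ _)); apply: lerD.
Qed.

Section covariance.
Context {R : realType} {d : nat}.
Context {disp : measure_display} {Omega : measurableType disp}.
Variables (P : probability Omega R) (X : Omega -> set 'rV[R]_d.+1) (theta : R).
Hypotheses (theta_gt0 : 0 < theta) (PX : poisson_process P X theta).
Variables (k : nat) (g g1 : R -> R).
Hypothesis C1g : C1_01 g g1.
Local Notation W := (@unit_ball R d.+1).
Local Notation N := (count X W).
Local Notation Y := (Ystat X k.+1).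
Local Notation a := (theta * volume W).
Local Notation integrable Z := (P.-integrable setT (EFin \o Z)).

(* The mesh is in the norm rather than in its square: the density of the norm is
   continuous up to 0. *)
Let rho w : R := Num.sqrt (Y w).
Let mesh n q : R := q%:R / n.+1%:R.
Let ind n q w : R := (rho w <= mesh n q)%R%:R.
Let step (f : R -> R) n w : R :=
  f 1 - \sum_(q < n.+1) (f (mesh n q.+1) - f (mesh n q)) * ind n q.+1 w.

Lemma integrable_mulb (F Z : Omega -> R) (B : R) : measurable_fun setT F ->
  (forall w, `|F w| <= B) -> integrable Z -> integrable (fun w => F w * Z w).
Proof.
move=> mF FB iZ; have iBZ := integrableZl measurableT B iZ.
apply: (le_integrable measurableT _ _ iBZ).
  apply/measurable_EFinP; apply: measurable_funM => //.
  by case/integrableP : iZ => /measurable_EFinP.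
move=> w _ /=; rewrite lee_fin !normrM ler_wpM2r//.
exact: le_trans (FB w) (ler_norm _).
Qed.

Lemma Rintegral_close (F F' Z : Omega -> R) (B e : R) :
  measurable_fun setT F -> measurable_fun setT F' -> (forall w, `|F w| <= B) ->
  (forall w, `|F' w - F w| <= e) -> integrable Z ->
  `|\int[P]_w (F' w * Z w) - \int[P]_w (F w * Z w)| <= e * \int[P]_w `|Z w|.
Proof.
move=> mF mF' FB FF iZ.
have F'B w : `|F' w| <= B + e.
  by rewrite -(subrK (F w) (F' w)) addrC (le_trans (ler_normD _ _))// lerD.
have i1 := integrable_mulb mF FB iZ; have i2 := integrable_mulb mF' F'B iZ.
have mD : measurable_fun setT (fun w => F' w - F w) by exact: measurable_funB.
have i3 := integrable_mulb mD FF iZ.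
rewrite -RintegralB//.
rewrite (_ : \int[P]_w _ = \int[P]_w ((F' w - F w) * Z w)); last first.
  by apply: eq_Rintegral => w _; rewrite mulrBl.
apply: (le_trans (le_normr_Rintegral measurableT i3)).
have iZn : integrable (fun w => `|Z w|) by have := integrable_abse iZ.
rewrite -RintegralZl//; apply: le_Rintegral => //.
- by have := integrable_abse i3.
- by have := integrableZl measurableT e iZn.
- by move=> w _; rewrite normrM ler_wpM2r.
Qed.

Lemma rho_itv w : 0 <= rho w <= 1.
Proof.
have /andP[_ y1] := Ystat_itv PX (ltn0Sn k) w.
by rewrite /rho sqrtr_ge0/= -sqrtr1 ler_wsqrtr.
Qed.

Lemma sqr_rho w : rho w ^+ 2 = Y w.
Proof. by rewrite /rho sqr_sqrtr//; have /andP[] := Ystat_itv PX (ltn0Sn k) w. Qed.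

Lemma mesh_itv n q : (q <= n.+1)%N -> 0 <= mesh n q <= 1.
Proof.
by move=> qn; rewrite /mesh divr_ge0//= ler_pdivrMr// mul1r ler_nat.
Qed.

Lemma measurable_rho : measurable_fun setT rho.
Proof.
apply: (@measurableT_comp _ _ _ _ _ _ (@Num.sqrt R) _ Y).
  apply: continuous_measurable_fun; exact: sqrt_continuous.
by apply: (FW_measurable_fun PX); exact: (FW_measurable_Ystat PX).
Qed.

Lemma measurable_rho_le r : measurable [set w | rho w <= r].
Proof.
rewrite -[X in measurable X]setTI.
by apply: (measurable_rho measurableT (measurable_itv `]-oo, r])).
Qed.

Lemma measurable_ind n q : measurable_fun setT (ind n q).
Proof.
rewrite (_ : ind n q = \1_[set w | rho w <= mesh n q]).
  by apply: measurable_indic; exact: measurable_rho_le.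
apply/funext => w; rewrite indicE /ind; case: (boolP (rho w <= mesh n q)) => h.
  by rewrite mem_set.
by rewrite memNset//=; apply/negP.
Qed.

Lemma measurable_step f n : measurable_fun setT (step f n).
Proof.
apply: measurable_funB => //; apply: measurable_sum => q.
by apply: measurable_funM => //; exact: measurable_ind.
Qed.

Lemma step_close (f : R -> R) (e : R) :
  (exists2 dl : R, 0 < dl & forall t y : R, 0 <= t <= 1 -> 0 <= y <= 1 ->
    `|t - y| <= dl -> `|f t - f y| <= e) ->
  \forall n \near \oo, forall w, `|step f n w - f (rho w)| <= e.
Proof.
move=> [dl dl0 hdl]; near=> n; move=> w.
have nd : n.+1%:R^-1 <= dl.
  by apply: ltW; near: n; exact: (near_infty_natSinv_lt (PosNum dl0)).
apply: (@abel_close R n.+1 f (fun q => ind n q w) (rho w) 0 e) => //.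
- exact: rho_itv.
- by move=> q; rewrite /ind; case: (rho w <= mesh n q); rewrite ?lexx ?ler01.
- move=> q; rewrite /ind ler_nat; case: (leP (rho w) (mesh n q)) => // h.
  rewrite (le_trans h)//; apply: ler_pM => //; by rewrite ler_nat.
- by move=> q qn h; rewrite /ind leNgt h.
- by move=> q qn; rewrite addr0 => h; rewrite /ind h.
- move=> t t01 tr; apply: hdl => //; first exact: rho_itv.
  by apply: (le_trans tr); rewrite add0r.
Unshelve. all: by end_near. Qed.

Lemma unif_sqr (f : R -> R) (e : R) : {within `[0, 1], continuous f} -> 0 < e ->
  exists2 dl : R, 0 < dl & forall t y : R, 0 <= t <= 1 -> 0 <= y <= 1 ->
    `|t - y| <= dl -> `|f (t ^+ 2) - f (y ^+ 2)| <= e.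
Proof.
move=> cf e0; have [dl dl0 hdl] := unif_cont01 cf e0.
exists (dl / 2); first by rewrite divr_gt0.
move=> t y /andP[t0 t1] /andP[y0 y1] ty; apply: hdl; rewrite ?sqr_ge0 ?expr_le1//.
rewrite subr_sqr normrM (ger0_norm (addr_ge0 t0 y0)).
have : t + y <= 2 by lra.
by move: (normr_ge0 (t - y)) ty; nra.
Qed.

Lemma E_ind (Z : Omega -> R) n q : integrable Z ->
  \int[P]_w (ind n q w * Z w) = \int[P]_(w in [set w | rho w <= mesh n q]) Z w.
Proof.
move=> iZ; rewrite [RHS]Rintegral_mkcond; apply: eq_Rintegral => w _.
rewrite patchE /ind; case: (boolP (rho w <= mesh n q)) => h.
  by rewrite mem_set// mul1r.
by rewrite memNset ?mul0r//=; apply/negP.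
Qed.

Lemma E_step (Z : Omega -> R) f n : integrable Z ->
  \int[P]_w (step f n w * Z w) = f 1 * \int[P]_w Z w -
  \sum_(q < n.+1) (f (mesh n q.+1) - f (mesh n q)) *
    \int[P]_(w in [set w | rho w <= mesh n q.+1]) Z w.
Proof.
move=> iZ.
have i1 q : integrable (fun w => ind n q w * Z w).
  apply: (@integrable_mulb _ _ 1) => //; first exact: measurable_ind.
  by move=> w; rewrite /ind; case: (rho w <= mesh n q); rewrite ?normr1 ?normr0.
pose c q := f (mesh n q.+1) - f (mesh n q).
have i2 (q : 'I_n.+1) : integrable (fun w => c q * (ind n q.+1 w * Z w)).
  by have := integrableZl measurableT (c q) (i1 q.+1).
have [i3 e3] := Rintegral_sumr (index_enum 'I_n.+1) measurableT i2.
have i4 : integrable (fun w => f 1 * Z w) by have := integrableZl measurableT (f 1) iZ.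
rewrite (_ : \int[P]_w _ = \int[P]_w (f 1 * Z w - \sum_(q < n.+1) c q * (ind n q.+1 w * Z w))).
  rewrite RintegralB// RintegralZl// e3; congr (_ - _); apply: eq_bigr => q _.
  by rewrite RintegralZl// E_ind.
apply: eq_Rintegral => w _; rewrite /step mulrBl mulr_suml; congr (_ - _).
by apply: eq_bigr => q _; rewrite mulrA.
Qed.

Lemma rho_le w r : 0 <= r < 1 -> (rho w <= r) = (k < count X (eball r) w)%N.
Proof.
move=> r01; rewrite -(Ystat_le PX _ w r01)// -sqr_rho ler_sqr ?nnegrE//.
  by case/andP: (rho_itv w).
by case/andP: r01.
Qed.

Lemma lam_eball r : 0 < r -> theta * volume (@eball R d.+1 r) = a * r ^+ d.+1.
Proof. by move=> r0; rewrite volume_eball//; ring. Qed.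

Lemma E_centered_rho r : 0 < r < 1 ->
  \int[P]_(w in [set w | rho w <= r]) ((N w)%:R - a) = r * tail_density a d k r.
Proof.
move=> /andP[r0 r1]; have r01 : 0 <= r <= 1 by rewrite !ltW.
rewrite (_ : [set w | _] = [set w | (k < count X (eball r) w)%N]).
  rewrite (E_centered_ge theta_gt0 PX r01) lam_eball// /tail_density exprS; ring.
by apply/seteqP; split => w /=; rewrite rho_le// ltW.
Qed.

Lemma E_centered_rho1 : \int[P]_(w in [set w | rho w <= 1]) ((N w)%:R - a) = 0.
Proof.
rewrite (_ : [set w | _] = setT); first exact: E_centered.
by apply/seteqP; split => // w _ /=; case/andP: (rho_itv w).
Qed.

Let hit w : R := (k < N w)%N%:R.

Lemma integrable_hit : integrable hit.
Proof.
apply: (integrable_dom theta_gt0 PX (C := 1)); first exact: (measurable_N PX (fun n => (k < n)%N%:R)).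
move=> w; rewrite mul1r /hit; case: (k < _)%N; rewrite ?normr1 ?normr0.
  by rewrite lerDl sqr_ge0.
by rewrite addr_ge0// sqr_ge0.
Qed.

Lemma pr_ge_tail r : 0 < r <= 1 ->
  fine (P [set w | (k < count X (eball r) w)%N]) = tail a d k r.
Proof.
move=> /andP[r0 r1]; have r01 : 0 <= r <= 1 by rewrite ltW.
have mC := measurable_Mlt PX r01 k.+1.
have -> : [set w | (k < count X (eball r) w)%N] = ~` [set w | (count X (eball r) w < k.+1)%N].
  by apply/seteqP; split => w /=; rewrite ltnS leqNgt => /negP; rewrite ?negbK.
rewrite probability_setC// (pr_M_lt PX r01) lam_eball//.
Qed.

(** Holds up to r = 1, unlike [rho_le]: [hit] discards the configurations where Y is 1 for lack of
    points. *)
Lemma E_hit_rho r : 0 < r <= 1 ->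
  \int[P]_(w in [set w | rho w <= r]) hit w = tail a d k r.
Proof.
move=> /andP[r0 r1]; rewrite -pr_ge_tail ?r0//.
have r01 : 0 <= r <= 1 by rewrite ltW.
have mM : measurable [set w | (k < count X (eball r) w)%N].
  rewrite (_ : [set w | _] = ~` [set w | (count X (eball r) w < k.+1)%N]).
    by apply: measurableC; exact: (measurable_Mlt PX r01).
  by apply/seteqP; split => w /=; rewrite ltnS leqNgt => /negP; rewrite ?negbK.
rewrite -[RHS]mul1r -Rintegral_cst// [LHS]Rintegral_mkcond [RHS]Rintegral_mkcond.
apply: eq_Rintegral => w _; rewrite !patchE /hit.
have MN : (count X (eball r) w <= N w)%N.
  by apply: (le_count PX); [exact: bounded_unit_ball|move=> x /le_trans; apply].
have [rl1|r1'] := ltP r 1.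
  have rE := @rho_le w r; rewrite ltW// rl1 in rE.
  case: (boolP (k < count X (eball r) w)%N) => kM.
    by rewrite !mem_set//= ?rE// (leq_trans kM MN).
  by rewrite !memNset//= ?rE//; apply/negP.
have re : r = 1 by apply/le_anti; rewrite r1.
rewrite re mem_set/=; last by case/andP: (rho_itv w).
by case: (boolP (k < N w)%N) => kN; [rewrite mem_set|rewrite memNset//=; apply/negP].
Qed.

Let h r : R := r ^+ 2 * g1 (r ^+ 2).

(** At the last mesh point the event is the whole space and contributes E[N - a] = 0 instead of the
    formula valid for r < 1. The sum on the right includes that formula at r = 1, and the first term
    takes it back; it vanishes as the mesh is refined. *)
Lemma E_step_centered n : \int[P]_w (step (fun r => g (r ^+ 2)) n w * ((N w)%:R - a)) =
  (g (mesh n n.+1 ^+ 2) - g (mesh n n ^+ 2)) * tail_density a d k 1 -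
  \sum_(q < n.+1) (g (mesh n q.+1 ^+ 2) - g (mesh n q ^+ 2)) *
    (mesh n q.+1 * tail_density a d k (mesh n q.+1)).
Proof.
rewrite E_step; last exact: integrable_centered.
have m1 : mesh n n.+1 = 1 by rewrite /mesh divff.
rewrite E_centered// mulr0 sub0r !big_ord_recr/= m1 E_centered_rho1 mulr0 addr0.
rewrite (eq_bigr (fun q : 'I_n => (g (mesh n q.+1 ^+ 2) - g (mesh n q ^+ 2)) *
    (mesh n q.+1 * tail_density a d k (mesh n q.+1)))) => [|q _]; first by ring.
congr (_ * _); apply: E_centered_rho.
by rewrite /mesh divr_gt0//= ltr_pdivrMr// mul1r ltr_nat ltnS.
Qed.

(** A summation by parts moves the increments from [h] to [tail], the form needed in
    [riemann_compare]. The boundary term at 0 vanishes with h(0), the one at 1 cancels against the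
    constant of [step]. *)
Lemma E_step_hit n : \int[P]_w (step h n w * hit w) =
  \sum_(q < n.+1) h (mesh n q) * (tail a d k (mesh n q.+1) - tail a d k (mesh n q)).
Proof.
rewrite E_step; last exact: integrable_hit.
have m1 : mesh n n.+1 = 1 by rewrite /mesh divff.
have h0 : h (mesh n 0) = 0 by rewrite /h /mesh mul0r expr0n mul0r.
have eT : \int[P]_w hit w = tail a d k (mesh n n.+1).
  rewrite m1 -E_hit_rho ?ltr01 ?lexx//.
  rewrite (_ : [set w | _] = setT)//; apply/seteqP; split => // w _ /=.
  by case/andP: (rho_itv w).
rewrite eT (eq_bigr (fun q : 'I_n.+1 => (h (mesh n q.+1) - h (mesh n q)) * tail a d k (mesh n q.+1))).
  have abel m : \sum_(q < m) (h (mesh n q.+1) - h (mesh n q)) * tail a d k (mesh n q.+1) =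
      h (mesh n m) * tail a d k (mesh n m) -
      \sum_(q < m) h (mesh n q) * (tail a d k (mesh n q.+1) - tail a d k (mesh n q)).
    elim: m => [|m IH]; first by rewrite !big_ord0 h0 mul0r subr0.
    by rewrite !big_ord_recr/= IH; ring.
  by rewrite abel m1; ring.
move=> q _; congr (_ * _); apply: E_hit_rho.
by rewrite /mesh divr_gt0//= ler_pdivrMr// mul1r ler_nat.
Qed.

Lemma covariance_Ystat :
  \int[P]_w (g (Y w) * ((N w)%:R - a)) =
  - (2 / d.+1%:R) * \int[P]_w (Y w * g1 (Y w) * (k < N w)%N%:R).
Proof.
have [cg cg1 _] := C1g.
have cid : {within `[0, 1], continuous (fun t : R => t)}.
  by apply: continuous_subspaceT => x; exact: cvg_id.
have ch : {within `[0, 1], continuous (fun t : R => t * g1 t)}.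
  by move=> t; apply: cvgM; [exact: cid|exact: cg1].
have [Bg Bg0 hBg] := C1_01_bound cg; have [Bh Bh0 hBh] := C1_01_bound ch.
have ctd : {within `[0, 1], continuous (tail_density a d k)}.
  by apply: continuous_subspaceT; exact: continuous_tail_density.
pose KZ := \int[P]_w `|(N w)%:R - a|; pose KH := \int[P]_w `|hit w|.
pose b : R := `|tail_density a d k 1|.
have iZ : integrable (fun w => (N w)%:R - a) by exact: integrable_centered.
have KZ0 : 0 <= KZ by apply: Rintegral_ge0.
have KH0 : 0 <= KH by apply: Rintegral_ge0.
have mY (f : R -> R) : {within `[0, 1], continuous f} -> measurable_fun setT (fun w => f (Y w)).
  by move=> cf; apply: (FW_measurable_fun PX); exact: (FW_measurable_Ystat_comp PX).
suff : forall e : R, 0 < e ->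
    `|\int[P]_w (g (Y w) * ((N w)%:R - a)) + 2 / d.+1%:R * \int[P]_w (h (rho w) * hit w)| <=
    e * (KZ + 2 / d.+1%:R * KH + b + 1).
  move=> H; have {}H : \int[P]_w (g (Y w) * ((N w)%:R - a)) +
      2 / d.+1%:R * \int[P]_w (h (rho w) * hit w) = 0.
    apply/eqP; rewrite -normr_le0; apply/ler_addgt0Pr => e e0; rewrite add0r.
    have c0 : 0 < KZ + 2 / d.+1%:R * KH + b + 1.
      by rewrite ltr_wpDl// !addr_ge0 ?mulr_ge0// ?invr_ge0// normr_ge0.
    have := H _ (divr_gt0 e0 c0).
    by rewrite divfK// gt_eqF.
  rewrite (_ : \int[P]_w (Y w * _ * _) = \int[P]_w (h (rho w) * hit w)).
    by rewrite mulNr; apply/eqP; rewrite -addr_eq0; apply/eqP.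
  by apply: eq_Rintegral => w _; rewrite /h sqr_rho.
move=> e e0.
have n1 := riemann_compare C1g (ltr0Sn R d) ctd (@tail_mvt R a d k) e0.
have n2 := step_close (unif_sqr cg e0).
have n3 := step_close (unif_sqr ch e0).
have [dl dl0 hdl] := unif_sqr cg e0.
have n4 : \forall n \near \oo, n.+1%:R^-1 < dl by exact: (near_infty_natSinv_lt (PosNum dl0)).
(* A single mesh satisfying all four estimates is enough for a given [e]. *)
have [n [[{}n1 {}n2] [{}n3 {}n4]]] := filter_ex (filterI (filterI n1 n2) (filterI n3 n4)).
have r1 : `|\int[P]_w (step (fun r => g (r ^+ 2)) n w * ((N w)%:R - a)) -
    \int[P]_w (g (Y w) * ((N w)%:R - a))| <= e * KZ.
  apply: (@Rintegral_close _ _ _ Bg) => //.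
  - exact: mY.
  - exact: measurable_step.
  - by move=> w; apply: hBg; exact: (Ystat_itv PX).
  - by move=> w; rewrite -sqr_rho; exact: n2.
have r2 : `|\int[P]_w (step h n w * hit w) - \int[P]_w (h (rho w) * hit w)| <= e * KH.
  apply: (@Rintegral_close _ _ _ Bh) => //.
  - rewrite (_ : (fun _ => _) = fun w => Y w * g1 (Y w)); first exact: (mY _ ch).
    by apply/funext => w; rewrite /h sqr_rho.
  - exact: measurable_step.
  - by move=> w; rewrite /h sqr_rho; apply: hBh; exact: (Ystat_itv PX).
  - exact: integrable_hit.
have r3 : `|g (mesh n n.+1 ^+ 2) - g (mesh n n ^+ 2)| <= e.
  apply: hdl; rewrite ?mesh_itv// /mesh -mulrBl -(natr1 n) addrAC subrr add0r mul1r.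
  by rewrite ger0_norm ?invr_ge0//; apply: ltW; rewrite natr1.
pose A := \sum_(q < n.+1) (g (mesh n q.+1 ^+ 2) - g (mesh n q ^+ 2)) *
    (mesh n q.+1 * tail_density a d k (mesh n q.+1)).
have r4 : `|A - 2 / d.+1%:R * \int[P]_w (step h n w * hit w)| <= e.
  rewrite E_step_hit mulr_sumr -sumrB; move: n1; rewrite (eq_bigr (fun q : 'I_n.+1 =>
    (g (mesh n q.+1 ^+ 2) - g (mesh n q ^+ 2)) *
    (mesh n q.+1 * tail_density a d k (mesh n q.+1)) - 2 / d.+1%:R *
    (h (mesh n q) * (tail a d k (mesh n q.+1) - tail a d k (mesh n q))))) => // q _.
  by rewrite [2 / _ * (h _ * _)]mulrA.
rewrite E_step_centered -/A in r1.
exact: (compare_bounds r1 r2 r3 r4 (divr_ge0 (ler0n _ 2) (ler0n _ d.+1))).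
Qed.

End covariance.

(** * The Stein estimator *)

Section logarithmic_derivative.
Context {R : realType}.
Variables phi phi1 phi2 : R -> R.
Hypothesis C2phi : C2_01 phi phi1 phi2.
Hypothesis phi_gt0 : forall t : R, 0 <= t <= 1 -> 0 < phi t.

Definition logsq (t : R) : R := ln (phi t ^+ 2).
Definition dlogsq (t : R) : R := 2 * phi1 t / phi t.
Definition score (t : R) : R := t * phi1 t / phi t.
Definition dscore (t : R) : R :=
  phi1 t / phi t + t * phi2 t / phi t - t * phi1 t ^+ 2 / phi t ^+ 2.

Lemma within_id : {within `[0, 1], continuous (fun t : R => t)}.
Proof. by apply: continuous_subspaceT => x; exact: cvg_id. Qed.

Lemma within_mul (f g : R -> R) : {within `[0, 1], continuous f} ->
  {within `[0, 1], continuous g} -> {within `[0, 1], continuous (fun t => f t * g t)}.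
Proof. by move=> cf cg t; apply: cvgM; [exact: cf|exact: cg]. Qed.

Lemma within_inv : {within `[0, 1], continuous (fun t => (phi t)^-1)}.
Proof.
have [cphi _ _ _] := C2phi; rewrite continuous_subspace_in => t.
rewrite inE/= in_itv/= => /phi_gt0 p0; apply: cvgV; last exact: cphi.
by rewrite gt_eqF.
Qed.

Lemma C1_logsq : C1_01 logsq dlogsq.
Proof.
have [cphi cphi1 _ dphi] := C2phi; split.
- rewrite continuous_subspace_in => t; rewrite inE/= in_itv/= => /phi_gt0 p0.
  apply: (@cvg_comp _ _ _ phi (fun x => ln (x ^+ 2)) _ (nbhs (phi t))); first exact: cphi.
  apply: (@continuous_comp _ _ _ (fun x : R => x ^+ 2) (@ln R)); first exact: exprn_continuous.
  by apply: continuous_ln; rewrite exprn_gt0.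
- rewrite (_ : dlogsq = fun t => (2 * phi1 t) * (phi t)^-1)//.
  apply: within_mul; last exact: within_inv.
  by move=> t; apply: cvgM; [exact: cvg_cst|exact: cphi1].
- move=> t t01; have [d1 _] := dphi t t01.
  have p0 : 0 < phi t.
    by apply: phi_gt0; move: t01; rewrite in_itv/= => /andP[/ltW -> /ltW].
  have d2 := is_derive_mul_fun d1 d1.
  have p2 : 0 < phi t * phi t by rewrite mulr_gt0.
  have d3 := @is_derive1_comp _ _ _ t _ _ (is_derive1_ln p2) d2.
  rewrite (_ : logsq = @ln R \o (fun x => phi x * phi x)); last first.
    by apply/funext => x; rewrite /logsq expr2.
  apply: (is_derive_eq d3); rewrite /dlogsq.
  by move: (lt0r_neq0 p0) => pn; field.
Qed.

Lemma C1_score (c : R) : C1_01 (fun t => c * score t) (fun t => c * dscore t).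
Proof.
have [cphi cphi1 cphi2 dphi] := C2phi; have ci := within_inv; have cid := within_id.
have cM := within_mul; have cc : {within `[0, 1], continuous (fun _ : R => c)} by move=> t; exact: cvg_cst.
split.
- by apply: (cM _ _ cc); apply: (cM _ _ (cM _ _ cid cphi1) ci).
- apply: (cM _ _ cc); rewrite (_ : dscore = fun t => phi1 t * (phi t)^-1 + t * phi2 t * (phi t)^-1 -
    t * (phi1 t * phi1 t) * ((phi t)^-1 * (phi t)^-1)); last first.
    by apply/funext => t; rewrite /dscore !expr2 invfM.
  have c1 := cM _ _ cphi1 ci; have c2 := cM _ _ (cM _ _ cid cphi2) ci.
  have c3 := cM _ _ (cM _ _ cid (cM _ _ cphi1 cphi1)) (cM _ _ ci ci).
  by move=> t; apply: cvgB; [apply: cvgD; [exact: c1|exact: c2]|exact: c3].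
- move=> t t01; have [d1 d2] := dphi t t01.
  have p0 : 0 < phi t.
    by apply: phi_gt0; move: t01; rewrite in_itv/= => /andP[/ltW -> /ltW].
  have pn := lt0r_neq0 p0.
  have h := is_derive_mul_fun (is_derive_cst c t 1)
    (is_derive_mul_fun (is_derive_mul_fun (is_derive_id t (1 : R)) d2) (is_deriveV pn d1)).
  apply: (is_derive_eq h); rewrite /dscore /GRing.scale/=.
  by field.
Qed.

End logarithmic_derivative.

Section main.
Context {R : realType} {d : nat}.
Context {disp : measure_display} {Omega : measurableType disp}.
Variables (P : probability Omega R) (X : Omega -> set 'rV[R]_d.+1) (theta : R).
Hypotheses (theta_gt0 : 0 < theta) (PX : poisson_process P X theta).
Variable V : 'I_d.+1 -> 'rV[R]_d.+1 -> R.
Hypothesis oV : orthonormal_bounded V.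
Variables (k : nat) (phi phi1 phi2 : R -> R).
Hypothesis C2phi : C2_01 phi phi1 phi2.
Hypothesis phi_gt0 : forall t : R, 0 <= t <= 1 -> 0 < phi t.
Hypothesis phi1_1 : phi1 1 = 0.
Local Notation W := (@unit_ball R d.+1).
Local Notation N := (count X W).
Local Notation Y := (Ystat X k.+1).
Local Notation a := (theta * volume W).
Local Notation volW := (volume W).
Local Notation D := (d.+1%:R : R).
Local Notation integrable Z := (P.-integrable setT (EFin \o Z)).
Local Notation kk := (k.+1).

Definition zeta0 w : R := - (4 / D) * score phi phi1 (Y w).

Let C1g := C1_score C2phi phi_gt0 (- (4 / D)).
Let C1psi := C1_logsq C2phi phi_gt0.
Let Y01 w : 0 <= Y w <= 1 := Ystat_itv PX (ltn0Sn k) w.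

Lemma logFE w : ln (Fk X kk phi w) = logsq phi (Y w).
Proof. by rewrite /Fk sqrtF_Ystat. Qed.

Lemma hit_Ystat w : (k < N w)%N = false -> Y w = 1.
Proof. by rewrite /Ystat => ->. Qed.

Lemma zeta0E w : - D^-1 * lim_euler X kk (dlogsq phi phi1) w = zeta0 w.
Proof.
have pn := lt0r_neq0 (phi_gt0 (Y01 w)).
rewrite /zeta0 /lim_euler /score /dlogsq; case: (boolP (k < N w)%N) => kN.
  rewrite mulr1; have : D != 0 by rewrite pnatr_eq0.
  by move: D => x xn; field; rewrite xn pn.
(* With too few points Y = 1, where [phi1] vanishes: the indicator of [lim_euler] is absorbed. *)
rewrite (hit_Ystat (negbTE kN)) phi1_1; ring.
Qed.

Lemma in_L2_zeta0 : in_L2 P X zeta0.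
Proof. by have [cg _ _] := C1g; exact: (in_L2_Ystat PX (ltn0Sn k) cg). Qed.

Lemma closure_nabla_zeta0 : closure_nabla P X V (fun w => ln (Fk X kk phi w)) zeta0.
Proof.
have [cpsi _ _] := C1psi; rewrite (_ : (fun _ => _) = fun w => logsq phi (Y w)); last first.
  by apply/funext => w; exact: logFE.
split; [exact: (in_L2_Ystat PX (ltn0Sn k) cpsi)|exact: in_L2_zeta0|].
exists (fun l => approx_form (logsq phi) kk l).
  exact: (approx_form_approx_Dom theta_gt0 PX (ltn0Sn d) oV (ltn0Sn k) C1psi).
have := nabla_approx_cvg theta_gt0 PX (ltn0Sn d) oV (ltn0Sn k) C1psi.
by rewrite (_ : (fun w => _) = zeta0)//; apply/funext => w; exact: zeta0E.
Qed.

Lemma measurable_L2 (Z : Omega -> R) : in_L2 P X Z -> measurable_fun setT Z.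
Proof. by case=> mZ _; exact: (FW_measurable_fun PX). Qed.

Lemma closure_nabla_unique zeta : closure_nabla P X V (fun w => ln (Fk X kk phi w)) zeta ->
  {ae P, forall w, zeta w = zeta0 w}.
Proof.
move=> [F2 z2 [f [Df fF _] fz]]; have [_ z02 [f0 [Df0 f0F _] f0z]] := closure_nabla_zeta0.
apply: (nabla_unique PX (ltn0Sn d) oV Df Df0 _ _ _ fF f0F fz f0z); exact: measurable_L2.
Qed.

Lemma E_ae_eq (Z Z' : Omega -> R) : measurable_fun setT Z -> measurable_fun setT Z' ->
  {ae P, forall w, Z w = Z' w} -> ('E_P[Z] = 'E_P[Z'])%E.
Proof.
move=> mZ mZ' e; rewrite unlock; apply: ae_eq_integral => //; try exact/measurable_EFinP.
by apply: filterS e => w ew _; rewrite ew.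
Qed.

(** L^2 convergence does not distinguish versions, so the sequence approximating [zeta0], itself a
    C^1 function of Y, also approximates [zeta]. *)
Lemma in_closure_Dom_zeta zeta : in_L2 P X zeta -> {ae P, forall w, zeta w = zeta0 w} ->
  in_closure_Dom P X V zeta.
Proof.
move=> z2 ez; split=> //.
have [_ [f [Df fF fU]]] := in_closure_Ystat theta_gt0 PX (ltn0Sn d) oV (ltn0Sn k) C1g.
exists f; split=> //; have mz := measurable_L2 z2; have mz0 := measurable_L2 in_L2_zeta0.
have mf l : measurable_fun setT (functional X (f l)).
  have [sf C1f _] := DomD_regular (Df l).
  by apply: (measurable_functional PX) => //; exact: C1_continuous.
rewrite /cvg_L2 (_ : (fun l => _) = fun l => 'E_P[fun w => ((functional X (f l) w - zeta0 w) ^+ 2)%R]%E)//.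
apply/funext => l; apply: E_ae_eq.
- by apply: measurable_funX; exact: measurable_funB.
- by apply: measurable_funX; exact: measurable_funB.
- by apply: filterS ez => w ->.
Qed.

End main.

(** * Mean squared error and gain *)

Section risk.
Context {R : realType} {d : nat}.
Context {disp : measure_display} {Omega : measurableType disp}.
Variables (P : probability Omega R) (X : Omega -> set 'rV[R]_d.+1) (theta : R).
Hypotheses (theta_gt0 : 0 < theta) (PX : poisson_process P X theta).
Variables (k : nat) (phi phi1 phi2 : R -> R).
Hypothesis C2phi : C2_01 phi phi1 phi2.
Hypothesis phi_gt0 : forall t : R, 0 <= t <= 1 -> 0 < phi t.
Hypothesis phi1_1 : phi1 1 = 0.
Local Notation W := (@unit_ball R d.+1).
Local Notation N := (count X W).
Local Notation Y := (Ystat X k.+1).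
Local Notation a := (theta * volume W).
Local Notation volW := (volume W).
Local Notation D := (d.+1%:R : R).
Local Notation integrable Z := (P.-integrable setT (EFin \o Z)).
Local Notation z0 := (zeta0 X k phi phi1).
Local Notation hit w := ((k < N w)%N%:R : R).
Local Notation Gf := (gain_fun phi phi1 phi2).

Let Y01 w : 0 <= Y w <= 1 := Ystat_itv PX (ltn0Sn k) w.
Let C1g := C1_score C2phi phi_gt0 (- (4 / D)).

Lemma E_Rintegral (Z : Omega -> R) : integrable Z -> ('E_P[Z] = (\int[P]_w Z w)%:E)%E.
Proof.
by move=> iZ; rewrite unlock /Rintegral fineK//; exact: integrable_fin_num.
Qed.

Lemma measurable_Y (f : R -> R) : {within `[0, 1], continuous f} ->
  measurable_fun setT (fun w => f (Y w)).
Proof. by move=> cf; apply: (FW_measurable_fun PX); exact: (FW_measurable_Ystat_comp PX). Qed.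

Lemma integrable_Y_hit (f : R -> R) : {within `[0, 1], continuous f} ->
  integrable (fun w => f (Y w) * hit w).
Proof.
move=> cf; have [B _ hB] := C1_01_bound cf.
apply: (integrable_mulb (measurable_Y cf) _ (integrable_hit theta_gt0 PX k)) => w.
exact: hB.
Qed.

Lemma within_gain : {within `[0, 1], continuous Gf}.
Proof.
have [_ cphi1 cphi2 _] := C2phi.
have ci := within_inv C2phi phi_gt0; have cid := @within_id R.
have c1 : {within `[0, 1], continuous (fun t : R => phi1 t + t * phi2 t)}.
  by move=> t; apply: cvgD; [exact: cphi1|exact: (within_mul cid cphi2)].
have c2 : {within `[0, 1], continuous (fun t : R => - t)}.
  by move=> t; apply: cvgN; exact: cid.
exact: (within_mul (within_mul c2 c1) ci).
Qed.

(** For s = t phi'/phi, the term - t^2 phi'^2 / phi^2 of t s' is cancelled by s^2. This is how the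
    cross term and the square of the correction combine into the gain function. *)
Lemma gain_pointwise t : 0 <= t <= 1 ->
  t * dscore phi phi1 phi2 t + score phi phi1 t ^+ 2 = - Gf t.
Proof.
move=> /phi_gt0/lt0r_neq0 pn; rewrite /dscore /score /gain_fun; by field.
Qed.

(** [zeta0] vanishes when N <= k, so the indicator can be inserted here. It cannot be removed from
    the covariance term, because [dscore] at 1 is phi2 1 / phi 1. *)
Lemma sqr_zeta0 w : z0 w ^+ 2 = 16 / D ^+ 2 * (score phi phi1 (Y w) ^+ 2 * hit w).
Proof.
rewrite /zeta0; have : D != 0 by rewrite pnatr_eq0.
case: (boolP (k < N w)%N) => kN; first by move: D => x xn; rewrite mulr1; field.
by move=> _; rewrite (hit_Ystat (negbTE kN)) /score phi1_1 mulr0 mul0r !mulr0 expr0n.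
Qed.

Lemma risk_zeta0 : \int[P]_w (((N w)%:R - a + z0 w) ^+ 2) =
  a - 16 / D ^+ 2 * \int[P]_w (Gf (Y w) * hit w).
Proof.
have [cg cg1 _] := C1g; have [B B0 hB] := C1_01_bound cg.
have mz : measurable_fun setT z0 by exact: (measurable_Y cg).
have zB w : `|z0 w| <= B by exact: hB.
have icz : integrable (fun w => z0 w * ((N w)%:R - a)).
  exact: (integrable_mulb mz zB (integrable_centered theta_gt0 PX)).
have cid := @within_id R.
have iYg : integrable (fun w => Y w * (- (4 / D) * dscore phi phi1 phi2 (Y w)) * hit w).
  exact: (integrable_Y_hit (within_mul cid cg1)).
have isz : integrable (fun w => z0 w ^+ 2).
  rewrite (_ : (fun _ => _) = fun w => z0 w * z0 w); last by apply/funext => w; rewrite expr2.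
  apply: (integrable_mulb mz zB); apply: (@integrable_dom _ _ _ _ P X theta theta_gt0 PX _ B) => // w.
  have := sqr_ge0 ((N w)%:R : R); move: (zB w) B0; move: (`|z0 w|) (_ ^+ 2) => *; nra.
have iG := integrable_Y_hit within_gain.
have i2 : integrable (fun w => 2 * (z0 w * ((N w)%:R - a))).
  by have := integrableZl measurableT 2 icz.
transitivity (\int[P]_w ((((N w)%:R - a) ^+ 2 + 2 * (z0 w * ((N w)%:R - a))) + z0 w ^+ 2)).
  by apply: eq_Rintegral => w _; ring.
have ics := integrable_centered_sqr theta_gt0 PX.
have i3 : integrable (fun w => ((N w)%:R - a) ^+ 2 + 2 * (z0 w * ((N w)%:R - a))).
  exact: integrableD_EFin.
rewrite !RintegralD// E_centered_sqr// RintegralZl//.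
have -> := covariance_Ystat theta_gt0 PX k C1g.
have i4 : integrable (fun w => 4 / D * (Y w * (- (4 / D) * dscore phi phi1 phi2 (Y w)) * hit w)).
  by have := integrableZl measurableT (4 / D) iYg.
have i5 : integrable (fun w => 16 / D ^+ 2 * (Gf (Y w) * hit w)).
  by have := integrableZl measurableT (16 / D ^+ 2) iG.
(* The square is expressed through the covariance integral so that the latter cancels against twice
   the cross term. *)
have -> : \int[P]_w (z0 w ^+ 2) =
    4 / D * \int[P]_w (Y w * (- (4 / D) * dscore phi phi1 phi2 (Y w)) * hit w) -
    16 / D ^+ 2 * \int[P]_w (Gf (Y w) * hit w).
  rewrite -!RintegralZl// -RintegralB//; apply: eq_Rintegral => w _.
  have -> : Gf (Y w) = - (Y w * dscore phi phi1 phi2 (Y w) + score phi phi1 (Y w) ^+ 2).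
    by rewrite gain_pointwise// opprK.
  rewrite sqr_zeta0; have : D != 0 by rewrite pnatr_eq0.
  by move: D (hit w) => x y xn; field.
have : D != 0 by rewrite pnatr_eq0.
by move: D (\int[P]_w _) (\int[P]_w _) => x I J xn; field.
Qed.

Lemma volW_gt0 : 0 < volW.
Proof. exact: volume_unit_ball_gt0. Qed.

Lemma theta_MLE_error w : theta_MLE X w - theta = ((N w)%:R - a) / volW.
Proof. by rewrite /theta_MLE; move: (lt0r_neq0 volW_gt0) => v0; field. Qed.

Lemma MSE_theta_MLE : (MSE P theta (theta_MLE X) = (theta / volW)%:E)%E.
Proof.
rewrite /MSE; under [X in expectation _ X]eq_fun do rewrite theta_MLE_error expr_div_n mulrC.
have i1 := integrable_centered_sqr theta_gt0 PX.
rewrite E_Rintegral; last by have := integrableZl measurableT (volW ^+ 2)^-1 i1.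
rewrite RintegralZl// E_centered_sqr//; congr EFin.
by move: (lt0r_neq0 volW_gt0) => v0; field.
Qed.

Lemma MSE_stein zeta : measurable_fun setT zeta -> {ae P, forall w, zeta w = z0 w} ->
  (MSE P theta (stein X zeta) = (theta / volW - 16 / (D ^+ 2 * volW ^+ 2) *
    \int[P]_w (Gf (Y w) * hit w))%:E)%E.
Proof.
move=> mz ez; have [cg cg1 _] := C1g; have [B B0 hB] := C1_01_bound cg.
have mz0 : measurable_fun setT z0 by exact: (measurable_Y cg).
have mN : measurable_fun setT (fun w => (N w)%:R - a) := measurable_N PX (fun n => n%:R - a).
have sE z w : stein X z w - theta = ((N w)%:R - a + z w) / volW.
  by rewrite /stein mulrDl -theta_MLE_error addrAC.
rewrite /MSE (@E_ae_eq _ _ _ P _ (fun w => (volW ^+ 2)^-1 * ((N w)%:R - a + z0 w) ^+ 2)).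
- have iq : integrable (fun w => ((N w)%:R - a + z0 w) ^+ 2).
    apply: (@integrable_dom _ _ _ _ P X theta theta_gt0 PX _ (3 * (1 + a ^+ 2 + B ^+ 2))).
      by apply: measurable_funX; exact: measurable_funD.
    move=> w; rewrite ger0_norm ?sqr_ge0//.
    have z2 : z0 w ^+ 2 <= B ^+ 2.
      by rewrite -real_normK ?num_real// ler_sqr ?nnegrE ?(ltW B0)//; exact: hB.
    apply: (@le_trans _ _ (3 * ((N w)%:R ^+ 2 + a ^+ 2 + z0 w ^+ 2))).
      have := sqr_ge0 ((N w)%:R + a); have := sqr_ge0 ((N w)%:R - z0 w).
      by have := sqr_ge0 (a + z0 w); nra.
    have n2 : 0 <= (N w)%:R ^+ 2 :> R by rewrite sqr_ge0.
    have q2 : 0 <= a ^+ 2 + B ^+ 2 by rewrite addr_ge0 ?sqr_ge0.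
    by move: n2 q2 z2; move: (_%:R ^+ 2) (a ^+ 2) (B ^+ 2) (z0 w ^+ 2) => *; nra.
  rewrite E_Rintegral; last by have := integrableZl measurableT (volW ^+ 2)^-1 iq.
  rewrite RintegralZl// risk_zeta0; congr EFin.
  have : D != 0 by rewrite pnatr_eq0.
  by move: (lt0r_neq0 volW_gt0) => v0; move: D => x xn; field; rewrite ?xn ?v0.
- apply: measurable_funX; rewrite (_ : (fun _ => _) = fun w => ((N w)%:R - a + zeta w) / volW).
    by apply: measurable_funM => //; exact: measurable_funD.
  by apply/funext => w; exact: sE.
- by apply: measurable_funM => //; apply: measurable_funX; exact: measurable_funD.
- by apply: filterS ez => w e; rewrite sE e expr_div_n mulrC.
Qed.

(* With at most [k] points in the space, [kth_closest k.+1] is the junk value 0. *)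
Lemma Yk_few w : (forall q : nat, (count X (eball q%:R) w <= k)%N) ->
  Yk X k.+1 w = 0 /\ kth_in_ball X k.+1 w = 1 :> R.
Proof.
move=> hq; suff e : enorm (kth_closest k.+1 (X w)) = 0.
  by rewrite /Yk /kth_in_ball e ler01 expr0n/= sub0r mulr1 subrr.
rewrite /kth_closest xgetPN => [|x [_ /andP[_ h]]].
  by rewrite /enorm /dotp big1 ?sqrtr0// => j _; rewrite mxE mul0r.
have := hq (Num.trunc (enorm x)).+1; rewrite leqNgt => /negP; apply.
apply: (leq_trans h); apply: (le_npointsI (B := eball (enorm x))); last exact: (finite_points_ball PX).
by move=> y /le_trans; apply; apply: ltW; exact: truncnS_gt.
Qed.

(** Expectations of almost surely equal variables are compared through measurability of both. [Yk]
    depends on points outside W, and on the event [E] of at most k points in the whole space it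
    takes its junk value, hence the case distinction. *)
Lemma measurable_gain_Yk : measurable_fun setT
  (fun w => Gf (Yk X k.+1 w) * kth_in_ball X k.+1 w).
Proof.
pose E := \bigcap_q [set w | (count X (eball q%:R) w < k.+1)%N].
have mE : measurable E.
  apply: bigcapT_measurable => q.
  have bB : bounded_set (@eball R d.+1 q%:R) by exact: (@bounded_eball _ _ q%:R).
  by have [] := pr_count_lt PX k.+1 (@measurable_eball R d.+1 q%:R) bB.
have mGY := measurable_Y within_gain.
rewrite (_ : (fun _ => _) = fun w => Gf 0 * \1_E w + Gf (Y w) * hit w * \1_(~` E) w).
  apply: measurable_funD; apply: measurable_funM => //.
  - by apply: measurable_funM => //; exact: (measurable_N PX (fun n => (k < n)%N%:R)).
  - exact/measurable_indic/measurableC.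
apply/funext => w; rewrite !indicE in_setC; have [wE|wE] := boolP (w \in E).
  have [|-> ->] := @Yk_few w; last by rewrite mulr0 addr0.
  by move=> q; have := set_mem wE q I; rewrite /= ltnS.
have [q hq] : exists q : nat, (k.+1 <= count X (eball q%:R) w)%N.
  apply: contrapT => h; move/negP: wE; apply; rewrite inE => q _ /=.
  by rewrite ltnNge; apply/negP => hq; apply: h; exists q.
have [-> ->] := Yk_Ystat PX (ltn0Sn k) hq.
by rewrite mulr0 add0r mulr1.
Qed.

Lemma E_gain_Yk : ('E_P[fun w => (Gf (Yk X k.+1 w) * kth_in_ball X k.+1 w)%R] =
  (\int[P]_w (Gf (Y w) * hit w))%:E)%E.
Proof.
have iG := integrable_Y_hit within_gain; rewrite -E_Rintegral//; apply: E_ae_eq.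
- exact: measurable_gain_Yk.
- by apply/measurable_EFinP; case/integrableP: iG.
- by apply: filterS (ae_Yk theta_gt0 PX (ltn0Sn k) (ltn0Sn d)) => w [-> ->].
Qed.

End risk.

Lemma C2_gt0 (R : realType) (phi : R -> R) : (forall t, t \in `[0, 1] -> 0 <= phi t) ->
  0 < inf (phi @` `[0, 1]) -> forall t : R, 0 <= t <= 1 -> 0 < phi t.
Proof.
move=> p0 pinf t t01; apply: lt_le_trans pinf _; apply: ge_inf; last by exists t; rewrite //= in_itv.
by exists 0 => _ [x x01 <-]; exact: p0.
Qed.

Theorem proposition4p3 (R : realType) (d : nat)
    (disp : measure_display) (Omega : measurableType disp)
    (P : probability Omega R) (X : Omega -> set 'rV[R]_d) (theta : R)
    (V : 'I_d -> 'rV[R]_d -> R)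
    (k : nat) (phi phi1 phi2 : R -> R) :
  (0 < d)%N -> 0 < theta -> poisson_process P X theta ->
  orthonormal_bounded V ->
  (1 <= k)%N -> C2_01 phi phi1 phi2 ->
  (forall t, t \in `[0, 1] -> 0 <= phi t) -> 0 < inf (phi @` `[0, 1]) ->
  phi1 1 = 0 ->
  let volW := volume (@unit_ball R d) in
  let logF := fun w => ln (Fk X k phi w) in
  let Y := Yk X k in
  let G := gain_fun phi phi1 phi2 in
  (exists zeta, closure_nabla P X V logF zeta) /\
  (forall zeta, closure_nabla P X V logF zeta ->
   [/\ in_closure_Dom P X V zeta,
       {ae P, forall w, stein X zeta w =
          theta_MLE X w - 4 / (d%:R * volW) * (Y w * phi1 (Y w) / phi (Y w))},
       MSE P theta (stein X zeta) =
         (MSE P theta (theta_MLE X) -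
          (16 / (d%:R ^+ 2 * volW ^+ 2))%:E *
            'E_P[fun w => (G (Y w) * kth_in_ball X k w)%R])%E,
       gain P X theta (stein X zeta) =
         16 / (theta * d%:R ^+ 2 * volW) *
           fine 'E_P[fun w => (G (Y w) * kth_in_ball X k w)%R]%E &
       phi2 1 = 0 ->
         MSE P theta (stein X zeta) =
           (MSE P theta (theta_MLE X) -
            (16 / (d%:R ^+ 2 * volW ^+ 2))%:E * 'E_P[fun w => G (Y w)])%E /\
         gain P X theta (stein X zeta) =
           16 / (theta * d%:R ^+ 2 * volW) * fine 'E_P[fun w => G (Y w)]%E]).
Proof.
case: d X V => // d X V _ th0 PX oV; case: k => // k _ C2phi p0 pinf phi1_1 volW logF Y G.
have pgt0 := C2_gt0 p0 pinf; have v0 : 0 < volW := volW_gt0.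
split; first by exists (zeta0 X k phi phi1); exact: (closure_nabla_zeta0 th0 PX oV k C2phi pgt0 phi1_1).
move=> zeta cz; have ez := closure_nabla_unique th0 PX oV C2phi pgt0 phi1_1 cz.
have [_ z2 _] := cz; have mz := measurable_L2 PX z2.
have eM := MSE_stein th0 PX C2phi pgt0 phi1_1 mz ez; have eM0 := MSE_theta_MLE th0 PX.
have eG := E_gain_Yk th0 PX k C2phi pgt0.
have M : MSE P theta (stein X zeta) =
    (MSE P theta (theta_MLE X) - (16 / (d.+1%:R ^+ 2 * volW ^+ 2))%:E *
       'E_P[fun w => (G (Y w) * kth_in_ball X k.+1 w)%R])%E.
  by rewrite eM eM0 eG -EFinM -EFinB.
have Gn : gain P X theta (stein X zeta) =
    16 / (theta * d.+1%:R ^+ 2 * volW) * fine 'E_P[fun w => (G (Y w) * kth_in_ball X k.+1 w)%R]%E.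
  rewrite /gain eM eM0 eG/= -/volW opprB addrC subrK.
  have : d.+1%:R != 0 :> R by rewrite pnatr_eq0.
  move: (lt0r_neq0 v0) (lt0r_neq0 th0); move: (\int[P]_w _) (d.+1%:R : R) => I x vn tn xn.
  by field; rewrite ?vn ?tn ?xn.
split=> //.
- exact: (in_closure_Dom_zeta th0 PX oV C2phi pgt0 z2 ez).
- apply: filterS2 ez (ae_Yk th0 PX (ltn0Sn k) (ltn0Sn d)) => w zw [eY _].
  rewrite /stein zw /Y eY /zeta0 /score -/volW.
  have : d.+1%:R != 0 :> R by rewrite pnatr_eq0.
  have := lt0r_neq0 (pgt0 _ (Ystat_itv PX (ltn0Sn k) w)).
  move: (lt0r_neq0 v0); move: (d.+1%:R : R) => x vn pn xn.
  by field; rewrite ?vn ?pn ?xn.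
(* Off the event that the k-th point is in the ball, Y = 1, where the gain function is 0 because
   both derivatives vanish. *)
- move=> phi2_1; suff E w : G (Y w) * kth_in_ball X k.+1 w = G (Y w).
    by move: M Gn; under [X in expectation _ X]eq_fun do rewrite E.
  rewrite /Y /Yk /kth_in_ball; case: (_ <= 1); first by rewrite mulr1.
  by rewrite !mulr0 addr0 /G /gain_fun phi1_1 phi2_1 mulr0 addr0 mulr0 mul0r.
Qed.
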